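(* Let $\ell$ be a positive integer and let $Y(qx)=A(x)Y(x)$ be a $q$-difference system of order $\mu$ in the class $\mathcal H_q^\ell$ which is in normal form. Then there exists a matrix $H(x)\in Gl_\mu(E_0')\cap M_{\mu\times\mu}(E_0)$ such that: (i) $H(0)\in Gl_\mu(K)$ and $|H(0)|=|H(0)^{-1}|=1$; (ii) $A_{[H]}(x):=H(qx)A(x)H(x)^{-1}=F(x^{p^\ell})$ for some matrix $F$; (iii) the eigenvalues of $A(0)$ and $F(0)$ coincide. Moreover the $q^{p^\ell}$-difference system $V(q^{p^\ell}X)=F(X)V(X)$ in the variable $X=x^{p^\ell}$ satisfies (iv) $\chi(F,q^{p^\ell})=\chi(A,q)^{p^\ell}$ and (v) $F(X)\in Gl_\mu(E_0)$.
   Context: $K$ is an algebraically closed field of characteristic $0$, complete for a non-archimedean absolute value with $|p|=p^{-1}$. $q\in K$ satisfies $|q|=1$, $q$ is not a root of unity, its reduction is algebraic over $\mathbb F_p$, and moreover $|1-q|<|\pi|=|\pi_q|$, where $\pi^{p-1}=-p$ and $\pi_q\in K$ is an element with $|\pi_q|=\lim_n|[n]_q^!|^{1/n}$ ($[n]_q=1+\dots+q^{n-1}$, $[n]_q^!=[1]_q\cdots[n]_q$). $d_qf(x)=\frac{f(qx)-f(x)}{(q-1)x}$. $E_0$ (analytic elements on $D(0,1^-)$) is the completion, for the norm $\|f\|=\sup_{|x|<1}|f(x)|$, of the ring of rational functions in $K(x)$ without poles in $D(0,1^-)$; it is identified with a ring of bounded analytic functions on $D(0,1^-)$ by Taylor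 expansion at $0$; $E_0'$ is its fraction field. Generic radius: let $\Omega/K$ be a complete algebraically closed extension with value group $\mathbb R_{\ge0}$ and residue field transcendental over that of $K$, containing $t$ transcendental over $K$ with $|\sum a_it^i/\sum b_jt^j|=\sup|a_i|/\sup|b_j|$. For a system $Y(qx)=A(x)Y(x)$ set $G_0=\mathbb I_\mu$, $G_1=\frac{A(x)-\mathbb I_\mu}{(q-1)x}$, $G_{n+1}(x)=G_n(qx)G_1(x)+d_q(G_n)(x)$, and $\chi(A,q)=\inf\big(1,\liminf_n|G_n(t)/[n]_q^!|^{-1/n}\big)$ (matrix norm = max of entries); $\chi(F,q^{p^\ell})$ is defined in the same way with $q^{p^\ell}$ in place of $q$ and $X$ in place of $x$. A $q$-orbit $q^{\mathbb Z}\xi\subset D(0,1^-)$ is ordinary (resp. an apparent singularity) if the system has a solution in $Gl_\mu(\mathcal A_{D'})$ (resp. $Gl_\mu(\mathcal M_{D'})$), where $D'=\bigcup_{i=0}^{n_0-1}D(q^i\zeta,\eta^-)$ is a $q$-invariant analytic domain containing $\xi$, with $\mathcal A_{D'},\mathcal M_{D'}$ analytic resp. meromorphic functions on $D'$. The class $\mathcal H_q^\ell$ consists of systems $Y(qx)=A(x)Y(x)$ with: (1) $A\in Gl_\mu(E_0')$; (2) $A$ analytic at $0$ and $A(0)\in Gl_\mu(K)$; (3) at worst apparent singularities in $D(0,1^-)\setminus\{0\}$; (4) $\chi(A,q)>|\pi_q|^{1/p^{\ell-1}}$. Such a system is in normal form if moreover $A\in Gl_\mu(E_0)$, any two eigenvalues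 $\lambda_1,\lambda_2$ of $A(0)$ satisfy $\lambda_1=\lambda_2$ or $\lambda_1\notin\lambda_2q^{\mathbb Z}$, and every eigenvalue $\lambda$ of $A(0)$ satisfies $|\frac{\lambda-1}{q-1}|<p^{1-\ell}$. *)

(* Defs.v *)
From HB Require Import structures.
From mathcomp Require Import all_boot all_order all_algebra.
From mathcomp Require Import all_classical all_reals all_analysis.

Set Implicit Arguments.
Unset Strict Implicit.
Unset Printing Implicit Defensive.

Import Order.TTheory GRing.Theory Num.Theory.
Import numFieldNormedType.Exports.
Local Open Scope classical_set_scope.
Local Open Scope ring_scope.

(* fps K is the ring K[[x]], so that {fraction fps K} is the field K((x)) *)

Record fps (K : fieldType) := Fps { fcoef : nat -> K }.

Section FormalPowerSeries.
Variable K : fieldType.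
Implicit Types f g h : fps K.

Lemma fpsP f g : fcoef f =1 fcoef g -> f = g.
Proof. by case: f g => [f] [g] /= /funext ->. Qed.

HB.instance Definition _ := gen_eqMixin (fps K).
HB.instance Definition _ := gen_choiceMixin (fps K).

Definition fps_of_poly (P : {poly K}) : fps K := Fps (fun n => P`_n).
Definition fps_add f g := Fps (fun n => fcoef f n + fcoef g n).
Definition fps_opp f := Fps (fun n => - fcoef f n).
Definition fps_mul f g :=
  Fps (fun n => \sum_(i < n.+1) fcoef f i * fcoef g (n - i)).
Definition fps_trunc (n : nat) f : {poly K} := \poly_(i < n) fcoef f i.

Lemma fps_addA : associative fps_add.
Proof. by move=> f g h; apply: fpsP => n /=; rewrite addrA. Qed.
Lemma fps_addC : commutative fps_add.
Proof. by move=> f g; apply: fpsP => n /=; rewrite addrC. Qed.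
Lemma fps_add0 : left_id (fps_of_poly 0) fps_add.
Proof. by move=> f; apply: fpsP => n /=; rewrite coef0 add0r. Qed.
Lemma fps_addN : left_inverse (fps_of_poly 0) fps_opp fps_add.
Proof. by move=> f; apply: fpsP => n /=; rewrite coef0 addNr. Qed.

HB.instance Definition _ :=
  GRing.isZmodule.Build (fps K) fps_addA fps_addC fps_add0 fps_addN.

Lemma fps_mul_trunc f g n m : (n < m)%N ->
  fcoef (fps_mul f g) n = (fps_trunc m f * fps_trunc m g)`_n.
Proof.
move=> nm; rewrite coefM /=; apply: eq_bigr => i _.
by rewrite !coef_poly (leq_ltn_trans (leq_subr i n) nm)
           (leq_ltn_trans (leq_ord i) nm).
Qed.

Lemma coefM_eq (P P' Q Q' : {poly K}) n :
  (forall i, (i <= n)%N -> P`_i = P'`_i) ->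
  (forall i, (i <= n)%N -> Q`_i = Q'`_i) -> (P * Q)`_n = (P' * Q')`_n.
Proof.
move=> eP eQ; rewrite !coefM; apply: eq_bigr => i _.
by rewrite eP ?leq_ord// eQ// leq_subr.
Qed.

Lemma fps_trunc_mul f g n i : (i < n)%N ->
  (fps_trunc n (fps_mul f g))`_i = (fps_trunc n f * fps_trunc n g)`_i.
Proof. by move=> lin; rewrite coef_poly lin; exact: fps_mul_trunc. Qed.

Lemma fps_mulC : commutative fps_mul.
Proof.
by move=> f g; apply: fpsP => n; rewrite !(@fps_mul_trunc _ _ n n.+1)// mulrC.
Qed.

Lemma fps_mulA : associative fps_mul.
Proof.
move=> f g h; apply: fpsP => n; rewrite !(@fps_mul_trunc _ _ n n.+1)//.
transitivity (fps_trunc n.+1 f * (fps_trunc n.+1 g * fps_trunc n.+1 h))`_n.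
  by apply: coefM_eq => // i lin; rewrite fps_trunc_mul.
by rewrite mulrA; apply: coefM_eq => // i lin; rewrite fps_trunc_mul.
Qed.

Lemma fps_mul1 : left_id (fps_of_poly 1) fps_mul.
Proof.
move=> f; apply: fpsP => n /=; rewrite big_ord_recl /= coef1 mul1r subn0.
by rewrite big1 ?addr0// => i _; rewrite coef1 mul0r.
Qed.

Lemma fps_mulDl : left_distributive fps_mul fps_add.
Proof.
move=> f g h; apply: fpsP => n /=; rewrite -big_split /=.
by apply: eq_bigr => i _; rewrite mulrDl.
Qed.

Lemma fps_1neq0 : fps_of_poly 1 != 0.
Proof.
apply/eqP => /(congr1 (fun f => fcoef f 0)) /=.
by rewrite coef1 coef0; apply/eqP; rewrite oner_eq0.
Qed.

HB.instance Definition _ := GRing.Zmodule_isComNzRing.Build (fps K)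
  fps_mulA fps_mulC fps_mul1 fps_mulDl fps_1neq0.

Definition fps_unit : pred (fps K) := fun f => `[< exists g, g * f = 1 >].
Definition fps_inv f : fps K :=
  if fps_unit f then xget 0 [set g | g * f = 1] else f.

Lemma fps_mulV : {in fps_unit, left_inverse 1 fps_inv *%R}.
Proof.
move=> f fu; rewrite /fps_inv -topredE /= in fu *; rewrite fu.
by case/asboolP: fu => g gf1; have := xgetI 0 (gf1 : [set g | g * f = 1] g).
Qed.

Lemma fps_unitP f g : g * f = 1 -> fps_unit f.
Proof. by move=> gf1; apply/asboolP; exists g. Qed.

Lemma fps_inv_out : {in [predC fps_unit], fps_inv =1 id}.
Proof. by move=> f; rewrite inE /= /fps_inv -topredE /= => /negbTE ->. Qed.

HB.instance Definition _ := GRing.ComNzRing_hasMulInverse.Build (fps K)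
  fps_mulV fps_unitP fps_inv_out.

Lemma fps_ord f : f != 0 ->
  exists2 n, fcoef f n != 0 & forall i, (i < n)%N -> fcoef f i = 0.
Proof.
move=> f0; have ex : exists n, fcoef f n != 0.
  apply: contrapT => f_eq0; move/eqP: f0; apply; apply: fpsP => n.
  by rewrite /= coef0; apply/eqP/negPn/negP => fn; apply: f_eq0; exists n.
case: (ex_minnP ex) => n fn0 nmin; exists n => // i lin.
by apply/eqP/negPn/negP => /nmin; rewrite leqNgt lin.
Qed.

Lemma fps_integral f g : f * g = 0 -> (f == 0) || (g == 0).
Proof.
move=> fg0; apply/norP => -[/fps_ord[m fm0 mmin] /fps_ord[n gn0 nmin]].
have := congr1 (fun h => fcoef h (m + n)) fg0; rewrite /= coef0.
have lmn : (m < (m + n).+1)%N by rewrite ltnS leq_addr.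
rewrite (bigD1 (Ordinal lmn)) //= addKn big1 => [|i].
  by rewrite addr0 => /eqP; rewrite mulf_eq0 (negbTE fm0) (negbTE gn0).
rewrite -val_eqE /= => im; have [lim|lmi] := ltnP i m.
  by rewrite mmin ?mul0r.
have {}lmi : (m < i)%N by rewrite ltn_neqAle eq_sym im.
by rewrite nmin ?mulr0// ltn_subLR ?leq_ord// ltn_add2r.
Qed.

HB.instance Definition _ :=
  GRing.ComUnitRing_isIntegral.Build (fps K) fps_integral.

End FormalPowerSeries.

Notation laurent K := {fraction (fps K)}.
Notation "f %:L" := (FracField.tofrac f) (at level 2, format "f %:L").

Section Substitutions.
Variable K : fieldType.

(* f(q x) *)
Definition fps_shift (q : K) (f : fps K) : fps K :=
  Fps (fun n => fcoef f n * q ^+ n).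

(* f(x ^ m), for m > 0 *)
Definition fps_comp_pow (m : nat) (f : fps K) : fps K :=
  Fps (fun n => if (m %| n)%N then fcoef f (n %/ m) else 0).

(* a(q x), computed on some fraction representing a; for q != 0 any fraction
   gives the same result, see laurent_shiftE *)
Definition laurent_shift (q : K) (a : laurent K) : laurent K :=
  (fps_shift q (frac (repr a)).1)%:L / (fps_shift q (frac (repr a)).2)%:L.

Lemma fps_shiftM (q : K) f g :
  fps_shift q (f * g) = fps_shift q f * fps_shift q g.
Proof.
apply: fpsP => n /=; rewrite mulr_suml; apply: eq_bigr => i _.
by rewrite mulrACA -exprD subnKC ?leq_ord.
Qed.

Lemma fps_shift_neq0 (q : K) f : q != 0 -> f != 0 -> fps_shift q f != 0.
Proof.
move=> q0 /fps_ord[n fn0 _]; apply/eqP => /(congr1 (fun h => fcoef h n)) /=.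
by rewrite coef0 => /eqP; rewrite mulf_eq0 (negbTE fn0) expf_eq0 (negbTE q0) andbF.
Qed.

Lemma laurent_shiftE (q : K) f g : q != 0 -> g != 0 ->
  laurent_shift q (f%:L / g%:L) = (fps_shift q f)%:L / (fps_shift q g)%:L.
Proof.
move=> q0 g0; rewrite /laurent_shift; set a := f%:L / _.
have dn0 : (frac (repr a)).2 != 0 by apply: denom_ratioP.
have aE : a = ((frac (repr a)).1)%:L / ((frac (repr a)).2)%:L.
  apply/(canRL (mulfK _)); first by rewrite tofrac_eq0.
  rewrite -{1}(reprK a); unlock FracField.tofrac.
  rewrite -[LHS]FracField.pi_mul; apply/eqmodP; rewrite /= FracField.equivfE.
  by rewrite /FracField.mulf !numden_Ratio ?mulr1 ?oner_neq0// mulrC.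
apply/eqP; rewrite eqr_div ?tofrac_eq0 ?fps_shift_neq0//.
rewrite -!tofracM tofrac_eq -!fps_shiftM; apply/eqP; congr fps_shift.
move/eqP: aE; rewrite {1}/a eqr_div ?tofrac_eq0// -!tofracM tofrac_eq.
by move/eqP.
Qed.

Definition qderiv (q : K) (a : laurent K) : laurent K :=
  (laurent_shift q a - a) / (fps_of_poly ((q - 1) *: 'X))%:L.

Definition Gseq_one mu (q : K) (A : 'M[laurent K]_mu) : 'M[laurent K]_mu :=
  ((fps_of_poly ((q - 1) *: 'X))%:L)^-1 *: (A - 1%:M).

Fixpoint Gseq mu (q : K) (A : 'M[laurent K]_mu) (n : nat) : 'M[laurent K]_mu :=
  if n is m.+1 then
    map_mx (laurent_shift q) (Gseq q A m) *m Gseq_one q A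
      + map_mx (qderiv q) (Gseq q A m)
  else 1%:M.

Definition qint (q : K) (n : nat) : K := \sum_(i < n) q ^+ i.
Definition qfact (q : K) (n : nat) : K := \prod_(1 <= i < n.+1) qint q i.

Definition fps_mx0 mu (A : 'M[fps K]_mu) : 'M[K]_mu :=
  map_mx (fun f => fcoef f 0) A.

Definition mx_laurent mu (A : 'M[fps K]_mu) : 'M[laurent K]_mu :=
  map_mx (@FracField.tofrac _) A.

(* a(0); meaningful when a lies in K[[x]] *)
Definition laurent_at0 (a : laurent K) : K :=
  xget 0 [set c | exists2 f : fps K, a = f%:L & c = fcoef f 0].
Definition mx_at0 mu (A : 'M[laurent K]_mu) : 'M[K]_mu := map_mx laurent_at0 A.

End Substitutions.

Section AbsoluteValue.
Variables (R : realType) (K : fieldType) (abs : K -> R).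

Record nonarch_abs : Prop := NonarchAbs {
  nonarch_abs_ge0 : forall x, 0 <= abs x;
  nonarch_abs_eq0 : forall x, abs x = 0 <-> x = 0;
  nonarch_absM : forall x y, abs (x * y) = abs x * abs y;
  nonarch_absD : forall x y, abs (x + y) <= Num.max (abs x) (abs y)
}.

Definition abs_cvg (u : nat -> K) (l : K) : Prop :=
  (fun n => abs (u n - l)) @ \oo --> (0 : R).

Definition abs_complete : Prop := forall u : nat -> K,
  (forall e : R, 0 < e -> exists N, forall m n, (N <= m)%N -> (N <= n)%N ->
    abs (u m - u n) < e) ->
  exists l, abs_cvg u l.

Definition mx_abs mu (M : 'M[K]_mu) : R :=
  \big[Num.max/0]_(ij : 'I_mu * 'I_mu) abs (M ij.1 ij.2).

Definition gauss_norm (P : {poly K}) : R :=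
  \big[Num.max/0]_(i < size P) abs P`_i.

(* the reduction of x, |x| <= 1, is a root of a non-zero polynomial over F_p;
   the coefficients of that polynomial are lifted to {0, .., p - 1} *)
Definition reduction_algebraic (p : nat) (x : K) : Prop :=
  exists2 P : {poly 'F_p}, P != 0 &
    abs (\sum_(i < size P) (nat_of_ord P`_i)%:R * x ^+ i) < 1.

(* the power series f converges at x, with sum y *)
Definition fps_sum (f : fps K) (x y : K) : Prop :=
  abs_cvg (fun n => \sum_(i < n) fcoef f i * x ^+ i) y.

(* P / Q has no pole in D(0,1^-), f converges on D(0,1^-), and
   ||f - P / Q|| <= e for the supremum norm on D(0,1^-) *)
Definition rat_approx (f : fps K) (P Q : {poly K}) (e : R) : Prop :=
  forall x, abs x < 1 -> Q.[x] != 0 /\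
    exists2 y, fps_sum f x y & abs (y - P.[x] / Q.[x]) <= e.

(* E_0 is the set of Taylor expansions at 0 of the uniform limits on D(0,1^-)
   of rational functions without poles there *)
Definition E0 (f : fps K) : Prop :=
  forall e : R, 0 < e -> exists P Q : {poly K}, rat_approx f P Q e.

Definition E0' (a : laurent K) : Prop :=
  exists f g : fps K, [/\ E0 f, E0 g, g != 0 & a = f%:L / g%:L].

Definition GL_E0 mu (A : 'M[fps K]_mu) : Prop :=
  [/\ A \in unitmx, forall i j, E0 (A i j) & forall i j, E0 (invmx A i j)].

Definition GL_E0' mu (A : 'M[laurent K]_mu) : Prop :=
  [/\ A \in unitmx, forall i j, E0' (A i j) & forall i j, E0' (invmx A i j)].

Definition analytic_at0 (a : laurent K) : Prop :=
  exists2 f : fps K, a = f%:L & exists2 r : R, 0 < r &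
    forall x, abs x < r -> exists y, fps_sum f x y.

(* a(x) for a in E_0' and |x| < 1, x not a pole of a *)
Definition E0'_eval (a : laurent K) (x : K) : K :=
  xget 0 [set y | exists f g u v,
    [/\ E0 f, E0 g, a = f%:L / g%:L, fps_sum f x u & fps_sum g x v]
    /\ v != 0 /\ y = u / v].

Section Domain.
(* the domain D' is the union of the D(q ^ i * zeta, eta^-) for i < n0 *)
Variables (q zeta : K) (eta : R) (n0 : nat).

Definition in_disc (i : nat) (x : K) : Prop := abs (x - q ^+ i * zeta) < eta.
Definition in_domain (x : K) : Prop := exists2 i, (i < n0)%N & in_disc i x.

Definition q_invariant : Prop := forall x, in_domain (q * x) <-> in_domain x.

Definition analytic_on (phi : K -> K) : Prop := forall i, (i < n0)%N ->
  exists f : fps K, forall x, in_disc i x ->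
    fps_sum f (x - q ^+ i * zeta) (phi x).

(* phi is not identically 0 on any of the discs: for an analytic phi, this says
   that phi is not a zero divisor in the ring of analytic functions on D' *)
Definition regular_on (phi : K -> K) : Prop :=
  forall i, (i < n0)%N -> exists2 x, in_disc i x & phi x != 0.

(* P holds on D' outside the zeros of a regular analytic function; equality of
   meromorphic functions on D' is pointwise equality in this sense *)
Definition generically (P : K -> Prop) : Prop := exists h : K -> K,
  [/\ analytic_on h, regular_on h &
      forall x, in_domain x -> h x != 0 -> P x].

(* The meromorphic functions on D' are the quotients of analytic functions.
   The values of phi at the zeros of the denominator are irrelevant. *)
Definition meromorphic_on (phi : K -> K) : Prop := exists f g : K -> K,
  [/\ analytic_on f, analytic_on g, regular_on g &
      forall x, in_domain x -> g x != 0 -> phi x = f x / g x].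

Definition GL_analytic mu (Y : K -> 'M[K]_mu) : Prop :=
  exists Z : K -> 'M[K]_mu,
  [/\ forall i j, analytic_on (fun x => Y x i j),
      forall i j, analytic_on (fun x => Z x i j) &
      forall x, in_domain x -> Y x *m Z x = 1%:M].

Definition GL_meromorphic mu (Y : K -> 'M[K]_mu) : Prop :=
  exists Z : K -> 'M[K]_mu,
  [/\ forall i j, meromorphic_on (fun x => Y x i j),
      forall i j, meromorphic_on (fun x => Z x i j) &
      generically (fun x => Y x *m Z x = 1%:M)].

Definition is_solution mu (A : 'M[laurent K]_mu) (Y : K -> 'M[K]_mu) : Prop :=
  generically (fun x => Y (q * x) = map_mx (fun a => E0'_eval a x) A *m Y x).

Definition invariant_domain : Prop :=
  [/\ (0 < n0)%N, 0 < eta, q_invariant &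
      forall x, in_domain x -> abs x < 1].

End Domain.

Definition ordinary_orbit mu (q : K) (A : 'M[laurent K]_mu) (xi : K) : Prop :=
  exists zeta eta n0,
    [/\ invariant_domain q zeta eta n0, in_domain q zeta eta n0 xi &
        exists2 Y, GL_analytic q zeta eta n0 Y &
                   is_solution q zeta eta n0 A Y].

Definition apparent_orbit mu (q : K) (A : 'M[laurent K]_mu) (xi : K) : Prop :=
  exists zeta eta n0,
    [/\ invariant_domain q zeta eta n0, in_domain q zeta eta n0 xi &
        exists2 Y, GL_meromorphic q zeta eta n0 Y &
                   is_solution q zeta eta n0 A Y].

End AbsoluteValue.

Section Generic.
Variables (R : realType) (K Omega : fieldType).
Variables (abs : K -> R) (absO : Omega -> R).
Variables (iota : {rmorphism K -> Omega}) (t : Omega).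

Record generic_extension : Prop := GenericExtension {
  gext_nonarch : nonarch_abs absO;
  gext_complete : abs_complete absO;
  gext_iso : forall x, absO (iota x) = abs x;
  gext_value_group : forall r : R, 0 <= r -> exists x, absO x = r;
  (* some u in the valuation ring has a reduction which is transcendental over
     the residue field of K *)
  gext_residue : exists2 u, absO u <= 1 & forall P : {poly K},
    (forall i, abs P`_i <= 1) -> (exists i, abs P`_i = 1) ->
    ~ absO (map_poly iota P).[u] < 1;
  gext_transcendental : ~ algebraicOver iota t;
  gext_gauss : forall P Q : {poly K}, Q != 0 ->
    absO ((map_poly iota P).[t] / (map_poly iota Q).[t])
      = gauss_norm abs P / gauss_norm abs Q
}.

(* y = f(t) for f in E_0: the evaluation at t of the rational functions without
   poles in D(0,1^-) is an isometry, which is extended by continuity *)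
Definition E0_generic_value (f : fps K) (y : Omega) : Prop :=
  forall e : R, 0 < e -> exists2 PQ : {poly K} * {poly K},
    rat_approx abs f PQ.1 PQ.2 e &
    absO (y - (map_poly iota PQ.1).[t] / (map_poly iota PQ.2).[t]) <= e.

Definition generic_eval (a : laurent K) : Omega :=
  xget 0 [set y | exists f g u v,
    [/\ g != 0, a = f%:L / g%:L, E0_generic_value f u,
        E0_generic_value g v & y = u / v]].

(* r ^ (- 1 / n), which is +oo for r = 0 *)
Definition root_inv (n : nat) (r : R) : \bar R :=
  if r == 0 then +oo%E else (r `^ (- n%:R^-1))%:E.

(* the minimum lies in [0, 1], so fine only casts it to R *)
Definition chi mu (A : 'M[laurent K]_mu) (q : K) : R :=
  fine (Order.min 1%:E (limn_einf (fun n => root_inv n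
    (mx_abs absO
      (map_mx (fun a => generic_eval a / iota (qfact q n)) (Gseq q A n)))))).

Record class_H (p l : nat) (q pi_q : K) mu (A : 'M[laurent K]_mu) : Prop :=
  ClassH {
  class_H_GL : GL_E0' abs A;
  class_H_analytic0 : forall i j, analytic_at0 abs (A i j);
  class_H_unit0 : mx_at0 A \in unitmx;
  class_H_apparent : forall xi, xi != 0 -> abs xi < 1 ->
    ordinary_orbit abs q A xi \/ apparent_orbit abs q A xi;
  class_H_chi : abs pi_q `^ ((p ^ l.-1)%:R^-1) < chi A q
}.

Record normal_form (p l : nat) (q : K) mu (A : 'M[laurent K]_mu) : Prop :=
  NormalForm {
  normal_form_GL : exists2 A0 : 'M[fps K]_mu,
    A = mx_laurent A0 & GL_E0 abs A0;
  normal_form_eigen : forall a b,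
    eigenvalue (mx_at0 A) a -> eigenvalue (mx_at0 A) b ->
    a = b \/ forall k : int, a <> b * q ^ k;
  normal_form_small : forall a, eigenvalue (mx_at0 A) a ->
    abs ((a - 1) / (q - 1)) < p%:R ^ (1 - l%:Z)
}.

End Generic.

(* Main.v *)
(** Put m = p^l and Q = q^m. Non-resonance gives a formal solution Y with Y(0) = 1 and
    Y(q x) A(0) = A(x) Y(x). Formally, Y(x) x^a with q^a = A(0) is a solution of the
    system, and the G_n of the statement are, up to the factor x^(-n), the images of this
    solution under [n]_q^! e_n(sigma_q), divided by it, where the e_n are the Newton
    polynomials of the nodes 1, q, q^2, ...; so chi measures the growth of these images.
    Since chi(A) exceeds the distance to 1 of the m-th roots of unity and of q, the
    substitution x -> z x with z^m = 1, expanded in Newton series, is bounded on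
    Y: hence the average Z of Y(z x) over these z, which is a series in x^m, has the
    property that H = Z Y^-1 is an analytic element. The same expansions, together with the
    smallness of the eigenvalues of A(0), bound the images of Z under the Newton polynomials
    of Q. The zeros of det H in the disc come in orbits of the m-th roots of unity and are
    removed one orbit at a time by multiplying Z on the left by a matrix in x^m. Then H is
    invertible over E_0, and H(q x) A(x) H(x)^-1 = Z(q x) A(0) Z(x)^-1 is a function of x^m.
    Re-expanding the e_n in the Newton polynomials of Q gives the converse bound for chi. *)

Require Import Defs.
From HB Require Import structures.
From mathcomp Require Import all_boot all_order all_algebra.
From mathcomp Require Import perm cyclic separable cyclotomic.
From mathcomp Require Import all_classical all_reals all_analysis.
From mathcomp Require Import ring lra zify.

Set Implicit Arguments.
Unset Strict Implicit.
Unset Printing Implicit Defensive.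

Import Order.TTheory GRing.Theory Num.Theory.
Import numFieldNormedType.Exports.
Local Open Scope classical_set_scope.
Local Open Scope ring_scope.

(** * Power series over a non-archimedean field *)

(** The obstacle is the multivalued factor x^a. Replacing x by z x in the solution Y(x) x^a produces
    z^a, whereas only Y is averaged; this is harmless provided that z^a = 1 whenever z^m = 1. The
    bound on the eigenvalues of A(0) secures this: formally z^a = (z^m)^(a/m), and the Newton series
    of ratio Q that expresses it at A(0) converges because |lambda - 1| < p |Q - 1|, which is the
    condition |(lambda - 1)/(q - 1)| < p^(1 - l). The constant rho = |pi|^(1/p^(l-1)) in the
    hypothesis on chi bounds the distance to 1 of the m-th roots of unity; it satisfies rho^m =
    |pi|^p = |pi| / p, while |j!| is at least |pi|^j. A substitution such as x -> z x is encoded by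
    a linear functional on polynomials, phi -> phi(z), whose values on the Newton basis are the
    coefficients of the expansion. Such an expansion converges at first only coefficient by
    coefficient in x; uniform bounds on its terms pass to the sum, and geometric decay of the terms
    makes the sum an analytic element. *)

Lemma strong_recursion (T : Type) (t0 : T) (g : nat -> (nat -> T) -> T) :
  (forall n y y', (forall i, (i < n)%N -> y i = y' i) -> g n y = g n y') ->
  exists y, forall n, y n = g n y.
Proof.
(* [s n] lists the first [n] values, which turns course-of-values recursion into structural
   recursion; [t0] is only the default value of [nth]. *)
move=> gP; pose s := fix s n := if n is m.+1 then rcons (s m) (g m (nth t0 (s m))) else [::].
have szs n : size (s n) = n by elim: n => //= n IH; rewrite size_rcons IH.
have sE n k i : (i < n)%N -> nth t0 (s (n + k)%N) i = nth t0 (s n) i.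
  move=> lin; elim: k => [|k IH]; first by rewrite addn0.
  by rewrite addnS /= nth_rcons szs (leq_trans lin) ?leq_addr.
exists (fun n => nth t0 (s n.+1) n) => n /=.
rewrite nth_rcons szs ltnn eqxx; apply: gP => i lin.
by rewrite -(subnKC lin) sE.
Qed.

Section PowerSeries.
Variable K : fieldType.
Implicit Types (f g : fps K) (P : {poly K}).

Lemma fcoefD f g n : fcoef (f + g) n = fcoef f n + fcoef g n. Proof. by []. Qed.
Lemma fcoefN f n : fcoef (- f) n = - fcoef f n. Proof. by []. Qed.
Lemma fcoefB f g n : fcoef (f - g) n = fcoef f n - fcoef g n. Proof. by []. Qed.
Lemma fcoef0 n : fcoef (0 : fps K) n = 0. Proof. by rewrite /= coef0. Qed.
Lemma fcoef1 n : fcoef (1 : fps K) n = (n == 0)%:R. Proof. by rewrite /= coef1. Qed.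
Lemma fcoefM f g n :
  fcoef (f * g) n = \sum_(i < n.+1) fcoef f i * fcoef g (n - i).
Proof. by []. Qed.
Lemma fcoef0M f g : fcoef (f * g) 0 = fcoef f 0 * fcoef g 0.
Proof. by rewrite fcoefM big_ord1. Qed.
Lemma fcoef_sum I (r : seq I) (P : pred I) (F : I -> fps K) n :
  fcoef (\sum_(i <- r | P i) F i) n = \sum_(i <- r | P i) fcoef (F i) n.
Proof.
by elim/big_rec2: _ => [|i y1 y2 _ <-]; rewrite ?fcoef0 ?fcoefD.
Qed.

Fact fps_of_poly_zmod : zmod_morphism (@fps_of_poly K).
Proof. by move=> P Q; apply: fpsP => n /=; rewrite coefB. Qed.
Fact fps_of_poly_monoid : monoid_morphism (@fps_of_poly K).
Proof. by split=> // P Q; apply: fpsP => n /=; rewrite coefM. Qed.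
HB.instance Definition _ :=
  GRing.isZmodMorphism.Build {poly K} (fps K) (@fps_of_poly K) fps_of_poly_zmod.
HB.instance Definition _ :=
  GRing.isMonoidMorphism.Build {poly K} (fps K) (@fps_of_poly K)
    fps_of_poly_monoid.

Definition fps_const (c : K) : fps K := fps_of_poly c%:P.
HB.instance Definition _ := GRing.RMorphism.copy fps_const (@fps_of_poly K \o @polyC K).

Lemma fcoefCM c f n : fcoef (fps_const c * f) n = c * fcoef f n.
Proof.
rewrite fcoefM big_ord_recl /= coefC subn0 big1 ?addr0// => i _.
by rewrite coefC mul0r.
Qed.

Lemma fcoefXnM m f n :
  fcoef (fps_of_poly 'X^m * f) n = if (n < m)%N then 0 else fcoef f (n - m).
Proof.
rewrite fcoefM; case: ltnP => [lt|le].
  by rewrite big1// => i _; rewrite /= coefXn (ltn_eqF (leq_trans (ltn_ord i) _)) ?mul0r.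
have lt : (m < n.+1)%N by [].
rewrite (bigD1 (Ordinal lt))//= coefXn eqxx mul1r big1 ?addr0// => i.
by rewrite -val_eqE/= coefXn => /negbTE->; rewrite mul0r.
Qed.

Lemma fps_unitE f : (f \is a GRing.unit) = (fcoef f 0 != 0).
Proof.
apply/idP/idP => [/divrr/(congr1 (fun h => fcoef h 0))|f0].
  rewrite fcoef0M fcoef1 eqxx => f0; apply/eqP => e.
  by move/eqP: f0; rewrite e mul0r eq_sym oner_eq0.
pose step n (y : nat -> K) :=
  (fcoef f 0)^-1 * ((n == 0)%:R - \sum_(i < n) y i * fcoef f (n - i)).
have [|y yE] := @strong_recursion K 0 step.
  move=> n y y' e; rewrite /step; congr (_ * (_ - _)).
  by apply: eq_bigr => i _; rewrite e.
apply/unitrP; exists (Fps y).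
have H : Fps y * f = 1.
  apply: fpsP => n; rewrite fcoefM big_ord_recr/= subnn yE /step mulrAC mulVf// mul1r.
  by rewrite addrC subrK coef1.
by split; rewrite // mulrC.
Qed.

Fact fps_shift_zmod (q : K) : zmod_morphism (fps_shift q).
Proof. by move=> f g; apply: fpsP => n /=; rewrite mulrBl. Qed.
Fact fps_shift_monoid (q : K) : monoid_morphism (fps_shift q).
Proof.
split=> [|f g]; last exact: fps_shiftM.
by apply: fpsP => n; rewrite fcoef1 /= coef1; case: n => [|n]; rewrite ?mulr1 ?mul0r.
Qed.
HB.instance Definition _ (q : K) :=
  GRing.isZmodMorphism.Build (fps K) (fps K) (fps_shift q) (fps_shift_zmod q).
HB.instance Definition _ (q : K) :=
  GRing.isMonoidMorphism.Build (fps K) (fps K) (fps_shift q) (fps_shift_monoid q).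

Lemma fps_shift_poly (q : K) P :
  fps_shift q (fps_of_poly P) = fps_of_poly (P \Po (q *: 'X)).
Proof.
apply: fpsP => n /=; rewrite comp_polyE coef_sum.
have [lt|le] := ltnP n (size P).
  rewrite (bigD1 (Ordinal lt))//= big1 ?addr0 => [|i].
    by rewrite coefZ exprZn coefZ coefXn eqxx mulr1.
  by rewrite -val_eqE/= exprZn !coefZ coefXn eq_sym => /negbTE->; rewrite !mulr0.
rewrite nth_default// mul0r big1// => i _.
rewrite exprZn !coefZ coefXn gtn_eqF ?mulr0//.
exact: leq_trans (ltn_ord i) le.
Qed.

Lemma fps_shift_shift (q r : K) f : fps_shift q (fps_shift r f) = fps_shift (r * q) f.
Proof. by apply: fpsP => n /=; rewrite exprMn mulrA. Qed.

Lemma fps_shift1 f : fps_shift 1 f = f.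
Proof. by apply: fpsP => n /=; rewrite expr1n mulr1. Qed.

Fact fps_comp_pow_zmod m : zmod_morphism (@fps_comp_pow K m).
Proof. by move=> f g; apply: fpsP => n /=; case: ifP; rewrite ?subr0. Qed.

Lemma fps_comp_powM m f g : (0 < m)%N ->
  fps_comp_pow m (f * g) = fps_comp_pow m f * fps_comp_pow m g.
Proof.
move=> m0; apply: fpsP => n; rewrite fcoefM /=; case: ifP => [/dvdnP[k ->]|mn].
  rewrite mulnK// [RHS](bigID (fun i : 'I__ => m %| i)%N)/= addrC [X in X + _]big1 => [|i /negbTE->]; last by rewrite mul0r.
  rewrite add0r (reindex_onto (fun i : 'I_k.+1 => inord (i * m) : 'I_(k * m).+1)
    (fun j : 'I__ => inord (j %/ m)))/=; last first.
    move=> i mi; apply: val_inj => /=.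
    have ik : (i %/ m < k.+1)%N by rewrite ltn_divLR// mulSn; have := ltn_ord i; lia.
    by rewrite inordK inordK// divnK// ltn_ord.
  apply: eq_big => [i|i _].
    have ik : (i * m < (k * m).+1)%N by rewrite ltnS leq_mul2r -ltnS ltn_ord orbT.
    by rewrite inordK// dvdn_mull//= mulnK// inord_val eqxx.
  have ik : (i * m < (k * m).+1)%N by rewrite ltnS leq_mul2r -ltnS ltn_ord orbT.
  by rewrite inordK// dvdn_mull// mulnK// -mulnBl dvdn_mull// mulnK.
rewrite big1// => i _; case: ifP => mi; last by rewrite mul0r.
rewrite ifF ?mulr0//; apply/negbTE/negP => mni; move/negP: mn; apply.
by rewrite -(subnKC (leq_ord i)) dvdn_add.
Qed.

Lemma fps_comp_powP m f : (0 < m)%N ->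
  (forall n, ~~ (m %| n)%N -> fcoef f n = 0) -> exists g, f = fps_comp_pow m g.
Proof.
move=> m0 f0; exists (Fps (fun n => fcoef f (n * m)%N)); apply: fpsP => n /=.
by case: ifP => [/divnK->//|/negbT/f0].
Qed.

Lemma fps_shift_comp_pow (q : K) m f : (0 < m)%N ->
  fps_shift q (fps_comp_pow m f) = fps_comp_pow m (fps_shift (q ^+ m) f).
Proof.
move=> m0; apply: fpsP => n /=; case: ifP => [/dvdnP[k ->]|]; last by rewrite mul0r.
by rewrite mulnK// -exprM mulnC.
Qed.

Lemma fps_comp_pow1 m : (0 < m)%N -> fps_comp_pow m (1 : fps K) = 1.
Proof.
move=> m0; apply: fpsP => n; rewrite fcoef1 /=.
case: ifP => [/dvdnP[k ->]|]; first by rewrite mulnK// coef1 muln_eq0 (gtn_eqF m0) orbF.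
by case: n => //; rewrite dvdn0.
Qed.
End PowerSeries.

(** * Ultrametric inequalities, coefficientwise bounds and dominant coefficients *)

Section NonArchimedean.
Variables (R : realType) (K : fieldType) (abs : K -> R).
Hypothesis na : nonarch_abs abs.
Implicit Types (x y : K) (f g h : fps K) (P : {poly K}) (C D : R).

Lemma absM x y : abs (x * y) = abs x * abs y.
Proof. exact: nonarch_absM na x y. Qed.
Lemma abs_ge0 x : 0 <= abs x.
Proof. exact: nonarch_abs_ge0 na x. Qed.
Lemma abs0 : abs 0 = 0.
Proof. exact/(nonarch_abs_eq0 na). Qed.
Lemma abs_eq0 x : (abs x == 0) = (x == 0).
Proof. by apply/eqP/eqP => /(nonarch_abs_eq0 na). Qed.
Lemma abs_gt0 x : (0 < abs x) = (x != 0).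
Proof. by rewrite lt0r abs_ge0 andbT abs_eq0. Qed.
Lemma abs1 : abs 1 = 1.
Proof.
have n0 : abs 1 != 0 by rewrite abs_eq0 oner_eq0.
by apply: (mulfI n0); rewrite -absM !mulr1.
Qed.
Lemma absX x n : abs (x ^+ n) = abs x ^+ n.
Proof. by elim: n => [|n IH]; rewrite ?expr0 ?abs1// !exprS absM IH. Qed.
Lemma absN x : abs (- x) = abs x.
Proof.
rewrite -mulN1r absM; suff -> : abs (- 1) = 1 by rewrite mul1r.
apply/eqP; rewrite -(@pexpr_eq1 _ _ 2)// ?abs_ge0// -absX.
by rewrite sqrrN expr1n abs1.
Qed.
Lemma abs_subC x y : abs (x - y) = abs (y - x).
Proof. by rewrite -absN opprB. Qed.
Lemma absV x : abs x^-1 = (abs x)^-1.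
Proof.
have [->|x0] := eqVneq x 0; first by rewrite invr0 abs0 invr0.
have n0 : abs x != 0 by rewrite abs_eq0.
by apply: (mulfI n0); rewrite -absM !mulfV// abs1.
Qed.
Lemma abs_prod I (r : seq I) (P : pred I) (F : I -> K) :
  abs (\prod_(i <- r | P i) F i) = \prod_(i <- r | P i) abs (F i).
Proof. by apply: big_morph; [exact: absM|exact: abs1]. Qed.

Lemma absD_le x y C : abs x <= C -> abs y <= C -> abs (x + y) <= C.
Proof.
by move=> xC yC; apply: (le_trans (nonarch_absD na x y)); rewrite ge_max xC.
Qed.
Lemma absB_le x y C : abs x <= C -> abs y <= C -> abs (x - y) <= C.
Proof. by move=> xC yC; rewrite absD_le// absN. Qed.
Lemma absD_lt x y C : abs x < C -> abs y < C -> abs (x + y) < C.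
Proof.
by move=> xC yC; apply: (le_lt_trans (nonarch_absD na x y)); rewrite gt_max xC.
Qed.
Lemma absB_lt x y C : abs x < C -> abs y < C -> abs (x - y) < C.
Proof. by move=> xC yC; rewrite absD_lt// absN. Qed.
Lemma abs_sum_le I (r : seq I) (P : pred I) (F : I -> K) C :
  0 <= C -> (forall i, P i -> abs (F i) <= C) ->
  abs (\sum_(i <- r | P i) F i) <= C.
Proof.
move=> C0 FC; elim/big_ind: _ => [|x y|//]; first by rewrite abs0.
exact: absD_le.
Qed.
Lemma abs_sum_lt I (r : seq I) (P : pred I) (F : I -> K) C :
  0 < C -> (forall i, P i -> abs (F i) < C) ->
  abs (\sum_(i <- r | P i) F i) < C.
Proof.
move=> C0 FC; elim/big_ind: _ => [|x y|//]; first by rewrite abs0.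
exact: absD_lt.
Qed.
Lemma absD_dom x y : abs y < abs x -> abs (x + y) = abs x.
Proof.
move=> yx; apply/eqP; rewrite eq_le absD_le ?(ltW yx)//=.
rewrite leNgt; apply/negP => xy.
by have := absB_lt xy yx; rewrite addrK ltxx.
Qed.
Lemma absB_dom x y : abs y < abs x -> abs (x - y) = abs x.
Proof. by move=> yx; rewrite absD_dom// absN. Qed.
Lemma abs_nat_le1 n : abs n%:R <= 1.
Proof.
by elim: n => [|n IH]; rewrite ?abs0// mulrS absD_le// abs1.
Qed.

(** A bound on the Gauss norm. It amounts to a bound on the supremum norm over the open unit disc,
    by [ev_le] and [maximum_modulus]. *)
Definition bnd f C := forall i, abs (fcoef f i) <= C.

Lemma bnd_ge0 f C : bnd f C -> 0 <= C.
Proof. by move/(_ 0%N); apply: le_trans; exact: abs_ge0. Qed.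
Lemma bndW f C D : C <= D -> bnd f C -> bnd f D.
Proof. by move=> CD fC i; apply: le_trans CD. Qed.
Lemma bnd0 C : 0 <= C -> bnd 0 C.
Proof. by move=> C0 i; rewrite fcoef0 abs0. Qed.
Lemma bnd1 : bnd 1 1.
Proof. by move=> i; rewrite fcoef1; case: eqP => _; rewrite ?abs1 ?abs0. Qed.
Lemma bndD f g C : bnd f C -> bnd g C -> bnd (f + g) C.
Proof. by move=> fC gC i; rewrite fcoefD absD_le. Qed.
Lemma bndN f C : bnd f C -> bnd (- f) C.
Proof. by move=> fC i; rewrite fcoefN absN. Qed.
Lemma bndB f g C : bnd f C -> bnd g C -> bnd (f - g) C.
Proof. by move=> fC gC; apply: bndD => //; exact: bndN. Qed.
Lemma bndM f g C D : bnd f C -> bnd g D -> bnd (f * g) (C * D).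
Proof.
move=> fC gD i; rewrite fcoefM abs_sum_le ?mulr_ge0 ?(bnd_ge0 fC) ?(bnd_ge0 gD)//.
by move=> j _; rewrite absM ler_pM ?abs_ge0.
Qed.
Lemma bndCM c f C : bnd f C -> bnd (fps_const c * f) (abs c * C).
Proof. by move=> fC i; rewrite fcoefCM absM ler_wpM2l ?abs_ge0. Qed.
Lemma bnd_sum I (r : seq I) (P : pred I) (F : I -> fps K) C :
  0 <= C -> (forall i, P i -> bnd (F i) C) -> bnd (\sum_(i <- r | P i) F i) C.
Proof. by move=> C0 FC i; rewrite fcoef_sum abs_sum_le// => j Pj; apply: FC. Qed.
Lemma bnd_shift q f C : abs q = 1 -> bnd f C -> bnd (fps_shift q f) C.
Proof. by move=> q1 fC i /=; rewrite absM absX q1 expr1n mulr1. Qed.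
Lemma bndXn m : bnd (fps_of_poly 'X^m) 1.
Proof. by move=> i; rewrite /= coefXn; case: eqP => _; rewrite ?abs1 ?abs0. Qed.
Lemma bnd_eq0 f : bnd f 0 -> f = 0.
Proof.
move=> f0; apply: fpsP => i; rewrite fcoef0; apply/eqP.
by rewrite -abs_eq0 eq_le f0 abs_ge0.
Qed.
Lemma bnd_comp_pow m f C : (0 < m)%N -> bnd (fps_comp_pow m f) C <-> bnd f C.
Proof.
move=> m0; split=> [fC i|fC i] /=; last first.
  by case: ifP => // _; rewrite abs0 (bnd_ge0 fC).
by have := fC (i * m)%N; rewrite /= dvdn_mull// mulnK.
Qed.

(* The coefficients of f are dominated by the one of index n, and n is the first
   such index; for an analytic element n is the number of zeros in D(0,1^-). *)
Definition dom f n := [/\ fcoef f n != 0, forall i, abs (fcoef f i) <= abs (fcoef f n)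
  & forall i, (i < n)%N -> abs (fcoef f i) < abs (fcoef f n)].

Lemma dom_uniq f n m : dom f n -> dom f m -> n = m.
Proof.
move=> [_ n1 n2] [_ m1 m2]; case: (ltngtP n m) => // [/m2|/n2].
  by rewrite ltNge n1.
by rewrite ltNge m1.
Qed.

(** In the coefficient of index n + m every other product is strictly smaller, because one of its
    two indices lies below the dominant one. *)
Lemma domM_abs f g n m : dom f n -> dom g m ->
  abs (fcoef (f * g) (n + m)) = abs (fcoef f n) * abs (fcoef g m).
Proof.
move=> [fn0 f1 f2] [gm0 g1 g2].
have fg : 0 < abs (fcoef f n) * abs (fcoef g m) by rewrite -absM abs_gt0 mulf_neq0.
have lt : (n < (n + m).+1)%N by rewrite ltnS leq_addr.
rewrite fcoefM (bigD1 (Ordinal lt))//= addKn absD_dom absM//.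
apply: abs_sum_lt => // i; rewrite -val_eqE/= => ine; rewrite absM.
case: (ltngtP i n) ine => // ltin _.
  apply: le_lt_trans (_ : abs (fcoef f i) * abs (fcoef g m) < _).
    by rewrite ler_wpM2l ?abs_ge0.
  by rewrite ltr_pM2r ?f2// abs_gt0.
apply: le_lt_trans (_ : abs (fcoef f n) * abs (fcoef g (n + m - i)) < _).
  by rewrite ler_wpM2r ?abs_ge0.
by rewrite ltr_pM2l ?abs_gt0// g2//; have := ltn_ord i; lia.
Qed.

Lemma domM f g n m : dom f n -> dom g m -> dom (f * g) (n + m).
Proof.
move=> df dg; have fgE := domM_abs df dg.
have [[fn0 f1 f2] [gm0 g1 g2]] := (df, dg).
have fg : 0 < abs (fcoef f n) * abs (fcoef g m) by rewrite -absM abs_gt0 mulf_neq0.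
split; first by rewrite -abs_gt0 fgE.
  by move=> i; rewrite fgE; apply: (@bndM f g).
move=> i lti; rewrite fgE; apply: abs_sum_lt => // j _; rewrite absM.
case: (ltnP j n) => jn.
  apply: le_lt_trans (_ : abs (fcoef f j) * abs (fcoef g m) < _).
    by rewrite ler_wpM2l ?abs_ge0.
  by rewrite ltr_pM2r ?f2// abs_gt0.
apply: le_lt_trans (_ : abs (fcoef f n) * abs (fcoef g (i - j)) < _).
  by rewrite ler_wpM2r ?abs_ge0.
by rewrite ltr_pM2l ?abs_gt0// g2//; have := leq_ord j; lia.
Qed.

Lemma dom0_unit f : dom f 0 -> f \is a GRing.unit.
Proof. by case=> f0 _ _; rewrite fps_unitE. Qed.

Lemma dom0V f : dom f 0 -> dom f^-1 0.
Proof.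
move=> d; have [f0 f1 _] := d; have u := dom0_unit d.
have fV := divrr u; have f0V : fcoef f^-1 0 = (fcoef f 0)^-1.
  by apply: (mulfI f0); rewrite mulfV// -fcoef0M fV fcoef1.
split=> //; rewrite f0V ?invr_eq0// absV => i.
elim/ltn_ind: i => -[_|i IH]; first by rewrite f0V absV.
have := congr1 (fun h => fcoef h i.+1) fV.
rewrite fcoefM big_ord_recl subn0 fcoef1/= => /eqP.
rewrite addr_eq0 => /eqP e.
rewrite -[leLHS]mul1r -[X in X * _](@mulVf _ (abs (fcoef f 0))) ?abs_eq0//.
rewrite -mulrA -absM e absN ler_piMr ?invr_ge0 ?abs_ge0//.
apply: abs_sum_le => // j _; rewrite absM -(mulfV (_ : abs (fcoef f 0) != 0)) ?abs_eq0//.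
apply: ler_pM; rewrite ?abs_ge0// IH//; rewrite /bump/=; lia.
Qed.

Lemma dom0_bndV f : dom f 0 -> bnd f^-1 (abs (fcoef f 0))^-1.
Proof.
move=> d; have [f0 _ _] := d; have [_ fV1 _] := dom0V d => i.
apply: le_trans (fV1 i) _.
have -> : fcoef f^-1 0 = (fcoef f 0)^-1; last by rewrite absV.
by apply: (mulfI f0); rewrite mulfV// -fcoef0M divrr ?fcoef1// dom0_unit.
Qed.

Lemma dom_prod I (r : seq I) (F : I -> fps K) (c : I -> nat) :
  (forall i, dom (F i) (c i)) -> dom (\prod_(i <- r) F i) (\sum_(i <- r) c i).
Proof.
move=> FP; elim/big_rec2: _ => [|i y1 y2 _ d]; last exact: domM.
split=> [|i|i]//; rewrite ?fcoef1 ?oner_eq0//.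
by rewrite eqxx abs1; case: eqP => _; rewrite ?abs1 ?abs0.
Qed.

Lemma dom_poly P : P != 0 -> exists n, dom (fps_of_poly P) n.
Proof.
move=> P0; have szP : (0 < size P)%N by rewrite size_poly_gt0.
have [|i _ imax] := @arg_maxP _ _ _ (Ordinal szP) xpredT (fun i => abs P`_i)%R; first by [].
have imax' j : abs P`_j <= abs P`_i.
  have [lt|ge] := ltnP j (size P); first exact: (imax (Ordinal lt)).
  by rewrite nth_default// abs0 abs_ge0.
have ex : exists n, abs P`_n == abs P`_i by exists i.
case: (ex_minnP ex) => n /eqP ni nmin; exists n; split=> /=.
  apply/negP => /eqP Pn; move: P0; rewrite -lead_coef_eq0 -abs_gt0.
  rewrite /lead_coef; move/lt_le_trans/(_ (imax' _)).
  by rewrite -ni Pn abs0 ltxx.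
  by rewrite ni.
move=> j jn; rewrite ni lt_neqAle imax' andbT; apply/negP => /nmin.
by rewrite leqNgt jn.
Qed.

Lemma dom_near f g n : dom f n -> (forall i, abs (fcoef (f - g) i) < abs (fcoef f n)) ->
  dom g n.
Proof.
move=> [fn0 f1 f2] fg.
have gE i : fcoef g i = fcoef f i - fcoef (f - g) i by rewrite fcoefB opprB addrC subrK.
have gn : abs (fcoef g n) = abs (fcoef f n) by rewrite gE absB_dom.
split; first by rewrite -abs_gt0 gn abs_gt0.
  by move=> i; rewrite gn gE absB_le// ltW.
by move=> i lin; rewrite gn gE absB_lt// f2.
Qed.
End NonArchimedean.
Section GeometricDecay.
Variable R : realType.

Lemma geometric_small (C r e : R) : 0 <= r -> r < 1 -> 0 < e ->
  exists N, forall n, (N <= n)%N -> C * r ^+ n < e.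
Proof.
move=> r0 r1 e0.
have C0 : 0 < `|C| + 1 by rewrite ltr_wpDl.
have := @cvg_expr R r; rewrite ger0_norm// => /(_ r1)/cvgr0Pnorm_lt.
move=> /(_ (e / (`|C| + 1)) (divr_gt0 e0 C0)) [N _ HN]; exists N => n Nn.
have := HN n Nn; rewrite /= ger0_norm ?exprn_ge0// ltr_pdivlMr// => lt.
apply: le_lt_trans lt; rewrite mulrC ler_wpM2l ?exprn_ge0//.
by rewrite (le_trans (ler_norm C))// lerDl.
Qed.

Lemma geometric_large (C r : R) : 1 < r -> exists N, forall n, (N <= n)%N -> C < r ^+ n.
Proof.
move=> r1; have r0 : 0 < r by apply: lt_trans r1.
have [| |N HN] := @geometric_small C r^-1 1 _ _ ltr01.
  by rewrite invr_ge0 ltW.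
  by rewrite invf_lt1.
by exists N => n /HN; rewrite exprVn ltr_pdivrMr ?mul1r// exprn_gt0.
Qed.
End GeometricDecay.

(** * Evaluation of bounded series on the open unit disc *)

Section Evaluation.
Variables (R : realType) (K : fieldType) (abs : K -> R).
Hypotheses (na : nonarch_abs abs) (complete : abs_complete abs).
Implicit Types (x y : K) (f g h : fps K) (P : {poly K}) (C D : R).

Lemma abs_cvgP (u : nat -> K) l : abs_cvg abs u l <->
  forall e : R, 0 < e -> exists N, forall n, (N <= n)%N -> abs (u n - l) < e.
Proof.
rewrite /abs_cvg; split=> [/cvgr0Pnorm_lt H e /H[N _ HN]|H].
  exists N => n /HN /=; by rewrite ger0_norm ?(abs_ge0 na).
apply/cvgr0Pnorm_lt => e /H[N HN]; exists N => // n /= /HN.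
by rewrite ger0_norm ?(abs_ge0 na).
Qed.

Lemma abs_small_eq0 x : (forall e : R, 0 < e -> abs x < e) -> x = 0.
Proof.
move=> H; apply/eqP; rewrite -(abs_eq0 na); apply/eqP/le_anti.
rewrite (abs_ge0 na) andbT leNgt; apply/negP => /H; by rewrite ltxx.
Qed.

Lemma abs_cvg_unique (u : nat -> K) l l' : abs_cvg abs u l -> abs_cvg abs u l' -> l = l'.
Proof.
move=> /abs_cvgP H /abs_cvgP H'; apply/eqP; rewrite -subr_eq0; apply/eqP.
apply: abs_small_eq0 => e e0; have [N HN] := H e e0; have [N' HN'] := H' e e0.
have := HN _ (leq_maxl N N'); have := HN' _ (leq_maxr N N') => a b.
by have := absB_lt na a b; rewrite opprB addrC addrA subrK.
Qed.

Lemma abs_cvg_le (u : nat -> K) l C :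
  (exists N, forall n, (N <= n)%N -> abs (u n) <= C) -> abs_cvg abs u l -> abs l <= C.
Proof.
move=> [N HN] /abs_cvgP H; rewrite leNgt; apply/negP => lC.
have [|N' HN'] := H (abs l); first by apply: le_lt_trans lC; apply: le_trans (HN N (leqnn N)); exact: abs_ge0.
have a := HN _ (leq_maxl N N'); have b := HN' _ (leq_maxr N N').
have := absB_lt na (le_lt_trans a lC) b; by rewrite opprB addrC subrK ltxx.
Qed.

Lemma abs_cvgD (u v : nat -> K) l l' : abs_cvg abs u l -> abs_cvg abs v l' ->
  abs_cvg abs (fun n => u n + v n) (l + l').
Proof.
move=> /abs_cvgP H /abs_cvgP H'; apply/abs_cvgP => e e0.
have [N HN] := H e e0; have [N' HN'] := H' e e0; exists (maxn N N') => n.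
rewrite geq_max => /andP[/HN a /HN' b].
by have := absD_lt na a b; rewrite opprD addrACA.
Qed.

Lemma abs_cvgMl (u : nat -> K) l c : abs_cvg abs u l -> abs_cvg abs (fun n => c * u n) (c * l).
Proof.
have [->|c0] := eqVneq c 0.
  move=> _; apply/abs_cvgP => e e0; exists 0%N => n _.
  by rewrite !mul0r subr0 (abs0 na).
move=> /abs_cvgP H; apply/abs_cvgP => e e0.
have ac : 0 < abs c by rewrite (abs_gt0 na).
have [N HN] := H (e / abs c) (divr_gt0 e0 ac); exists N => n /HN.
by rewrite -mulrBr (absM na) ltr_pdivlMr// mulrC.
Qed.

Lemma fps_sumD f g x y y' : fps_sum abs f x y -> fps_sum abs g x y' ->
  fps_sum abs (f + g) x (y + y').
Proof.
move=> H H'; have := abs_cvgD H H'; rewrite /fps_sum.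
congr abs_cvg; apply/funext => n; rewrite -big_split /=.
by apply: eq_bigr => i _; rewrite -mulrDl.
Qed.

Lemma fps_sumCM c f x y : fps_sum abs f x y -> fps_sum abs (fps_const c * f) x (c * y).
Proof.
move=> /(abs_cvgMl c); rewrite /fps_sum; congr abs_cvg.
by apply/funext => n; rewrite mulr_sumr; apply: eq_bigr => i _; rewrite fcoefCM mulrA.
Qed.

Lemma fps_sumN f x y : fps_sum abs f x y -> fps_sum abs (- f) x (- y).
Proof.
by move/(fps_sumCM (- 1)); rewrite rmorphN rmorph1 !mulN1r.
Qed.

Lemma fps_sum_poly P x : fps_sum abs (fps_of_poly P) x P.[x].
Proof.
apply/abs_cvgP => e e0; exists (size P) => n le.
rewrite (horner_coef_wide _ le) subrr (abs0 na)//.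
Qed.

Lemma bnd_cvg f C x : bnd abs f C -> abs x < 1 -> exists y, fps_sum abs f x y.
Proof.
move=> fC x1; apply: complete => e e0.
have [N HN] := geometric_small C (abs_ge0 na x) x1 e0; exists N.
have key m n : (N <= m)%N -> (m <= n)%N ->
    abs (\sum_(i < n) fcoef f i * x ^+ i - \sum_(i < m) fcoef f i * x ^+ i) < e.
  move=> Nm mn; rewrite -(big_mkord xpredT (fun i => fcoef f i * x ^+ i)).
  rewrite (big_cat_nat (n := m))//= -(big_mkord xpredT (fun i => fcoef f i * x ^+ i)).
  rewrite addrAC subrr add0r big_nat; apply: (abs_sum_lt na) => // i /andP[mi _].
  rewrite (absM na) (absX na); apply: le_lt_trans (HN i (leq_trans Nm mi)).
  by rewrite ler_wpM2r ?exprn_ge0 ?(abs_ge0 na).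
move=> m n Nm Nn; have [mn|/ltnW nm] := leqP m n; last exact: key.
by rewrite (abs_subC na) key.
Qed.

Definition ev f x : K := xget 0 [set y | fps_sum abs f x y].

Lemma fps_sum_ev f x y : fps_sum abs f x y -> ev f x = y.
Proof.
move=> H; apply: xget_unique => //= y' H'; exact: abs_cvg_unique H' H.
Qed.

Lemma evP f C x : bnd abs f C -> abs x < 1 -> fps_sum abs f x (ev f x).
Proof. by move=> fC x1; apply: xgetPex (bnd_cvg fC x1). Qed.

Lemma ev_poly P x : ev (fps_of_poly P) x = P.[x].
Proof. exact/fps_sum_ev/fps_sum_poly. Qed.

Lemma evD f g C D x : bnd abs f C -> bnd abs g D -> abs x < 1 ->
  ev (f + g) x = ev f x + ev g x.
Proof. by move=> fC gD x1; apply/fps_sum_ev/fps_sumD; apply: evP. Qed.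

Lemma evN f C x : bnd abs f C -> abs x < 1 -> ev (- f) x = - ev f x.
Proof. by move=> fC x1; apply/fps_sum_ev/fps_sumN; apply: evP x1. Qed.

Lemma evB f g C D x : bnd abs f C -> bnd abs g D -> abs x < 1 ->
  ev (f - g) x = ev f x - ev g x.
Proof. by move=> fC gD x1; rewrite (evD fC (bndN na gD))// (evN gD). Qed.

Lemma ev_sum I (r : seq I) (F : I -> fps K) C x :
  (forall i, bnd abs (F i) C) -> abs x < 1 ->
  ev (\sum_(i <- r) F i) x = \sum_(i <- r) ev (F i) x.
Proof.
move=> FC x1; have C0 : 0 <= C \/ r = [::].
  by case: r => [|i r]; [right|left; apply: bnd_ge0 (FC i)].
case: C0 => [C0|->]; last by rewrite !big_nil ev_poly horner0.
elim: r => [|i r IH]; first by rewrite !big_nil ev_poly horner0.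
by rewrite !big_cons (evD (FC i) (bnd_sum na r C0 (fun i (_ : xpredT i) => FC i)))// IH.
Qed.

Lemma ev_le f C x : bnd abs f C -> abs x < 1 -> abs (ev f x) <= C.
Proof.
move=> fC x1; apply: abs_cvg_le (evP fC x1); exists 0%N => n _.
apply: (abs_sum_le na) (bnd_ge0 na fC) _ => i _; rewrite (absM na) (absX na).
by rewrite -[C]mulr1 ler_pM ?(abs_ge0 na) ?exprn_ge0 ?exprn_ile1 ?(ltW x1)// (abs_ge0 na).
Qed.

Lemma ev_shift f z x : ev (fps_shift z f) x = ev f (z * x).
Proof.
rewrite /ev; congr xget; apply: eq_set => y; rewrite /fps_sum; congr abs_cvg.
by apply/funext => n; apply: eq_bigr => i _; rewrite /= exprMn mulrA.
Qed.

Lemma fcoefXsubM x g n : fcoef (fps_of_poly ('X - x%:P) * g) n =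
  (if n is n'.+1 then fcoef g n' else 0) - x * fcoef g n.
Proof.
rewrite rmorphB mulrBl fcoefB -/(fps_const x) fcoefCM -['X]expr1 fcoefXnM.
by case: n => //= n; rewrite subn1.
Qed.

(** The partial sums telescope to a single term, a coefficient of [g] times a power of x, which
    tends to 0. *)
Lemma ev_XsubM g C x : bnd abs g C -> abs x < 1 ->
  ev (fps_of_poly ('X - x%:P) * g) x = 0.
Proof.
move=> gC x1; apply/fps_sum_ev/abs_cvgP => e e0.
have E n : \sum_(i < n) fcoef (fps_of_poly ('X - x%:P) * g) i * x ^+ i =
    if n is n'.+1 then - fcoef g n' * x ^+ n'.+1 else 0.
  elim: n => [|n IH]; first by rewrite big_ord0.
  rewrite big_ord_recr IH fcoefXsubM; case: n {IH} => [|n]; rewrite /= ?exprS ?expr0; ring.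
have [N HN] := geometric_small C (abs_ge0 na x) x1 e0; exists N.+1 => -[//|n] Nn.
rewrite subr0 E mulNr (absN na) (absM na) (absX na).
apply: le_lt_trans (HN n.+1 (ltnW Nn)).
by rewrite ler_wpM2r ?exprn_ge0 ?(abs_ge0 na).
Qed.

(** The quotient has as coefficient of index n the tail of the series at x from index n + 1 on,
    divided by x^(n+1). The ultrametric inequality bounds this tail by C |x|^(n+1), so the bound C
    is kept. Multiplicativity of evaluation and the Lipschitz estimate both follow from this
    division. *)
Lemma ev_divide f C x : bnd abs f C -> abs x < 1 ->
  exists2 g, bnd abs g C & f = fps_const (ev f x) + fps_of_poly ('X - x%:P) * g.
Proof.
move=> fC x1; have [->|x0] := eqVneq x 0.
  exists (Fps (fun n => fcoef f n.+1)) => [i|]; first exact: fC.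
  have -> : ev f 0 = fcoef f 0.
    apply/fps_sum_ev/abs_cvgP => e e0; exists 1%N => -[//|n] _.
    rewrite big_ord_recl/= mulr1 big1 ?addr0 ?subrr ?(abs0 na)// => i _.
    by rewrite expr0n mulr0.
  apply: fpsP => n; rewrite fcoefD fcoefXsubM /= coefC mul0r subr0.
  by case: n => [|n]; rewrite ?addr0 ?add0r.
set y := ev f x.
pose g := Fps (fun n => (y - \sum_(i < n.+1) fcoef f i * x ^+ i) / x ^+ n.+1).
exists g => [n|].
  rewrite /= (absM na) (absV na) ler_pdivrMr ?(absX na) ?exprn_gt0 ?(abs_gt0 na)//.
  have : abs_cvg abs (fun k => \sum_(i < k) fcoef f i * x ^+ i - \sum_(i < n.+1) fcoef f i * x ^+ i)
      (y - \sum_(i < n.+1) fcoef f i * x ^+ i).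
    move: (evP fC x1) => /abs_cvgP H; apply/abs_cvgP => e /H[N HN]; exists N => k /HN.
    by rewrite opprB addrA subrK.
  apply: abs_cvg_le; exists n.+1 => k nk.
  rewrite -(big_mkord xpredT (fun i => fcoef f i * x ^+ i)).
  rewrite (big_cat_nat (n := n.+1))//= -(big_mkord xpredT (fun i => fcoef f i * x ^+ i)).
  rewrite addrAC subrr add0r big_nat; apply: (abs_sum_le na).
    by rewrite mulr_ge0 ?exprn_ge0 ?(abs_ge0 na) ?(bnd_ge0 na fC).
  move=> i /andP[ni _]; rewrite (absM na) (absX na) ler_pM ?exprn_ge0 ?(abs_ge0 na)//.
  by rewrite ler_wiXn2l ?(abs_ge0 na)// ltW.
apply: fpsP => n; rewrite fcoefD fcoefXsubM /= coefC; case: n => [|n] /=.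
  by rewrite big_ord1 expr0 expr1; field.
rewrite (big_ord_recr n.+1) /=; have xn0 : x ^+ n.+1 != 0 by rewrite expf_neq0.
by rewrite [x ^+ n.+2]exprS; move: (x ^+ n.+1) xn0 => X X0; field; rewrite X0 x0.
Qed.

Lemma evM f g C D x : bnd abs f C -> bnd abs g D -> abs x < 1 ->
  ev (f * g) x = ev f x * ev g x.
Proof.
move=> fC gD x1; have [f1 f1C fE] := ev_divide fC x1.
rewrite {1}fE mulrDl -mulrA.
have b := bndM na f1C gD.
have b' : bnd abs (fps_of_poly ('X - x%:P) * (f1 * g)) (1 * (C * D)).
  apply: bndM => // i; rewrite rmorphB fcoefB (absB_le na)//.
    by have := bndXn na 1 i; rewrite expr1.
  by rewrite /= coefC; case: eqP => _; rewrite ?(abs0 na)// ltW.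
rewrite (evD (bndCM na _ gD) b')// (ev_XsubM b)// addr0.
exact/fps_sum_ev/fps_sumCM/(evP gD).
Qed.

Lemma ev_prod I (r : seq I) (F : I -> fps K) C x :
  (forall i, bnd abs (F i) C) -> abs x < 1 ->
  ev (\prod_(i <- r) F i) x = \prod_(i <- r) ev (F i) x.
Proof.
move=> FC x1; suff [] : (exists D, bnd abs (\prod_(i <- r) F i) D) /\
  ev (\prod_(i <- r) F i) x = \prod_(i <- r) ev (F i) x by [].
elim: r => [|i r [[D IHD] IH]].
  by rewrite !big_nil ev_poly hornerE; split => //; exists 1; exact: bnd1.
rewrite !big_cons; split; first by exists (C * D); apply: bndM.
by rewrite (evM (FC i) IHD)// IH.
Qed.

Lemma ev_lipschitz f C x y : bnd abs f C -> abs x < 1 -> abs y < 1 ->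
  abs (ev f x - ev f y) <= C * abs (x - y).
Proof.
move=> fC x1 y1; have [g gC fE] := ev_divide fC y1.
have bX : bnd abs (fps_of_poly ('X - y%:P)) 1.
  move=> i; rewrite rmorphB fcoefB (absB_le na)//.
    by have := bndXn na 1 i; rewrite expr1.
  by rewrite /= coefC; case: eqP => _; rewrite ?(abs0 na)// ltW.
have bC : bnd abs (fps_const (ev f y)) (abs (ev f y)).
  by move=> i; rewrite /= coefC; case: eqP => _; rewrite ?(abs0 na) ?(abs_ge0 na).
rewrite {1}fE (evD bC (bndM na bX gC))// (evM bX gC)// !ev_poly !hornerE addrC addKr.
by rewrite (absM na) mulrC ler_wpM2r ?(abs_ge0 na)// (ev_le gC).
Qed.
End Evaluation.
Section ResidueCharacteristic.
Variables (R : realType) (p : nat) (K : fieldType) (abs : K -> R).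
Hypotheses (p_prime : prime p) (na : nonarch_abs abs).
Hypothesis abs_p : abs p%:R = p%:R^-1.

Lemma p_natr_gt0 : 0 < p%:R :> R.
Proof. by rewrite ltr0n prime_gt0. Qed.

Lemma abs_p_natr_lt1 : abs p%:R < 1.
Proof. by rewrite abs_p invf_lt1 ?p_natr_gt0// ltr1n prime_gt1. Qed.

(** Bezout: if n had absolute value below 1 along with p, so would 1. *)
Lemma abs_natr_coprime n : coprime p n -> abs n%:R = 1.
Proof.
move=> /eqP pn; apply/eqP; rewrite eq_le (abs_nat_le1 na) /= leNgt; apply/negP => n1.
case: (egcdnP n (prime_gt0 p_prime)) => a b; rewrite pn => e _.
have : abs ((a * p)%:R - (b * n)%:R) < 1.
  apply: (absB_lt na); rewrite natrM (absM na).
    by apply: le_lt_trans abs_p_natr_lt1; rewrite ler_piMl ?(abs_ge0 na) ?(abs_nat_le1 na).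
  by apply: le_lt_trans n1; rewrite ler_piMl ?(abs_ge0 na) ?(abs_nat_le1 na).
by rewrite e natrD addrC addKr (abs1 na) ltxx.
Qed.
End ResidueCharacteristic.

Lemma sum_prim_root_exp (F : fieldType) N (w : F) s : N.-primitive_root w ->
  \sum_(k < N) (w ^+ s) ^+ k = if (N %| s)%N then N%:R else 0.
Proof.
move=> wP; case: ifP => [Ns|/negbT Ns].
  have -> : w ^+ s = 1 by apply/eqP; rewrite -(prim_order_dvd wP).
  by under eq_bigr do rewrite expr1n; rewrite sumr_const card_ord.
have ws1 : w ^+ s - 1 != 0 by rewrite subr_eq0 -(prim_order_dvd wP).
apply: (mulfI ws1); rewrite -subrX1 mulr0 -exprM mulnC exprM.
by rewrite (prim_expr_order wP) expr1n subrr.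
Qed.

(** * Roots of unity and the maximum modulus principle *)

Section MaximumModulus.
Variables (R : realType) (p : nat) (K : closedFieldType) (abs : K -> R).
Hypotheses (p_prime : prime p) (K_char0 : [pchar K] =i pred0).
Hypotheses (na : nonarch_abs abs) (complete : abs_complete abs).
Hypothesis abs_p : abs p%:R = p%:R^-1.
Implicit Types (x y : K) (f g h : fps K) (P Q : {poly K}) (C D e : R).

Lemma char0_natr_neq0 n : (0 < n)%N -> n%:R != 0 :> K.
Proof. by move=> n0; rewrite ((pcharf0P K).1 K_char0) -lt0n. Qed.

Lemma prim_root_exists N : (0 < N)%N -> exists w : K, N.-primitive_root w.
Proof.
move=> N_gt0; pose P := 'X^N - 1 : {poly K}; have [r Dp] := closed_field_poly_normal P.
move: Dp; rewrite (monicP _) ?monicXnsubC // scale1r => Dp.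
have rn1 : all N.-unity_root r by apply/allP=> z; rewrite -root_prod_XsubC -Dp.
have sz_r : (N < (size r).+1)%N.
  by rewrite -(size_prod_XsubC r id) -Dp size_XnsubC.
have [|z] := hasP (has_prim_root N_gt0 rn1 _ sz_r); last by exists z.
by rewrite -separable_prod_XsubC -Dp separable_Xn_sub_1 // char0_natr_neq0.
Qed.

Lemma root_exists k (a : K) : (0 < k)%N -> exists x, x ^+ k = a.
Proof.
move=> k0; have : size ('X^k - a%:P) != 1%N by rewrite size_XnsubC// eqSS -lt0n.
by move/closed_rootP => [x]; rewrite /root !hornerE subr_eq0 => /eqP; exists x.
Qed.

Lemma abs_unity N (w : K) : (0 < N)%N -> w ^+ N = 1 -> abs w = 1.
Proof.
move=> N0 w1; apply/eqP; rewrite -(@pexpr_eq1 _ _ N) ?(abs_ge0 na) ?lt0n_neq0//.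
by rewrite -(absX na) w1 (abs1 na).
Qed.

(** Roots of p of high order provide values |a| < 1 as close to 1 as desired, so the factor |a|^k
    can be removed. *)
Lemma abs_close_to1 C D k : (forall a, a != 0 -> abs a < 1 -> C * abs a ^+ k <= D) ->
  0 < D -> C <= D.
Proof.
move=> H D0; rewrite leNgt; apply/negP => DC.
have C0 : 0 < C by apply: lt_trans DC.
case: k H => [|k] H.
  have := H p%:R (char0_natr_neq0 (prime_gt0 p_prime)) (abs_p_natr_lt1 p_prime abs_p).
  by rewrite expr0 mulr1 leNgt DC.
have [|N HN] := @geometric_large R p%:R (C / D); first by rewrite ltr_pdivlMr ?mul1r.
have [a ak] := @root_exists (k.+1 * N.+1) p%:R isT.
have a0 : a != 0.
  apply/eqP => a0; move: ak; rewrite a0 expr0n muln_eq0 /= => /eqP.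
  by rewrite eq_sym (negbTE (char0_natr_neq0 (prime_gt0 p_prime))).
have a1 : abs a < 1.
  rewrite -(@expr_lt1 _ (k.+1 * N.+1)) ?(abs_ge0 na)//.
  by rewrite -(absX na) ak (abs_p_natr_lt1 p_prime abs_p).
have := H a a0 a1; rewrite -ler_pdivlMl// mulrC -[leRHS]invf_div => le.
have CD : 0 < C / D by rewrite divr_gt0.
have : (abs a ^+ k.+1) ^+ N.+1 <= (C / D)^-1 ^+ N.+1.
  by rewrite lerXn2r ?nnegrE ?exprn_ge0 ?(abs_ge0 na)// invr_ge0 ltW.
rewrite -exprM -(absX na) ak abs_p exprVn lef_pV2 ?posrE ?(p_natr_gt0 R p_prime) ?exprn_gt0//.
by rewrite leNgt HN.
Qed.

(** A Cauchy estimate by finite Fourier inversion: the coefficient of index i is recovered from the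
    values at the points a w^k, where w is a primitive N-th root of unity. The terms of index at
    least N are at most e in absolute value, which is harmless in an ultrametric sum. *)
Lemma maximum_modulus g e : 0 < e ->
  (forall x, abs x < 1 -> exists2 y, fps_sum abs g x y & abs y <= e) -> bnd abs g e.
Proof.
move=> e0 ge i; apply: (@abs_close_to1 _ _ i) => // a a0 a1.
have [y /(abs_cvgP na) ay _] := ge a a1.
have [N0 HN0] := ay e e0.
have tail j : (N0 <= j)%N -> abs (fcoef g j * a ^+ j) <= e.
  move=> Nj; have := absB_lt na (HN0 _ (leqW Nj)) (HN0 _ Nj).
  move/ltW; rewrite big_ord_recr /=; set S := \sum_(_ < _) _; set t := _ * _.
  by have -> : S + t - y - (S - y) = t by ring.
(* N exceeds both N0 and i, and is 1 modulo p, so that the division by N in the inversion formula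
   does not change absolute values. *)
pose N := (p * (maxn N0 i).+1).+1.
have N0N : (N0 <= N)%N.
  rewrite /N; apply: leqW; apply: leq_trans (_ : (maxn N0 i).+1 <= _)%N.
    by rewrite leqW// leq_maxl.
  by rewrite leq_pmull// prime_gt0.
have iN : (i < N)%N.
  rewrite /N ltnS; apply: leq_trans (_ : (maxn N0 i).+1 <= _)%N.
    by rewrite leqW// leq_maxr.
  by rewrite leq_pmull// prime_gt0.
have [w wP] := @prim_root_exists N isT.
have w1 : abs w = 1 by apply: (@abs_unity N) => //; exact: prim_expr_order.
pose T k := \sum_(j < N) fcoef g j * (a * w ^+ k) ^+ j.
have TE k : abs (T k) <= e.
  have [|z zS ze] := ge (a * w ^+ k); first by rewrite (absM na) (absX na) w1 expr1n mulr1.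
  suff : abs (z - T k) <= e.
    by move/(absB_le na ze); rewrite opprB addrC subrK.
  have : abs_cvg abs (fun n => \sum_(j < n) fcoef g j * (a * w ^+ k) ^+ j - T k) (z - T k).
    by move/(abs_cvgD na): zS; apply; apply/(abs_cvgP na) => e' e'0; exists 0%N => n _;
      rewrite subrr (abs0 na).
  apply: (abs_cvg_le na); exists N => n Nn.
  rewrite /T -!(big_mkord xpredT (fun j => fcoef g j * (a * w ^+ k) ^+ j)).
  rewrite (big_cat_nat (n := N))//= addrAC subrr add0r big_nat.
  apply: (abs_sum_le na) => [|j /andP[Nj _]]; first exact: ltW.
  rewrite exprMn mulrA (absM na) !(absX na) w1 !expr1n mulr1.
  exact/tail/(leq_trans N0N).
have : abs (\sum_(k < N) w ^+ (k * (N - i)) * T k) <= e.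
  apply: (abs_sum_le na) => [|k _]; first exact: ltW.
  by rewrite (absM na) (absX na) w1 expr1n mul1r.
have -> : \sum_(k < N) w ^+ (k * (N - i)) * T k = N%:R * (fcoef g i * a ^+ i).
  transitivity (\sum_(j < N) fcoef g j * a ^+ j * \sum_(k < N) (w ^+ (N - i + j)) ^+ k).
    under eq_bigr do rewrite mulr_sumr; rewrite exchange_big /=; apply: eq_bigr => j _.
    rewrite mulr_sumr; apply: eq_bigr => k _.
    rewrite exprMn -!exprM.
    have -> : ((N - i + j) * k = k * (N - i) + k * j)%N by rewrite mulnC mulnDr.
    by rewrite exprD; ring.
  rewrite (bigD1 (Ordinal iN))//= [X in _ + X]big1 => [|j ji].
    by rewrite addr0 sum_prim_root_exp// subnK ?dvdnn 1?ltnW// mulrC.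
  rewrite sum_prim_root_exp// ifF ?mulr0//; apply/negbTE/negP.
  move: ji; rewrite -val_eqE/= => ji /dvdnP[[|[|c]]]; have := ltn_ord j; rewrite ?mulSn; lia.
rewrite (absM na) (abs_natr_coprime p_prime na abs_p) ?mul1r ?(absM na) ?(absX na)//.
by rewrite -coprime_modr /N -addn1 mulnC modnMDl coprime_modr coprimen1.
Qed.
End MaximumModulus.

(** * Analytic elements on the open unit disc *)

Lemma ratio_add (U : comUnitRingType) (a b u v : U) :
  u \is a GRing.unit -> v \is a GRing.unit ->
  (a * v + b * u) / (u * v) = a / u + b / v.
Proof.
by move=> uu uv; rewrite mulrDl invrM// mulrA mulrK// [v^-1 * _]mulrC mulrA mulrK.
Qed.

Section AnalyticElements.
Variables (R : realType) (p : nat) (K : closedFieldType) (abs : K -> R).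
Hypotheses (p_prime : prime p) (K_char0 : [pchar K] =i pred0).
Hypotheses (na : nonarch_abs abs) (complete : abs_complete abs).
Hypothesis abs_p : abs p%:R = p%:R^-1.
Implicit Types (x y z c : K) (f g h : fps K) (P Q : {poly K}) (C D e : R).
Local Notation "P %:S" := (fps_of_poly P) (at level 2, format "P %:S").
Local Notation bnd := (bnd abs).
Local Notation dom := (dom abs).
Local Notation E0 := (E0 abs).
Local Notation ev := (ev abs).

Definition zero_free Q := forall x, abs x < 1 -> Q.[x] != 0.

Lemma dom_const c : c != 0 -> dom (fps_const c) 0.
Proof.
move=> c0; split=> //= [|i]; rewrite coefC//.
by case: eqP => _; rewrite ?coefC//= (abs0 na) (abs_ge0 na).
Qed.

Lemma dom_Xsub z : dom ('X - z%:P)%:S (abs z < 1)%R.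
Proof.
have X i : abs ('X - z%:P)`_i = if i == 0%N then abs z else if i == 1%N then 1 else 0.
  rewrite coefB coefX coefC; case: i => [|[|i]]/=; rewrite ?sub0r ?subr0 ?(absN na)//.
    by rewrite (abs1 na).
  by rewrite (abs0 na).
case: ltP => z1; split=> [|i|i] //; rewrite -?(abs_gt0 na) /= ?X//=.
  by case: i => [|[|i]] //=; rewrite ltW.
  by case: i => [|i].
  exact: lt_le_trans ltr01 z1.
by case: i => [|[|i]] //=; apply: (abs_ge0 na).
Qed.

(** Dominant indices add up under multiplication, and that of X - z is 1 or 0 according to whether z
    lies in the open disc. *)
Lemma dom_roots c (r : seq K) : c != 0 ->
  dom (c *: \prod_(z <- r) ('X - z%:P))%:S (count (fun z => abs z < 1) r).
Proof.
move=> c0; rewrite -mul_polyC rmorphM rmorph_prod -[count _ _]add0n.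
apply: (domM na); first exact: dom_const.
have -> : count (fun z => abs z < 1) r = (\sum_(i <- r) nat_of_bool (abs i < 1)%R)%N.
  by rewrite -sum1_count big_mkcond; apply: eq_bigr => i _; case: ifP.
exact: (dom_prod na) dom_Xsub.
Qed.

Lemma zero_free_dom Q : zero_free Q -> dom Q%:S 0.
Proof.
move=> zf; have Q0 : Q != 0.
  by apply/eqP => Q0; have := zf 0; rewrite Q0 (abs0 na) horner0 eqxx => /(_ ltr01).
have [r Qr] := closed_field_poly_normal Q.
have lQ : lead_coef Q != 0 by rewrite lead_coef_eq0.
have := dom_roots r lQ; rewrite -Qr; suff -> : count (fun z => abs z < 1) r = 0%N by [].
apply/eqP; rewrite -leqn0 leqNgt -has_count; apply/negP => /hasP[z zr z1].
have := zf z z1; rewrite Qr hornerZ mulf_eq0 (negbTE lQ) /= -/(root _ z) root_prod_XsubC.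
by rewrite zr.
Qed.

Lemma dom0_zero_free Q : dom Q%:S 0 -> zero_free Q.
Proof.
move=> d x x1; have Q0 : Q != 0.
  by apply/eqP => Q0; case: d; rewrite Q0 rmorph0 fcoef0 eqxx.
have [r Qr] := closed_field_poly_normal Q.
have lQ : lead_coef Q != 0 by rewrite lead_coef_eq0.
have := dom_roots r lQ; rewrite -Qr => /(dom_uniq d)/esym/eqP.
rewrite -leqn0 leqNgt -has_count => /hasPn H.
rewrite Qr hornerZ mulf_neq0// -/(root _ x) root_prod_XsubC.
by apply/negP => /H; rewrite x1.
Qed.

Lemma bnd_poly P : exists C, bnd P%:S C.
Proof.
have [->|/(dom_poly na)[n [_ P1 _]]] := eqVneq P 0; last by exists (abs P`_n).
by exists 0; rewrite rmorph0; exact: bnd0.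
Qed.

Lemma bnd_ratio P Q : zero_free Q -> exists C, bnd (P%:S / Q%:S) C.
Proof.
move=> /zero_free_dom d; have [C PC] := bnd_poly P; eexists.
exact: (bndM na PC (dom0_bndV na d)).
Qed.

Lemma ev_ratio P Q x : zero_free Q -> abs x < 1 -> ev (P%:S / Q%:S) x = P.[x] / Q.[x].
Proof.
move=> zf x1; have [C PQC] := bnd_ratio P zf; have [D QD] := bnd_poly Q.
apply/(canRL (mulfK (zf x x1))); rewrite -!(ev_poly na) -(evM na complete PQC QD)//.
by rewrite divrK// (dom0_unit (zero_free_dom zf)).
Qed.

(** Replaces the pointwise approximation in the definition of analytic elements by a coefficientwise
    one; the maximum modulus principle gives the direct implication. *)
Lemma rat_approxE f P Q e : 0 < e ->
  rat_approx abs f P Q e <-> zero_free Q /\ bnd (f - P%:S / Q%:S) e.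
Proof.
move=> e0; split=> [H|[zf H] x x1].
  have zf : zero_free Q by move=> x /H[].
  split=> //; apply: (maximum_modulus p_prime K_char0 na abs_p) => // x x1.
  have [_ [y yS ye]] := H x x1; exists (y - P.[x] / Q.[x]) => //.
  have [C PQC] := bnd_ratio P zf.
  apply: (fps_sumD na yS); apply: (fps_sumN na).
  by rewrite -ev_ratio//; apply: (evP na complete PQC).
split; first exact: zf.
have [C PQC] := bnd_ratio P zf; have fE : f = f - P%:S / Q%:S + P%:S / Q%:S by rewrite subrK.
exists (ev f x).
  rewrite fE; have := fps_sumD na (evP na complete H x1) (evP na complete PQC x1).
  by move=> S; rewrite (fps_sum_ev na S).
by rewrite -ev_ratio// {1}fE (evD na complete H PQC)// addrK (ev_le na complete H).
Qed.

Lemma E0P f : E0 f <-> forall e, 0 < e ->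
  exists P Q, zero_free Q /\ bnd (f - P%:S / Q%:S) e.
Proof.
by split=> H e e0; have [P [Q]] := H e e0; move=> /(rat_approxE _ _ _ e0); exists P, Q.
Qed.

Lemma E0_bnd f : E0 f -> exists C, bnd f C.
Proof.
move=> /E0P/(_ 1 ltr01)[P [Q [zf H]]]; have [C PQC] := bnd_ratio P zf.
exists (Num.max 1 C); rewrite -[f](subrK (P%:S / Q%:S)); apply: (bndD na).
  by apply: bndW H; rewrite le_max lexx.
by apply: bndW PQC; rewrite le_max lexx orbT.
Qed.

Lemma E0_limit f : (forall e, 0 < e -> exists2 g, E0 g & bnd (f - g) e) -> E0 f.
Proof.
move=> H; apply/E0P => e e0; have [g /E0P/(_ e e0)[P [Q [zf gPQ]]] fg] := H e e0.
exists P, Q; split=> //; rewrite -[f](subrK g) -addrA; exact: bndD.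
Qed.

Lemma zero_free1 : zero_free 1.
Proof. by move=> x _; rewrite hornerC oner_eq0. Qed.

Lemma zero_freeM Q Q' : zero_free Q -> zero_free Q' -> zero_free (Q * Q').
Proof. by move=> z z' x x1; rewrite hornerM mulf_neq0 ?z ?z'. Qed.

Lemma zero_free_unit Q : zero_free Q -> Q%:S \is a GRing.unit.
Proof. by move/zero_free_dom/dom0_unit. Qed.

Lemma E0_ratio P Q : zero_free Q -> E0 (P%:S / Q%:S).
Proof. by move=> zf; apply/E0P => e e0; exists P, Q; split=> //; rewrite subrr; apply: bnd0 => //; exact: ltW. Qed.

Lemma E0_poly P : E0 P%:S.
Proof. by have := E0_ratio P zero_free1; rewrite rmorph1 divr1. Qed.

Lemma E0D f g : E0 f -> E0 g -> E0 (f + g).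
Proof.
move=> /E0P Hf /E0P Hg; apply/E0P => e e0.
have [P [Q [zf fPQ]]] := Hf e e0; have [P' [Q' [zf' gPQ]]] := Hg e e0.
exists (P * Q' + P' * Q), (Q * Q'); split; first exact: zero_freeM.
rewrite rmorphD !rmorphM ratio_add ?zero_free_unit//.
by rewrite opprD addrACA; apply: bndD.
Qed.

Lemma E0CM c f : E0 f -> E0 (fps_const c * f).
Proof.
have [->|c0] := eqVneq c 0; first by rewrite rmorph0 mul0r => _; exact: (E0_poly 0).
move=> /E0P Hf; apply/E0P => e e0; have ac : 0 < abs c by rewrite (abs_gt0 na).
have [P [Q [zf fPQ]]] := Hf (e / abs c) (divr_gt0 e0 ac).
exists (c%:P * P), Q; split=> //; rewrite rmorphM -mulrA -mulrBr.
by apply: bndW (bndCM na c fPQ); rewrite mulrC divfK ?gt_eqF.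
Qed.

Lemma E0N f : E0 f -> E0 (- f).
Proof. by move/(E0CM (- 1)); rewrite rmorphN rmorph1 mulN1r. Qed.

Lemma E0B f g : E0 f -> E0 g -> E0 (f - g).
Proof. by move=> Hf Hg; apply: E0D => //; exact: E0N. Qed.

Lemma E0M f g : E0 f -> E0 g -> E0 (f * g).
Proof.
move=> Hf Hg; have [Cg gC] := E0_bnd Hg.
have Cg0 : 0 < Cg + 1 by rewrite ltr_wpDl ?(bnd_ge0 na gC).
apply: E0_limit => e e0.
have [P [Q [zf fPQ]]] := (E0P f).1 Hf (e / (Cg + 1)) (divr_gt0 e0 Cg0).
have [C PQC] := bnd_ratio P zf.
have C0 : 0 < C + 1 by rewrite ltr_wpDl ?(bnd_ge0 na PQC).
have [P' [Q' [zf' gPQ]]] := (E0P g).1 Hg (e / (C + 1)) (divr_gt0 e0 C0).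
exists ((P%:S / Q%:S) * (P'%:S / Q'%:S)).
  rewrite mulrACA -invrM ?zero_free_unit// -!rmorphM.
  exact/E0_ratio/zero_freeM.
rewrite (_ : _ - _ = (f - P%:S / Q%:S) * g + P%:S / Q%:S * (g - P'%:S / Q'%:S)); last by ring.
apply: (bndD na).
  apply: bndW (bndM na fPQ gC); rewrite mulrAC -mulrA ger_pMr// ler_pdivrMr// mul1r lerDl//.
apply: bndW (bndM na PQC gPQ); rewrite mulrA mulrAC ger_pMl// ler_pdivrMr// mul1r lerDl//.
Qed.

Lemma E0_sum I (r : seq I) (S : pred I) (F : I -> fps K) :
  (forall i, S i -> E0 (F i)) -> E0 (\sum_(i <- r | S i) F i).
Proof. by move=> H; elim/big_ind: _ => //; [exact: (E0_poly 0)|exact: E0D]. Qed.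

Lemma E0_prod I (r : seq I) (S : pred I) (F : I -> fps K) :
  (forall i, S i -> E0 (F i)) -> E0 (\prod_(i <- r | S i) F i).
Proof. by move=> H; elim/big_ind: _ => //; [exact: (E0_poly 1)|exact: E0M]. Qed.

Lemma zero_free_comp Q c : abs c = 1 -> zero_free Q -> zero_free (Q \Po (c *: 'X)).
Proof.
by move=> c1 zf x x1; rewrite horner_comp !hornerE zf// (absM na) c1 mul1r.
Qed.

Lemma E0_shift c f : abs c = 1 -> E0 f -> E0 (fps_shift c f).
Proof.
move=> c1 /E0P Hf; apply/E0P => e e0; have [P [Q [zf fPQ]]] := Hf e e0.
exists (P \Po (c *: 'X)), (Q \Po (c *: 'X)); split; first exact: zero_free_comp.
rewrite -!fps_shift_poly -rmorphV ?zero_free_unit// -rmorphM -rmorphB.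
exact: bnd_shift.
Qed.

Lemma dom_ratio P Q n : zero_free Q -> dom P%:S n <-> dom (P%:S / Q%:S) n.
Proof.
move=> zf; have d := zero_free_dom zf; split=> H.
  by rewrite -[n]addn0; apply: (domM na) => //; exact: dom0V.
by rewrite -[P%:S](divrK (zero_free_unit zf)) -[n]addn0; apply: (domM na).
Qed.

(** A rational function closer to f than the size of some nonzero coefficient of f has a dominant
    coefficient above the error, and therefore shares its dominant index with f. *)
Lemma E0_dom f : E0 f -> f != 0 -> exists n, dom f n.
Proof.
move=> /E0P Hf f0; have [i fi _] := fps_ord f0.
have e0 : 0 < abs (fcoef f i) / 2 by rewrite divr_gt0 ?(abs_gt0 na).
have lte : abs (fcoef f i) / 2 < abs (fcoef f i).
  by rewrite ltr_pdivrMr// ltr_pMr ?(abs_gt0 na)// ltr1n.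
have [P [Q [zf fPQ]]] := Hf _ e0; set g := P%:S / Q%:S in fPQ.
have gi : abs (fcoef g i) = abs (fcoef f i).
  have -> : fcoef g i = fcoef f i - fcoef (f - g) i by rewrite fcoefB opprB addrC subrK.
  by rewrite (absB_dom na)// (le_lt_trans (fPQ i)).
have P0 : P != 0.
  apply/eqP => P0; move/eqP: gi; rewrite /g P0 rmorph0 mul0r fcoef0 (abs0 na) eq_sym.
  by rewrite (abs_eq0 na) (negbTE fi).
have [n /(dom_ratio _ _ zf) dn] := dom_poly na P0; exists n.
apply: (dom_near na dn) => j; rewrite -opprB fcoefN (absN na).
apply: le_lt_trans (fPQ j) _; apply: lt_le_trans lte _.
by rewrite -gi; case: dn => _ + _; exact.
Qed.

Lemma E0V f : E0 f -> dom f 0 -> E0 f^-1.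
Proof.
move=> Hf df; have [f0 f1 _] := df; have a0 : 0 < abs (fcoef f 0) by rewrite (abs_gt0 na).
apply: E0_limit => e e0.
(* The first bound keeps the approximation g invertible with |g_0| = |f_0|; the second absorbs the
   factor |f_0|^-2 coming from f^-1 - g^-1 = - f^-1 (f - g) g^-1. *)
pose e' := Num.min (abs (fcoef f 0) / 2) (e * abs (fcoef f 0) ^+ 2).
have e'0 : 0 < e' by rewrite lt_min divr_gt0//= mulr_gt0 ?exprn_gt0.
have [P [Q [zf fPQ]]] := (E0P f).1 Hf e' e'0; set g := P%:S / Q%:S in fPQ.
have e'f : e' < abs (fcoef f 0).
  by rewrite gt_min; apply/orP; left; rewrite ltr_pdivrMr// ltr_pMr// ltr1n.
have dg : dom g 0 by apply: (dom_near na df) => i; apply: le_lt_trans (fPQ i) e'f.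
have zfP : zero_free P by apply: dom0_zero_free; apply/(dom_ratio _ _ zf).
exists g^-1.
  by rewrite invrM ?unitrV ?zero_free_unit// invrK; exact: E0_ratio.
have uf := dom0_unit df; have ug := dom0_unit dg.
have -> : f^-1 - g^-1 = f^-1 * (- (f - g) * g^-1).
  by rewrite opprB mulrBl divrr// mulrBr mulr1 mulrA mulVr// mul1r.
have gf : abs (fcoef g 0) = abs (fcoef f 0).
  have -> : fcoef g 0 = fcoef f 0 - fcoef (f - g) 0 by rewrite fcoefB opprB addrC subrK.
  by rewrite (absB_dom na)// (le_lt_trans (fPQ 0%N)).
apply: bndW (bndM na (dom0_bndV na df) (bndM na (bndN na fPQ) (dom0_bndV na dg))).
rewrite gf mulrC -mulrA -invfM -expr2 ler_pdivrMr ?exprn_gt0//.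
by rewrite ge_min lexx orbT.
Qed.

Lemma E0_divide f x : E0 f -> abs x < 1 -> ev f x = 0 ->
  exists2 g, E0 g & f = ('X - x%:P)%:S * g.
Proof.
move=> Hf x1 fx; have [C fC] := E0_bnd Hf.
have [g gC fE] := ev_divide na complete fC x1.
rewrite fx rmorph0 add0r in fE; exists g => //; apply/E0P => e e0.
have [P [Q [zf fPQ]]] := (E0P f).1 Hf e e0.
(* Subtracting its value at x makes the approximation divisible by X - x. Since f vanishes at x,
   this value is no larger than the error. *)
pose c := P.[x] / Q.[x]; have : root (P - c *: Q) x.
  by rewrite /root !hornerE divfK ?zf// subrr.
move=> /factor_theorem[P1 P1E]; exists P1, Q; split=> //.
have uQ := zero_free_unit zf; have uX : ('X - x%:P)%:S != 0.
  by apply/eqP => /(congr1 (fun h => fcoef h 1)); rewrite fcoef0 /= coefB coefX coefC /= subr0;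
     apply/eqP; rewrite oner_eq0.
have dE : f - P%:S / Q%:S + fps_const c = ('X - x%:P)%:S * (g - P1%:S / Q%:S).
  have PE : P%:S = ('X - x%:P)%:S * P1%:S + fps_const c * Q%:S.
    by rewrite /fps_const -!rmorphM -rmorphD mul_polyC [_ * P1]mulrC -P1E subrK.
  by rewrite PE mulrDl mulrK// mulrBr -fE; ring.
have cb : bnd (fps_const c) e.
  suff ce : abs c <= e.
    by move=> i; rewrite /= coefC; case: eqP => _; rewrite ?(abs0 na)// ltW.
  rewrite /c -ev_ratio//; have [D PQD] := bnd_ratio P zf.
  by have := ev_le na complete fPQ x1; rewrite (evB na complete fC PQD)// fx sub0r (absN na).
have db : bnd (('X - x%:P)%:S * (g - P1%:S / Q%:S)) e by rewrite -dE; apply: bndD.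
have [D PQD] := bnd_ratio P1 zf.
have gb : bnd (g - P1%:S / Q%:S) (Num.max C D).
  by apply: (bndB na); [apply: bndW gC|apply: bndW PQD]; rewrite le_max lexx ?orbT.
have [h hb hE] := ev_divide na complete db x1.
rewrite (ev_XsubM na gb x1) rmorph0 add0r in hE.
by move/(mulfI uX): hE => ->.
Qed.

(** Each of the n roots z in the disc is split off and contributes |x - z| >= d; what remains has
    dominant index 0, hence constant absolute value on the disc. *)
Lemma ratio_small_root P Q n x d : zero_free Q -> dom (P%:S / Q%:S) n -> abs x < 1 ->
  0 <= d -> (forall z, abs z < 1 -> P.[z] = 0 -> d <= abs (x - z)) ->
  abs (fcoef (P%:S / Q%:S) n) * d ^+ n <= abs (ev (P%:S / Q%:S) x).
Proof.
move=> zf; elim: n P => [|n IH] P dP x1 d0 H.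
  have [[g0 g1 _] bg] := (dP, dP); rewrite expr0 mulr1.
  have gb : bnd (P%:S / Q%:S) (abs (fcoef (P%:S / Q%:S) 0)) by case: dP.
  have ev0 : ev (P%:S / Q%:S) 0 = fcoef (P%:S / Q%:S) 0.
    rewrite ev_ratio ?(abs0 na)// !horner_coef0 fcoef0M; congr (_ * _).
    have u := zero_free_unit zf; have Q0 : Q`_0 != 0 by move: u; rewrite fps_unitE.
    by apply: (mulfI Q0); rewrite mulfV// -[Q`_0]/(fcoef Q%:S 0) -fcoef0M divrr// fcoef1.
  have := ev_lipschitz na complete gb x1 (_ : abs 0 < 1).
  rewrite (abs0 na) ltr01 => /(_ isT); rewrite ev0 subr0 => le.
  have {le} lt : abs (ev (P%:S / Q%:S) x - fcoef (P%:S / Q%:S) 0) < abs (fcoef (P%:S / Q%:S) 0).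
    by apply: le_lt_trans le _; rewrite -[ltRHS]mulr1 ltr_pM2l// (abs_gt0 na).
  rewrite -[ev _ _](subrK (fcoef (P%:S / Q%:S) 0)) addrC (absD_dom na)//.
have P0 : P != 0.
  by apply/eqP => P0; case: dP; rewrite P0 rmorph0 mul0r fcoef0 eqxx.
have [r Pr] := closed_field_poly_normal P.
have lP : lead_coef P != 0 by rewrite lead_coef_eq0.
have := dom_roots r lP; rewrite -Pr => /(dom_uniq ((dom_ratio _ _ zf).2 dP)) cE.
have : has (fun z => abs z < 1) r by rewrite has_count -cE.
move=> /hasP[z zr z1]; have Pz : root P z.
  by rewrite Pr rootZ// root_prod_XsubC.
have [P1 P1E] := factor_theorem _ _ Pz.
have gE : P%:S / Q%:S = ('X - z%:P)%:S * (P1%:S / Q%:S).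
  by rewrite P1E [P1 * _]mulrC rmorphM mulrA.
have P10 : P1 != 0 by apply: contraNneq P0 => e; rewrite P1E e mul0r.
have [k dk] := dom_poly na P10; move/(dom_ratio _ _ zf): dk => dk.
have dX := dom_Xsub z; rewrite z1 in dX.
have := domM na dX dk; rewrite -gE => /(dom_uniq dP); rewrite add1n => -[nk].
rewrite -{}nk in dk.
have := domM_abs na dX dk; rewrite -gE add1n => ->.
have -> : abs (fcoef ('X - z%:P)%:S 1) = 1.
  by rewrite /= coefB coefX coefC subr0 (abs1 na).
have [D gD] := bnd_ratio P1 zf; have [D' XD] := bnd_poly ('X - z%:P).
rewrite mul1r gE (evM na complete XD gD)// (ev_poly na) !hornerE (absM na) exprS mulrCA.
apply: ler_pM => //.
  by rewrite mulr_ge0 ?exprn_ge0 ?(abs_ge0 na).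
  by apply: H => //; apply/rootP.
by apply: IH => // y y1 Py; apply: H => //; rewrite P1E hornerM Py mul0r.
Qed.

Lemma ratio_near_root P Q n x d : zero_free Q -> dom (P%:S / Q%:S) n.+1 -> abs x < 1 ->
  0 < d -> abs (ev (P%:S / Q%:S) x) < abs (fcoef (P%:S / Q%:S) n.+1) * d ^+ n.+1 ->
  exists z, [/\ abs z < 1, P.[z] = 0 & abs (x - z) < d].
Proof.
move=> zf dP x1 d0 lt; apply: contrapT => /forallNP H.
move: lt; rewrite ltNge => /negP; apply; apply: ratio_small_root => //; first exact: ltW.
move=> z z1 Pz; rewrite leNgt; apply/negP => xz; exact: (H z).
Qed.

(** A root of one rational approximation nearly annihilates the next one, which by [ratio_near_root]
    has a root close to it. The roots chosen in this way form a Cauchy sequence, whose limit is a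
    zero of f. *)
Lemma E0_root f n : E0 f -> dom f n.+1 -> exists2 x, abs x < 1 & ev f x = 0.
Proof.
move=> Hf df; have [f0 f1 _] := df; set M := abs (fcoef f n.+1).
have M0 : 0 < M by rewrite (abs_gt0 na).
have fM : bnd f M by [].
pose d k : R := 2^-1 ^+ k.+1; have d0 k : 0 < d k by rewrite exprn_gt0.
have d1 k : d k < 1 by rewrite exprn_ilt1// invf_lt1// ltr1n.
have dS k : d k.+1 <= d k by rewrite /d ler_wiXn2l// invf_le1// ler1n.
(* A value below M d_k^(n+1) forces a root within d_k; the division by 2 turns the non-strict error
   bound into a strict one. *)
pose e k := M * d k ^+ n.+1 / 2.
have e0 k : 0 < e k by rewrite /e divr_gt0// mulr_gt0// exprn_gt0.
have eS k : e k.+1 <= e k.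
  by rewrite /e ler_wpM2r ?invr_ge0// ler_wpM2l ?(ltW M0)// lerXn2r ?nnegrE ?(ltW (d0 _)).
have elt k : e k < M * d k ^+ n.+1.
  by rewrite /e ltr_pdivrMr// ltr_pMr ?mulr_gt0 ?exprn_gt0// ltr1n.
have eM k : e k < M.
  by apply: lt_le_trans (elt k) _; rewrite ger_pMr// exprn_ile1 ?ltW.
have /choice[PQ PQP] : forall k, exists PQ : {poly K} * {poly K},
    zero_free PQ.2 /\ bnd (f - PQ.1%:S / PQ.2%:S) (e k).
  by move=> k; have [P [Q H]] := (E0P f).1 Hf (e k) (e0 k); exists (P, Q).
pose g k := (PQ k).1%:S / (PQ k).2%:S.
have gb k : exists C, bnd (g k) C by apply: bnd_ratio; case: (PQP k).
have dg k : dom (g k) n.+1.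
  by apply: (dom_near na df) => i; apply: le_lt_trans (eM k); case: (PQP k).
have gM k : abs (fcoef (g k) n.+1) = M.
  have -> : fcoef (g k) n.+1 = fcoef f n.+1 - fcoef (f - g k) n.+1.
    by rewrite fcoefB opprB addrC subrK.
  by rewrite (absB_dom na)//; apply: le_lt_trans (eM k); case: (PQP k).
pose good k x := abs x < 1 /\ (PQ k).1.[x] = 0.
have gv k x : good k x -> ev (g k) x = 0.
  by move=> [x1 Px]; rewrite ev_ratio//; [rewrite Px mul0r|case: (PQP k)].
have fgv k x : abs x < 1 -> abs (ev f x - ev (g k) x) <= e k.
  move=> x1; have [C gC] := gb k; rewrite -(evB na complete fM gC)//.
  by apply: (ev_le na complete) => //; case: (PQP k).
have step k x : good k x -> exists z, good k.+1 z /\ abs (x - z) < d k.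
  move=> gx; have [x1 Px] := gx.
  have [||//|||z [z1 Pz xz]] := @ratio_near_root (PQ k.+1).1 (PQ k.+1).2 n x (d k).
    by case: (PQP k.+1).
    exact: dg.
    exact: d0.
    rewrite -/(g k.+1) gM; apply: le_lt_trans (elt k).
    have := absB_le na (le_trans (fgv k.+1 x x1) (eS k)) (fgv k x x1).
    by rewrite (gv k x gx) subr0 addrC addKr (absN na).
  by exists z.
have [x00 gx00] : exists x, good 0 x.
  (* The first root only has to exist, so the radius may exceed 1; it is chosen so large that the
     value at 0 satisfies the required bound. *)
  have [||//|||z [z1 Pz _]] := @ratio_near_root (PQ 0).1 (PQ 0).2 n 0
      (1 + abs (ev (g 0) 0) / M).
    by case: (PQP 0).
    exact: dg.
    by rewrite (abs0 na).
    by rewrite ltr_wpDr// divr_ge0 ?(abs_ge0 na)// ltW.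
    rewrite -/(g 0) gM; set b := abs _.
    have b0 : 0 <= b / M by rewrite divr_ge0 ?(abs_ge0 na)// ltW.
    rewrite exprS; apply: lt_le_trans (_ : M * (1 + b / M) <= _).
      by rewrite mulrDr mulr1 mulrCA divff ?gt_eqF// mulr1 ltrDr.
    by rewrite ler_wpM2l ?(ltW M0)// ler_peMr ?exprn_ege1 ?lerDl// addr_ge0.
  by exists z.
pose x_ := fix x_ k := if k is k'.+1 then xget 0 [set z | good k'.+1 z /\ abs (x_ k' - z) < d k']
  else x00.
have xP k : good k (x_ k).
  elim: k => [|k IH] //=; have [z zP] := step k _ IH.
  by have [] := @xgetI _ 0 [set z | good k.+1 z /\ abs (x_ k - z) < d k] z zP.
have xd k : abs (x_ k - x_ k.+1) < d k.
  have [z zP] := step k _ (xP k).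
  by have [] := @xgetI _ 0 [set z | good k.+1 z /\ abs (x_ k - z) < d k] z zP.
have xdist k j : abs (x_ k - x_ (k + j)%N) < d k.
  elim: j => [|j IH]; first by rewrite addn0 subrr (abs0 na).
  rewrite addnS -[x_ k](subrK (x_ (k + j)%N)) -addrA; apply: (absD_lt na) => //.
  apply: lt_le_trans (xd _) _; rewrite /d ler_wiXn2l ?invf_le1 ?ler1n//.
  by rewrite ltnS leq_addr.
have dsmall eps : 0 < eps -> exists N, forall k, (N <= k)%N -> d k < eps.
  move=> eps0; have [||N HN] := @geometric_small R 1 2^-1 eps _ _ eps0.
    by rewrite invr_ge0.
    by rewrite invf_lt1// ltr1n.
  by exists N => k Nk; rewrite /d; have := HN k.+1 (leqW Nk); rewrite mul1r.
have [l lP] : exists l, abs_cvg abs x_ l.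
  apply: complete => eps /dsmall[N HN]; exists N.
  have key m j : (N <= m)%N -> abs (x_ m - x_ (m + j)%N) < eps.
    by move=> Nm; apply: lt_trans (xdist _ _) (HN _ Nm).
  move=> m j Nm Nj; have [mj|/ltnW jm] := leqP m j.
    by rewrite -(subnKC mj) key.
  by rewrite (abs_subC na) -(subnKC jm) key.
have xl k : abs (x_ k - l) <= d k.
  have : abs_cvg abs (fun j => x_ k - x_ j) (x_ k - l).
    move/(abs_cvgP na): lP => lP; apply/(abs_cvgP na) => eps /lP[N HN]; exists N => j /HN.
    have -> : x_ k - x_ j - (x_ k - l) = l - x_ j by ring.
    by rewrite (abs_subC na).
  apply: (abs_cvg_le na); exists k => j kj.
  by rewrite -(subnKC kj) ltW.
have l1 : abs l < 1.
  rewrite -[l](subrK (x_ 0)) (absD_lt na)//; last by case: (xP 0).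
  by rewrite (abs_subC na) (le_lt_trans (xl 0)).
exists l => //; apply: (abs_small_eq0 na) => eps eps0.
have eps1 : 0 < eps / (M + 1) by rewrite divr_gt0// ltr_wpDl// ltW.
have [N HN] := dsmall _ eps1; have dN := HN N (leqnn N).
rewrite -[ev f l](subrK (ev f (x_ N))).
have [x1 _] := xP N.
have dM : M * d N < eps.
  move: dN; rewrite ltr_pdivlMr ?ltr_wpDl// ?ltW// mulrC; apply: le_lt_trans.
  by rewrite ler_wpM2r ?(ltW (d0 _))// lerDl.
apply: (absD_lt na).
  apply: le_lt_trans (ev_lipschitz na complete fM l1 x1) _.
  by apply: le_lt_trans dM; rewrite ler_wpM2l ?(ltW M0)// (abs_subC na).
have := fgv N _ x1; rewrite (gv N) // subr0 => le; apply: le_lt_trans le _.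
apply: lt_trans (elt N) _; apply: le_lt_trans dM; rewrite ler_wpM2l ?(ltW M0)//.
by rewrite exprS ger_pMr// exprn_ile1 ?ltW.
Qed.

Lemma fps_invariant_comp_pow m w f : m.-primitive_root w -> fps_shift w f = f ->
  forall n, ~~ (m %| n)%N -> fcoef f n = 0.
Proof.
move=> wP wf n mn; have := congr1 (fun h => fcoef h n) wf => /= /eqP.
rewrite -subr_eq0 -{2}[fcoef f n]mulr1 -mulrBr mulf_eq0 subr_eq0.
by rewrite -(prim_order_dvd wP) (negbTE mn) orbF => /eqP.
Qed.

Lemma poly_comp_pow m P : (0 < m)%N -> (forall n, ~~ (m %| n)%N -> P`_n = 0) ->
  exists P', P%:S = fps_comp_pow m P'%:S /\ forall x, P'.[x ^+ m] = P.[x].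
Proof.
move=> m0 P0; pose P' := \poly_(i < size P) P`_(i * m).
have PE : P = P' \Po 'X^m.
  apply/polyP => n; rewrite coef_comp_poly_Xn//; case: ifP => [/dvdnP[k ->]|/negbT/P0//].
  rewrite mulnK// coef_poly; case: ltnP => // szk; rewrite nth_default//.
  by rewrite (leq_trans szk)// leq_pmulr.
exists P'; move: P' PE => P' ->; split=> [|x]; last by rewrite horner_comp !hornerE.
by apply: fpsP => n /=; rewrite coef_comp_poly_Xn.
Qed.

(* A rational approximation of f(x^m) is averaged over the m-th roots of unity. *)
Lemma E0_comp_pow_inv m f : (0 < m)%N -> E0 (fps_comp_pow m f) -> E0 f.
Proof.
move=> m0 /E0P Hf; apply/E0P => e e0; have mK := char0_natr_neq0 K_char0 m0.
have am : 0 < abs m%:R by rewrite (abs_gt0 na).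
have [P [Q [zf fPQ]]] := Hf (e * abs m%:R) (mulr_gt0 e0 am).
have [w wP] := prim_root_exists K_char0 m0.
have w1 : abs w = 1 by apply: (abs_unity na m0); exact: prim_expr_order.
have wk1 k : abs (w ^+ k) = 1 by rewrite (absX na) w1 expr1n.
pose Pk k := P \Po (w ^+ k *: 'X); pose Qk k := Q \Po (w ^+ k *: 'X).
have zfk k : zero_free (Qk k) by exact: zero_free_comp.
have PkS k : fps_shift w (Pk k)%:S = (Pk k.+1)%:S.
  by rewrite -!fps_shift_poly fps_shift_shift exprSr.
have QkS k : fps_shift w (Qk k)%:S = (Qk k.+1)%:S.
  by rewrite -!fps_shift_poly fps_shift_shift exprSr.
pose Dp := \prod_(k < m) Qk k.
have zfD : zero_free Dp.
  by move=> x x1; rewrite horner_prod; apply/prodf_neq0 => k _; exact: zfk.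
have DpS : fps_shift w Dp%:S = Dp%:S.
  rewrite /Dp !rmorph_prod /=; case: (m) m0 wP => // m' _ wP.
  rewrite big_ord_recr big_ord_recl /= mulrC; congr (_ * _).
    by rewrite QkS /Qk (prim_expr_order wP).
  by apply: eq_bigr => k _; rewrite QkS.
pose g := fps_const m%:R^-1 * \sum_(k < m) (Pk k)%:S / (Qk k)%:S.
have gS : fps_shift w g = g.
  rewrite /g rmorphM rmorph_sum /=; congr (_ * _).
    by apply: fpsP => n /=; rewrite coefC; case: n => [|n] /=; rewrite ?mulr1 ?mul0r.
  case: (m) m0 wP => // m' _ wP.
  rewrite big_ord_recr big_ord_recl /= addrC; congr (_ + _).
    by rewrite rmorphM rmorphV ?zero_free_unit//= PkS QkS /Qk /Pk (prim_expr_order wP).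
  by apply: eq_bigr => k _; rewrite rmorphM rmorphV ?zero_free_unit//= PkS QkS.
pose Np := m%:R^-1 *: \sum_(k < m) Pk k * \prod_(j < m | j != k) Qk j.
have NpE : Np%:S = g * Dp%:S.
  rewrite /Np -mul_polyC rmorphM -/(fps_const _) rmorph_sum /g -mulrA; congr (_ * _).
  rewrite mulr_suml; apply: eq_bigr => k _; rewrite rmorphM /Dp [in RHS](bigD1 k)//= rmorphM.
  by rewrite mulrA divrK// zero_free_unit.
have NpS : fps_shift w Np%:S = Np%:S by rewrite NpE fps_shiftM DpS gS.
have [N' [N'E _]] := poly_comp_pow m0 (fps_invariant_comp_pow wP NpS).
have [D' [D'E D'x]] := poly_comp_pow m0 (fps_invariant_comp_pow wP DpS).
have zfD' : zero_free D'.
  move=> y y1; have [x xy] := root_exists y m0; rewrite -xy D'x zfD//.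
  by rewrite -(@expr_lt1 _ m) ?(abs_ge0 na)// -(absX na) xy.
exists N', D'; split=> //; apply/(bnd_comp_pow na _ _ m0).
have -> : fps_comp_pow m (f - N'%:S / D'%:S) = fps_comp_pow m f - g.
  rewrite fps_comp_pow_zmod fps_comp_powM//; congr (_ - _).
  have uD := zero_free_unit zfD.
  apply: (mulIr uD); rewrite -NpE N'E -mulrA [X in _ * X](_ : _ = 1) ?mulr1//.
  by rewrite D'E -fps_comp_powM// mulVr ?zero_free_unit// fps_comp_pow1.
have -> : fps_comp_pow m f - g =
    fps_const m%:R^-1 * \sum_(k < m) fps_shift (w ^+ k) (fps_comp_pow m f - P%:S / Q%:S).
  rewrite /g; under [in RHS]eq_bigr => k _.
    rewrite rmorphB rmorphM rmorphV ?zero_free_unit//= !fps_shift_poly fps_shift_comp_pow//.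
    rewrite exprAC (prim_expr_order wP) expr1n fps_shift1; over.
  rewrite sumrB mulrBr; congr (_ - _).
  rewrite sumr_const card_ord -[X in _ * X]mulr_natl mulrA.
  by rewrite -(rmorph_nat (@fps_const K)) -rmorphM mulVf// rmorph1 mul1r.
apply: bndW (bndCM na _ (bnd_sum na _ _ (fun k _ => bnd_shift na (wk1 _) fPQ))).
  by rewrite (absV na) mulrC mulfK ?gt_eqF.
by rewrite mulr_ge0// ltW.
Qed.

End AnalyticElements.

(** * Values at the generic point *)

Section GrowthRate.
Variable R : realType.
Implicit Types (x : nat -> R) (C r s : R).

Lemma limn_einf_sup_range (u : (\bar R)^nat) : limn_einf u = ereal_sup (range (einfs u)).
Proof.
rewrite limn_einf_lim; apply/cvg_lim => //.
by apply: ereal_nondecreasing_cvgn; exact: nondecreasing_einfs.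
Qed.

Lemma powR_rootK r n : 0 < r -> (0 < n)%N -> (r `^ (- n%:R^-1)) ^+ n = r^-1.
Proof.
move=> r0 n0; rewrite -powR_mulrn ?powR_ge0// -powRrM mulNr mulVf ?pnatr_eq0 -?lt0n//.
by rewrite powR_inv1 ?ltW.
Qed.

(** The lower limit controls all but finitely many terms, and the constant C absorbs the remaining
    ones. Together with [root_inv_upper] this replaces the radius chi by geometric growth
    estimates. *)
Lemma root_inv_lower x r : (forall n, 0 <= x n) -> 0 < r ->
  r < fine (Order.min 1%:E (limn_einf (fun n => root_inv n (x n)))) ->
  exists2 C, 0 < C & forall n, x n * r ^+ n <= C.
Proof.
move=> x0 r0; set L := limn_einf _ => rL.
have {rL} : (r%:E < L)%E.
  move: rL; case: (L) => [l| |]; rewrite ?ltry//.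
    by rewrite -EFin_min /= lt_min lte_fin => /andP[].
  by rewrite minC min_l ?leNye//= ltNge (ltW r0).
rewrite /L limn_einf_sup_range => /ereal_sup_gt[_ [N _ <-] rN].
have H n : (N < n)%N -> x n * r ^+ n <= 1.
  move=> Nn; have : (r%:E < root_inv n (x n))%E.
    by apply: lt_le_trans rN _; apply: ereal_inf_lbound; exists n => //=; exact: ltnW.
  rewrite /root_inv; case: eqP => [->|/eqP xn0]; first by rewrite mul0r.
  have xn : 0 < x n by rewrite lt0r xn0 x0.
  have n0 : (0 < n)%N by apply: leq_ltn_trans Nn.
  rewrite lte_fin => lt; rewrite mulrC -ler_pdivlMr// mul1r -(powR_rootK xn n0).
  by rewrite lerXn2r ?nnegrE ?powR_ge0 ?ltW.
have s0 : 0 <= \sum_(k < N.+1) x k * r ^+ k.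
  by rewrite sumr_ge0// => k _; rewrite mulr_ge0// exprn_ge0 ?ltW.
exists (1 + \sum_(k < N.+1) x k * r ^+ k); first by rewrite ltr_wpDr.
move=> n; case: (ltnP N n) => [/H le|nN]; first by rewrite (le_trans le)// lerDl.
have nN' : (n < N.+1)%N by [].
rewrite (bigD1 (Ordinal nN'))//= addrCA lerDl addr_ge0// sumr_ge0// => k _.
by rewrite mulr_ge0// exprn_ge0 ?ltW.
Qed.

(** For s < r the constant C is eventually below (r / s)^n, so every such s lies below the lower
    limit; then s tends to r. *)
Lemma root_inv_upper x r C : (forall n, 0 <= x n) -> 0 < r -> r <= 1 ->
  (forall n, x n * r ^+ n <= C) ->
  r <= fine (Order.min 1%:E (limn_einf (fun n => root_inv n (x n)))).
Proof.
move=> x0 r0 r1 H; set L := limn_einf _.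
have key s : 0 < s -> s < r -> (s%:E <= L)%E.
  move=> s0 sr; have [|N HN] := @geometric_large R C (r / s); first by rewrite ltr_pdivlMr ?mul1r.
  rewrite /L limn_einf_sup_range.
  apply: le_trans (_ : (einfs (fun n => root_inv n (x n)) N.+1 <= _)%E); last first.
    by apply: ereal_sup_ubound; exists N.+1.
  apply: le_ereal_inf_tmp => _ [n /= Nn <-]; rewrite /root_inv.
  case: eqP => [_|/eqP xn0]; first by rewrite leey.
  have xn : 0 < x n by rewrite lt0r xn0 x0.
  have n0 : (0 < n)%N by apply: leq_ltn_trans Nn.
  rewrite lee_fin -(@ler_pXn2r _ n)// ?nnegrE ?powR_ge0 ?(ltW s0)// powR_rootK//.
  rewrite -[leRHS]mul1r ler_pdivlMr// mulrC.
  have sn : 0 < s ^+ n by rewrite exprn_gt0.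
  have Cn := HN n (ltnW Nn).
  have : x n * r ^+ n <= (r / s) ^+ n by apply: le_trans (H n) (ltW Cn).
  rewrite expr_div_n ler_pdivlMr// mulrAC ger_pMl ?exprn_gt0//.
have rL : (r%:E <= L)%E.
  rewrite leNgt; apply/negP; case E : (L) => [l| |].
    rewrite lte_fin => lr; pose s := Num.max ((l + r) / 2) (r / 2).
    have s0 : 0 < s by rewrite lt_max [0 < r / 2]divr_gt0// orbT.
    have sr : s < r by rewrite gt_max; apply/andP; split; lra.
    have := key s s0 sr; rewrite E lee_fin ge_max => /andP[]; lra.
    by rewrite ltNge leey.
  have r20 : 0 < r / 2 by rewrite divr_gt0.
  by have := key _ r20; rewrite E leeNy_eq => /(_ ltac:(lra)).
have : (r%:E <= Order.min 1%:E L)%E by rewrite le_min lee_fin r1 rL.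
have : (Order.min 1%:E L <= 1%:E)%E by rewrite ge_min lexx.
by case: (Order.min 1%:E L) => [l| |].
Qed.
End GrowthRate.

Section GenericPoint.
Variables (R : realType) (p : nat) (K Omega : closedFieldType).
Variables (abs : K -> R) (absO : Omega -> R).
Variables (iota : {rmorphism K -> Omega}) (t : Omega).
Hypotheses (p_prime : prime p) (K_char0 : [pchar K] =i pred0).
Hypotheses (na : nonarch_abs abs) (complete : abs_complete abs).
Hypothesis abs_p : abs p%:R = p%:R^-1.
Hypothesis Omega_generic : generic_extension abs absO iota t.
Implicit Types (f g h : fps K) (P Q : {poly K}) (u v y : Omega) (C D e : R).
Local Notation "P %:S" := (fps_of_poly P) (at level 2, format "P %:S").
Local Notation bnd := (bnd abs).
Local Notation dom := (dom abs).
Local Notation E0 := (E0 abs).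
Local Notation gv := (E0_generic_value abs absO iota t).
Local Notation ratO P Q := ((map_poly iota P).[t] / (map_poly iota Q).[t]).
Local Notation rat_approxE := (rat_approxE p_prime K_char0 na complete abs_p).
Local Notation zero_free := (zero_free abs).

Let naO : nonarch_abs absO. Proof. exact: gext_nonarch Omega_generic. Qed.

Lemma gauss_norm_dom P n : dom P%:S n -> gauss_norm abs P = abs P`_n.
Proof.
move=> [Pn0 P1 _]; apply/le_anti/andP; split.
  by apply/bigmax_leP; split=> [|i _]; [exact: abs_ge0|exact: P1].
have nP : (n < size P)%N.
  by rewrite ltnNge; apply: contra Pn0 => le; rewrite /= nth_default.
exact: (le_bigmax_cond _ (j := Ordinal nP) (P := xpredT) (fun i : 'I_(size P) => abs P`_i)).
Qed.

(** Both sides compare C with the Gauss norm of P / Q, which is the absolute value of the dominant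
    coefficient on one side and of the value at t on the other. *)
Lemma ratO_le P Q C : zero_free Q -> 0 <= C ->
  bnd (P%:S / Q%:S) C <-> absO (ratO P Q) <= C.
Proof.
move=> zf C0; have dQ := zero_free_dom na zf.
have Q0 : Q != 0 by apply/eqP => Q0; case: dQ; rewrite Q0 rmorph0 fcoef0 eqxx.
rewrite (gext_gauss Omega_generic)//.
have [->|P0] := eqVneq P 0.
  rewrite rmorph0 mul0r /gauss_norm size_poly0 big_ord0 mul0r; split=> // _.
  exact: bnd0.
have [n dP] := dom_poly na P0; rewrite (gauss_norm_dom dP) (gauss_norm_dom dQ).
have dPQ := (dom_ratio na P n zf).1 dP; have dV := dom0V na dQ.
have := domM_abs na dP dV; rewrite addn0.
have -> : fcoef (Q%:S)^-1 0 = (Q`_0)^-1.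
  have [q0 _ _] := dQ; apply: (mulfI q0); rewrite -fcoef0M divrr ?fcoef1 ?mulfV//.
  exact: dom0_unit dQ.
rewrite (absV na) => <-; split=> [H|H i]; first exact: H.
by apply: le_trans H; case: dPQ.
Qed.

(** Evaluation at t is an isometry on rational functions, hence on their limits: if one of the two
    quantities exceeded C, an approximation to within half of it would contradict [ratO_le]. *)
Lemma generic_value_bnd f y C : gv f y -> 0 <= C -> bnd f C <-> absO y <= C.
Proof.
move=> fy C0; split=> [fC|yC i].
  rewrite leNgt; apply/negP => Cy; have y0 : 0 < absO y by apply: le_lt_trans Cy.
  have e0 : 0 < absO y / 2 by rewrite divr_gt0.
  have [[P Q] /= /(rat_approxE _ _ _ e0)[zf H] yPQ] := fy _ e0.
  set M := Num.max C (absO y / 2).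
  have My : M < absO y by rewrite gt_max Cy /=; lra.
  have PQM : bnd (P%:S / Q%:S) M.
    have -> : P%:S / Q%:S = f - (f - P%:S / Q%:S) by rewrite opprB addrC subrK.
    by apply: (bndB na); [apply: bndW fC|apply: bndW H]; rewrite le_max lexx ?orbT.
  have := (ratO_le P zf (le_trans C0 _)).1 PQM; rewrite le_max lexx => /(_ isT) le.
  have : absO y <= M.
    rewrite -[y](subrK (ratO P Q)); apply: (absD_le naO) => //.
    by apply: le_trans yPQ _; rewrite le_max lexx orbT.
  by rewrite leNgt My.
rewrite leNgt; apply/negP => Cy; have y0 : 0 < abs (fcoef f i) by apply: le_lt_trans Cy.
have e0 : 0 < abs (fcoef f i) / 2 by rewrite divr_gt0.
have [[P Q] /= /(rat_approxE _ _ _ e0)[zf H] yPQ] := fy _ e0.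
set M := Num.max C (abs (fcoef f i) / 2).
have My : M < abs (fcoef f i) by rewrite gt_max Cy /=; lra.
have M0 : 0 <= M by rewrite le_max C0.
have PQM : absO (ratO P Q) <= M.
  have -> : ratO P Q = y - (y - ratO P Q) by rewrite opprB addrC subrK.
  by apply: (absB_le naO); [apply: le_trans yC _|apply: le_trans yPQ _]; rewrite le_max lexx ?orbT.
have /(_ i) le := (ratO_le P zf M0).2 PQM.
have : abs (fcoef f i) <= M.
  have -> : fcoef f i = fcoef (f - P%:S / Q%:S) i + fcoef (P%:S / Q%:S) i.
    by rewrite fcoefB subrK.
  by apply: (absD_le na) => //; apply: le_trans (H i) _; rewrite le_max lexx orbT.
by rewrite leNgt My.
Qed.

Lemma generic_value_poly P : gv P%:S (map_poly iota P).[t].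
Proof.
move=> e e0; exists (P, 1) => /=.
  apply/(rat_approxE _ _ _ e0); split; first exact: zero_free1.
  by rewrite rmorph1 divr1 subrr; apply: (bnd0 na); exact: ltW.
by rewrite rmorph1 hornerC divr1 subrr (abs0 naO) ltW.
Qed.

(** By [ratO_le], the values at t of rational approximations with error 2^-k form a Cauchy sequence
    in the complete field [Omega]. *)
Lemma generic_value_exists f : E0 f -> exists y, gv f y.
Proof.
move=> Ef; pose e k : R := 2^-1 ^+ k; have e0 k : 0 < e k by rewrite exprn_gt0.
have eS k j : (k <= j)%N -> e j <= e k.
  by move=> kj; rewrite /e ler_wiXn2l ?invr_ge0 ?invf_le1 ?ler1n.
have /choice[PQ PQP] : forall k, exists PQ : {poly K} * {poly K}, rat_approx abs f PQ.1 PQ.2 (e k).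
  by move=> k; have [P [Q H]] := Ef (e k) (e0 k); exists (P, Q).
have zf k : zero_free (PQ k).2 by have [] := (rat_approxE _ _ _ (e0 k)).1 (PQP k).
have fb k : bnd (f - (PQ k).1%:S / (PQ k).2%:S) (e k).
  by have [] := (rat_approxE _ _ _ (e0 k)).1 (PQP k).
have Q0 k : (map_poly iota (PQ k).2).[t] != 0.
  have Qk : (PQ k).2 != 0.
    by apply/eqP => E; have := zf k 0; rewrite E (abs0 na) horner0 eqxx => /(_ ltr01).
  apply/eqP => E; apply: (gext_transcendental Omega_generic).
  by exists (PQ k).2 => //; apply/rootP.
pose y_ k := ratO (PQ k).1 (PQ k).2.
have yd k j : (k <= j)%N -> absO (y_ k - y_ j) <= e k.
  move=> kj; have zfkj := zero_freeM (zf k) (zf j).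
  have := ratO_le ((PQ k).1 * (PQ j).2 - (PQ j).1 * (PQ k).2) zfkj (ltW (e0 k)).
  rewrite [in ratO _ _]rmorphB !rmorphM !hornerE.
  have -> : ((map_poly iota (PQ k).1).[t] * (map_poly iota (PQ j).2).[t] -
     (map_poly iota (PQ j).1).[t] * (map_poly iota (PQ k).2).[t]) /
    ((map_poly iota (PQ k).2).[t] * (map_poly iota (PQ j).2).[t]) = y_ k - y_ j.
    by rewrite /y_; field; rewrite !Q0.
  move=> H; apply/H; rewrite rmorphB !rmorphM -mulNr ratio_add ?(zero_free_unit na)//.
  have -> : (PQ k).1%:S / (PQ k).2%:S + - (PQ j).1%:S / (PQ j).2%:S =
    (f - (PQ j).1%:S / (PQ j).2%:S) - (f - (PQ k).1%:S / (PQ k).2%:S) by rewrite mulNr; ring.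
  by apply: (bndB na) => //; apply: bndW (fb j); exact: eS.
have esmall eps : 0 < eps -> exists N, e N < eps.
  move=> eps0; have [||N HN] := @geometric_small R 1 2^-1 eps _ _ eps0.
    by rewrite invr_ge0.
    by rewrite invf_lt1// ltr1n.
  by exists N; have := HN N (leqnn N); rewrite mul1r.
have [l lP] : exists l, abs_cvg absO y_ l.
  apply: (gext_complete Omega_generic) => eps /esmall[N HN]; exists N.
  have key m j : (N <= m)%N -> (m <= j)%N -> absO (y_ m - y_ j) < eps.
    by move=> Nm mj; apply: le_lt_trans (yd m j mj) _; apply: le_lt_trans (eS _ _ Nm) HN.
  move=> m j Nm Nj; have [mj|/ltnW jm] := leqP m j; first exact: key.
  by rewrite (abs_subC naO) key.
exists l => eps /esmall[N HN]; exists (PQ N).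
  apply/(rat_approxE _ _ _ (lt_trans (e0 N) HN)); split=> //.
  by apply: bndW (fb N); exact: ltW.
apply: le_trans (ltW HN).
have : abs_cvg absO (fun j => y_ j - y_ N) (l - y_ N).
  move/(abs_cvgP naO): lP => lP; apply/(abs_cvgP naO) => e1 /lP[M HM]; exists M => j /HM.
  by have -> : y_ j - y_ N - (l - y_ N) = y_ j - l by ring.
by apply: (abs_cvg_le naO); exists N => j Nj; rewrite (abs_subC naO) yd.
Qed.

Lemma generic_value_E0 f y : gv f y -> E0 f.
Proof. by move=> fy e /fy[[P Q] /= H _]; exists P, Q. Qed.

Lemma zero_free_horner Q : zero_free Q -> (map_poly iota Q).[t] != 0.
Proof.
move=> zf; have Q0 : Q != 0.
  by apply/eqP => E; have := zf 0; rewrite E (abs0 na) horner0 eqxx => /(_ ltr01).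
apply/eqP => E; apply: (gext_transcendental Omega_generic).
by exists Q => //; apply/rootP.
Qed.

Lemma generic_valueB f g u v : gv f u -> gv g v -> gv (f - g) (u - v).
Proof.
move=> fu gv' e e0; have [[P Q] /= /(rat_approxE _ _ _ e0)[zf H] uPQ] := fu e e0.
have [[P' Q'] /= /(rat_approxE _ _ _ e0)[zf' H'] vPQ] := gv' e e0.
exists (P * Q' + (- P') * Q, Q * Q') => /=.
  apply/(rat_approxE _ _ _ e0); split; first exact: zero_freeM.
  rewrite rmorphD !rmorphM ratio_add ?(zero_free_unit na)//.
  have -> : f - g - (P%:S / Q%:S + (- P')%:S / Q'%:S) =
    (f - P%:S / Q%:S) - (g - P'%:S / Q'%:S) by rewrite rmorphN; ring.
  exact: bndB.
have -> : ratO (P * Q' + - P' * Q) (Q * Q') = ratO P Q - ratO P' Q'.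
  by rewrite rmorphD !rmorphM rmorphN !hornerE /=; field; rewrite !zero_free_horner.
have -> : u - v - (ratO P Q - ratO P' Q') = u - ratO P Q - (v - ratO P' Q') by ring.
exact: absB_le.
Qed.

Lemma generic_valueM f g u v : gv f u -> gv g v -> gv (f * g) (u * v).
Proof.
move=> fu gv' e e0; have [C gC] := E0_bnd p_prime K_char0 na complete abs_p (generic_value_E0 gv').
have C0 := bnd_ge0 na gC; have vC := (generic_value_bnd gv' C0).1 gC.
have C1 : 0 < C + 1 by rewrite ltr_wpDl.
have e1 := divr_gt0 e0 C1.
have [[P Q] /= /(rat_approxE _ _ _ e1)[zf H] uPQ] := fu _ e1.
have [D PQD] := bnd_ratio na P zf; have D0 := bnd_ge0 na PQD.
have D1 : 0 < D + 1 by rewrite ltr_wpDl.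
have e2 := divr_gt0 e0 D1.
have [[P' Q'] /= /(rat_approxE _ _ _ e2)[zf' H'] vPQ] := gv' _ e2.
have b1 : e / (C + 1) * C <= e by rewrite mulrAC -mulrA ger_pMr// ler_pdivrMr// mul1r lerDl.
have b2 : D * (e / (D + 1)) <= e by rewrite mulrA mulrAC ger_pMl// ler_pdivrMr// mul1r lerDl.
exists (P * P', Q * Q') => /=.
  apply/(rat_approxE _ _ _ e0); split; first exact: zero_freeM.
  rewrite !rmorphM invrM ?(zero_free_unit na)//.
  have -> : f * g - P%:S * P'%:S * (Q'%:S^-1 / Q%:S) =
    (f - P%:S / Q%:S) * g + P%:S / Q%:S * (g - P'%:S / Q'%:S) by ring.
  apply: (bndD na); first by apply: bndW (bndM na H gC).
  by apply: bndW (bndM na PQD H').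
have -> : ratO (P * P') (Q * Q') = ratO P Q * ratO P' Q'.
  by rewrite !rmorphM !hornerE /=; field; rewrite !zero_free_horner.
have -> : u * v - ratO P Q * ratO P' Q' =
  (u - ratO P Q) * v + ratO P Q * (v - ratO P' Q') by ring.
apply: (absD_le naO); rewrite (absM naO).
  by apply: le_trans b1; rewrite ler_pM ?(abs_ge0 naO).
by apply: le_trans b2; rewrite ler_pM ?(abs_ge0 naO)//; apply/(ratO_le P zf D0).
Qed.

Lemma generic_value_unique f y y' : gv f y -> gv f y' -> y = y'.
Proof.
move=> fy fy'; have := generic_valueB fy fy'; rewrite subrr => H.
have := (generic_value_bnd H (lexx 0)).1 (bnd0 na (lexx 0)).
move=> le; apply/eqP; rewrite -subr_eq0 -(abs_eq0 naO) eq_le le (abs_ge0 naO)//.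
Qed.

Lemma generic_value_neq0 f y : gv f y -> f != 0 -> y != 0.
Proof.
move=> fy; apply: contraNneq => y0; apply/eqP/(bnd_eq0 na).
by apply/(generic_value_bnd fy (lexx 0)); rewrite y0 (abs0 naO).
Qed.

Lemma generic_evalE f g u v : g != 0 -> gv f u -> gv g v ->
  generic_eval abs absO iota t (f%:L / g%:L) = u / v.
Proof.
move=> g0 fu gv'; apply: xget_unique; first by exists f, g, u, v.
move=> _ [f' [g' [u' [v' [g'0 E f'u g'v ->]]]]].
have fg : f * g' = f' * g.
  apply/eqP; rewrite -tofrac_eq !tofracM; move/eqP: E; rewrite eqr_div ?tofrac_eq0//.
have vn := generic_value_neq0 gv' g0; have v'n := generic_value_neq0 g'v g'0.
apply/eqP; rewrite eqr_div//; apply/eqP.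
have H := generic_valueM fu g'v; rewrite fg in H.
exact: generic_value_unique (generic_valueM f'u gv') H.
Qed.

Lemma abs_t : absO t = 1.
Proof.
have := gext_gauss Omega_generic 'X (oner_neq0 _).
rewrite map_polyX hornerX rmorph1 hornerC divr1 => ->.
rewrite (gauss_norm_dom (_ : dom 'X%:S 1)); last first.
  have := dom_Xsub na 0; rewrite (abs0 na) ltr01 subr0; exact.
rewrite (gauss_norm_dom (_ : dom 1%:S 0)); last exact/zero_free_dom/zero_free1.
by rewrite coefX coef1 (abs1 na) divr1.
Qed.

(** The denominator x^n does not affect the absolute value because |t| = 1. Taking c = [n]_q^! shows
    that chi only depends on the Gauss norms of the numerators. *)
Lemma generic_eval_bnd f n (c : K) C : E0 f -> c != 0 -> 0 <= C ->
  absO (generic_eval abs absO iota t ((fps_const c * f)%:L / ('X^n)%:S%:L) / iota c) <= C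
  <-> bnd f C.
Proof.
move=> Ef c0 C0; have [u fu] := generic_value_exists Ef.
have X0 : ('X^n : {poly K})%:S != 0.
  by apply/eqP => /(congr1 (fun h => fcoef h n)); rewrite fcoef0 /= coefXn eqxx; apply/eqP/oner_neq0.
have cfu := generic_valueM (generic_value_poly c%:P) fu.
rewrite (generic_evalE X0 cfu (generic_value_poly 'X^n)).
rewrite map_polyC hornerC map_polyXn hornerXn (generic_value_bnd fu C0).
have ic : iota c != 0 by rewrite fmorph_eq0.
have t0 : t != 0 by rewrite -(abs_gt0 naO) abs_t.
have -> : iota c * u / t ^+ n / iota c = u / t ^+ n by field; rewrite ic expf_neq0.
by rewrite (absM naO) (absV naO) (absX naO) abs_t expr1n divr1.
Qed.

Section Chi.
Variables (mu : nat) (q : K) (A : 'M[laurent K]_mu) (G : nat -> 'M[fps K]_mu).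
Hypothesis qfact0 : forall n, qfact q n != 0.
Hypothesis GE0 : forall n i j, E0 (G n i j).
Hypothesis GE : forall n i j,
  Gseq q A n i j = (fps_const (qfact q n) * G n i j)%:L / ('X^n)%:S%:L.

Let x n := mx_abs absO
  (map_mx (fun a => generic_eval abs absO iota t a / iota (qfact q n)) (Gseq q A n)).

Let x_le n C : 0 <= C -> x n <= C <-> forall i j, bnd (G n i j) C.
Proof.
move=> C0; split=> [/bigmax_leP[_ H] i j|H].
  by apply/(generic_eval_bnd n (GE0 n i j) (qfact0 n) C0); have := H (i, j) isT; rewrite /= mxE GE.
apply/bigmax_leP; split=> // -[i j] _ /=; rewrite mxE GE.
exact/(generic_eval_bnd n (GE0 n i j) (qfact0 n) C0).
Qed.

Let x_ge0 n : 0 <= x n.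
Proof. exact: bigmax_ge_id. Qed.

Lemma chi_lower r : 0 < r -> r < chi abs absO iota t A q ->
  exists2 C, 0 < C & forall n i j, bnd (G n i j) (C / r ^+ n).
Proof.
move=> r0 /(root_inv_lower x_ge0 r0)[C C0 H]; exists C => // n.
apply/x_le; first by rewrite divr_ge0 ?exprn_ge0 ?ltW.
by rewrite ler_pdivlMr ?exprn_gt0.
Qed.

Lemma chi_upper r C : 0 < r -> r <= 1 ->
  (forall n i j, bnd (G n i j) (C / r ^+ n)) -> (0 < mu)%N -> r <= chi abs absO iota t A q.
Proof.
move=> r0 r1 H mu0; apply: (root_inv_upper x_ge0 r0 r1 (C := C)) => n.
rewrite -ler_pdivlMr ?exprn_gt0//; apply/x_le => [|i j]; last exact: H.
exact: bnd_ge0 (H n (Ordinal mu0) (Ordinal mu0)).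
Qed.

Lemma chi_le1 : chi abs absO iota t A q <= 1.
Proof.
rewrite /chi; set L := limn_einf _; have : (Order.min 1%:E L <= 1%:E)%E by rewrite ge_min lexx.
by case: (Order.min 1%:E L) => [l| |].
Qed.
End Chi.
End GenericPoint.

(** * Newton interpolation at powers of q *)

Section QNewton.
Variables (K : fieldType) (q : K).
Hypothesis q_neq0 : q != 0.
Hypothesis q_not_root1 : forall n, (0 < n)%N -> q ^+ n != 1.
Implicit Types (P : {poly K}) (u : K).

Definition qpoch (q : K) n : {poly K} := \prod_(i < n) ('X - (q ^+ i)%:P).
(** This is the value of [qpoch q n] at q^n, so that [qbin q n] takes the value 1 there. *)
Definition qconst (q : K) n : K := \prod_(i < n) (q ^+ i * (q ^+ i.+1 - 1)).
(* The polynomials with [qbin q n].[q ^ k] = q-binomial (k, n), dual to [qpoch q n]. *)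
Definition qbin (q : K) n : {poly K} := (qconst q n)^-1 *: qpoch q n.
(* The coefficient of [qpoch q n] in the Newton expansion of P at 1, q, q^2, ... *)
Definition ncoef (q : K) n P : K := \sum_(k < n.+1) (qbin q n)`_k * P.[q ^+ k].

Lemma qconst_neq0 n : qconst q n != 0.
Proof.
by apply/prodf_neq0 => i _; rewrite mulf_neq0 ?expf_neq0// subr_eq0 q_not_root1.
Qed.

Lemma qpoch0 : qpoch q 0 = 1. Proof. exact: big_ord0. Qed.
Lemma qbin0 : qbin q 0 = 1. Proof. by rewrite /qbin qpoch0 /qconst big_ord0 invr1 scale1r. Qed.
Lemma qpochS n : qpoch q n.+1 = qpoch q n * ('X - (q ^+ n)%:P).
Proof. exact: big_ord_recr. Qed.
Lemma qconstS n : qconst q n.+1 = qconst q n * (q ^+ n * (q ^+ n.+1 - 1)).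
Proof. exact: big_ord_recr. Qed.

Lemma size_qpoch n : size (qpoch q n) = n.+1.
Proof. by rewrite /qpoch size_prod_XsubC -[X in _ = X]/(n.+1) /index_enum -enumT size_enum_ord. Qed.

Lemma size_qbin n : size (qbin q n) = n.+1.
Proof. by rewrite size_scale ?invr_eq0 ?qconst_neq0// size_qpoch. Qed.

Lemma qpochE n : qpoch q n = qconst q n *: qbin q n.
Proof. by rewrite scalerA mulfV ?qconst_neq0// scale1r. Qed.

Lemma qbin_mulX n : 'X * qbin q n =
  q ^+ n *: qbin q n + (q ^+ n * (q ^+ n.+1 - 1)) *: qbin q n.+1.
Proof.
have c : q ^+ n * (q ^+ n.+1 - 1) != 0.
  by rewrite mulf_neq0 ?expf_neq0// subr_eq0 q_not_root1.
have -> : (q ^+ n * (q ^+ n.+1 - 1)) *: qbin q n.+1 = (qconst q n)^-1 *: qpoch q n.+1.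
  by rewrite /qbin scalerA qconstS; move: (q ^+ n * _) c => c c0; rewrite invfM mulrCA mulfV// mulr1.
by rewrite /qbin qpochS -!mul_polyC; ring.
Qed.

(** The scaling moves the roots 1, ..., q^n to q^-1, ..., q^(n-1): only the factor q X - 1 is new,
    and it is rewritten in terms of X - q^n. *)
Lemma qpoch_scale n : qpoch q n.+1 \Po (q *: 'X) =
  q ^+ n.+1 *: qpoch q n.+1 + (q ^+ n * (q ^+ n.+1 - 1)) *: qpoch q n.
Proof.
have -> : qpoch q n.+1 \Po (q *: 'X) = (q *: 'X - 1) * (q ^+ n *: qpoch q n).
  elim: n => [|n IH].
    by rewrite qpochS !qpoch0 mul1r comp_polyB comp_polyX comp_polyC expr0 scale1r mulr1.
  rewrite qpochS comp_polyM IH comp_polyB comp_polyX comp_polyC [in RHS]qpochS.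
  rewrite -!mul_polyC !exprS !rmorphM; ring.
rewrite qpochS -!mul_polyC !exprS !rmorphM rmorphB rmorph1 !rmorphM; ring.
Qed.

Lemma qbin_scale n : qbin q n.+1 \Po (q *: 'X) = q ^+ n.+1 *: qbin q n.+1 + qbin q n.
Proof.
have c : q ^+ n * (q ^+ n.+1 - 1) != 0.
  by rewrite mulf_neq0 ?expf_neq0// subr_eq0 q_not_root1.
rewrite /qbin comp_polyZ qpoch_scale scalerDr !scalerA qconstS; congr (_ *: _ + _ *: _).
  by rewrite mulrC.
by rewrite invfM -mulrA mulVf// mulr1.
Qed.

Lemma coef_comp_scale P (c : K) k : (P \Po (c *: 'X))`_k = P`_k * c ^+ k.
Proof. by have := congr1 (fun h => fcoef h k) (fps_shift_poly c P). Qed.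

Lemma qpoch_root n k : (k < n)%N -> (qpoch q n).[q ^+ k] = 0.
Proof.
move=> kn; apply/eqP; rewrite horner_prod; apply/prodf_eq0; exists (Ordinal kn) => //=.
by rewrite !hornerE subrr.
Qed.

(** The infinite sum of the terms qpoch_j(u) qbin_j(X) formally represents X^(log_q u), so passing
    from u to q u multiplies it by X; truncation leaves the last term as a correction, which
    vanishes when u is a smaller power of q. *)
Lemma qnewton_sumS u J :
  \sum_(j < J.+1) (qpoch q j).[q * u] *: qbin q j =
  'X * (\sum_(j < J) (qpoch q j).[u] *: qbin q j) + (q ^+ J * (qpoch q J).[u]) *: qbin q J.
Proof.
elim: J => [|J IH]; first by rewrite big_ord1 big_ord0 qpoch0 !hornerC mulr0 add0r expr0 mul1r.
rewrite big_ord_recr IH [in RHS]big_ord_recr /= mulrDr -scalerAr qbin_mulX.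
have := congr1 (fun P => P.[u]) (qpoch_scale J); rewrite horner_comp !hornerE => ->.
by rewrite -!mul_polyC !rmorphD !rmorphM; ring.
Qed.

Lemma expX_newton k J : (k < J)%N -> 'X^k = \sum_(j < J) (qpoch q j).[q ^+ k] *: qbin q j.
Proof.
elim: k J => [|k IH] [//|J] kJ.
  rewrite big_ord_recl qpoch0 hornerC qbin0 scale1r big1 ?addr0// => i _.
  by rewrite qpoch_root// scale0r.
by rewrite [q ^+ _]exprS qnewton_sumS -IH// qpoch_root// mulr0 scale0r addr0 -exprS.
Qed.

Lemma ncoefD n P Q : ncoef q n (P + Q) = ncoef q n P + ncoef q n Q.
Proof. by rewrite -big_split; apply: eq_bigr => k _; rewrite hornerD mulrDr. Qed.
Lemma ncoefZ n c P : ncoef q n (c *: P) = c * ncoef q n P.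
Proof. by rewrite mulr_sumr; apply: eq_bigr => k _; rewrite hornerZ mulrCA. Qed.
Lemma ncoef_sum n I (r : seq I) (F : I -> {poly K}) :
  ncoef q n (\sum_(i <- r) F i) = \sum_(i <- r) ncoef q n (F i).
Proof.
elim/big_rec2: _ => [|i y1 y2 _ <-]; last exact: ncoefD.
by rewrite /ncoef big1// => k _; rewrite horner0 mulr0.
Qed.

Lemma ncoef0 P : ncoef q 0 P = P.[1].
Proof. by rewrite /ncoef big_ord1 qbin0 coefC mul1r. Qed.

Lemma ncoef_wide n J P : (n < J)%N -> ncoef q n P = \sum_(k < J) (qbin q n)`_k * P.[q ^+ k].
Proof.
move=> nJ; rewrite -!(big_mkord xpredT (fun k => (qbin q n)`_k * P.[q ^+ k])).
rewrite [RHS](big_cat_nat (n := n.+1))//= [X in _ + X]big_nat [X in _ + X]big1 => [|k /andP[nk _]].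
  by rewrite addr0 big_mkord.
by rewrite nth_default ?mul0r// size_qbin.
Qed.

Lemma ncoefX n P : ncoef q n.+1 ('X * P) = q ^+ n.+1 * ncoef q n.+1 P + ncoef q n P.
Proof.
rewrite (@ncoef_wide n n.+2)// /ncoef mulr_sumr -big_split; apply: eq_bigr => k _ /=.
have := coef_comp_scale (qbin q n.+1) q k; rewrite qbin_scale coefD coefZ => e.
by rewrite hornerM hornerX mulrA -e; ring.
Qed.

Lemma ncoef_Xsub n w P :
  ncoef q n.+1 (('X - w%:P) * P) = (q ^+ n.+1 - w) * ncoef q n.+1 P + ncoef q n P.
Proof.
rewrite mulrBl mul_polyC -scaleNr ncoefD ncoefZ ncoefX; ring.
Qed.

Lemma ncoef1 n : ncoef q n 1 = (n == 0)%:R.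
Proof.
rewrite /ncoef; under eq_bigr do rewrite hornerC mulr1.
have : (qbin q n).[1] = \sum_(k < n.+1) (qbin q n)`_k.
  by rewrite horner_coef size_qbin; apply: eq_bigr => k _; rewrite expr1n mulr1.
move=> <-; case: n => [|n]; first by rewrite qbin0 hornerC.
by rewrite hornerZ -[1](expr0 q) qpoch_root// mulr0.
Qed.

Lemma ncoef_qpoch n i : ncoef q n (qpoch q i) = (n == i)%:R.
Proof.
elim: i n => [|i IH] n; first by rewrite qpoch0 ncoef1.
case: n => [|n]; first by rewrite ncoef0 -[1](expr0 q) qpoch_root.
rewrite qpochS mulrC ncoef_Xsub !IH eqSS; case: eqP => [<-|_]; first by rewrite subrr mul0r add0r.
by rewrite mulr0 add0r.
Qed.

Lemma ncoefXn n a : ncoef q n 'X^a = (qbin q n).[q ^+ a].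
Proof.
rewrite horner_coef size_qbin; apply: eq_bigr => k _.
by rewrite hornerXn -!exprM mulnC.
Qed.

(** By linearity P = X^a, where the symmetry qpoch_j(q^a) qbin_j = qbin_j(q^a) qpoch_j turns
    [expX_newton] into the claim. *)
Lemma newton_expand P N : (size P <= N)%N -> P = \sum_(n < N) ncoef q n P *: qpoch q n.
Proof.
move=> sP; have XE a : (a < N)%N -> 'X^a = \sum_(n < N) ncoef q n 'X^a *: qpoch q n.
  move=> aN; rewrite {1}(expX_newton aN); apply: eq_bigr => j _.
  by rewrite ncoefXn qpochE hornerZ scalerA mulrC.
rewrite -[LHS]coefK poly_def (big_ord_widen N (fun i => P`_i *: 'X^i)) // big_mkcond /=.
transitivity (\sum_(a < N) P`_a *: 'X^a).
  by apply: eq_bigr => a _; case: ltnP => // le; rewrite nth_default// scale0r.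
transitivity (\sum_(a < N) \sum_(n < N) (P`_a * ncoef q n 'X^a) *: qpoch q n).
  by apply: eq_bigr => a _; rewrite {1}XE// scaler_sumr; apply: eq_bigr => n _; rewrite scalerA.
rewrite exchange_big; apply: eq_bigr => n _; rewrite -scaler_suml; congr (_ *: _).
rewrite -[in RHS](coefK P) poly_def ncoef_sum (big_ord_widen N (fun i => ncoef q n (P`_i *: 'X^i))) //.
rewrite [RHS]big_mkcond /=; apply: eq_bigr => a _; rewrite ncoefZ.
by case: ltnP => // le; rewrite nth_default// mul0r.
Qed.
End QNewton.

(** * Comparison of the Newton bases of ratios q and q^m *)

Section QNewtonPower.
Variables (K : fieldType) (q : K) (m : nat).
Hypothesis q_neq0 : q != 0.
Hypothesis q_not_root1 : forall n, (0 < n)%N -> q ^+ n != 1.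
Hypothesis m_gt0 : (0 < m)%N.
Local Notation Q := (q ^+ m).
Implicit Types P : {poly K}.

Lemma qpow_neq0 : Q != 0. Proof. by rewrite expf_neq0. Qed.
Lemma qpow_not_root1 n : (0 < n)%N -> Q ^+ n != 1.
Proof. by move=> n0; rewrite -exprM q_not_root1// muln_gt0 m_gt0. Qed.

(* Both sides expand z^(log_q u) = (z^(log_Q (u^m))), in the Newton bases with ratios q and Q. *)
Lemma qbin_pow i n J : (n < J)%N -> qbin q n \Po (q ^+ i *: 'X) =
  \sum_(j < J) ncoef q n ('X^i * (qpoch Q j \Po 'X^m)) *: qbin Q j.
Proof.
move=> nJ; transitivity (\sum_(k < n.+1) ((qbin q n)`_k * (q ^+ i) ^+ k) *: 'X^k).
  apply/polyP => k; rewrite coef_comp_scale coef_sum.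
  under eq_bigr do rewrite coefZ coefXn.
  case: (ltnP k n.+1) => kn.
    rewrite (bigD1 (Ordinal kn))//= eqxx mulr1 big1 ?addr0// => a.
    by rewrite -val_eqE/= eq_sym => /negbTE->; rewrite mulr0.
  rewrite nth_default ?size_qbin// mul0r big1// => a _.
  by rewrite gtn_eqF ?mulr0// (leq_trans (ltn_ord a)).
transitivity (\sum_(k < n.+1) \sum_(j < J) (((qbin q n)`_k * (q ^+ i) ^+ k) * (qpoch Q j).[Q ^+ k]) *: qbin Q j).
  apply: eq_bigr => k _; rewrite {1}(@expX_newton K Q qpow_neq0 qpow_not_root1 k J); last first.
    by apply: leq_ltn_trans nJ; rewrite -ltnS.
  by rewrite scaler_sumr; apply: eq_bigr => j _; rewrite scalerA.
rewrite exchange_big; apply: eq_bigr => j _; rewrite -scaler_suml; congr (_ *: _).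
apply: eq_bigr => k _; rewrite hornerM hornerXn horner_comp hornerXn -mulrA; congr (_ * (_ * _.[_])).
  by rewrite -!exprM mulnC.
by rewrite -!exprM mulnC.
Qed.

Variable w : K.
Hypothesis wP : m.-primitive_root w.

(** The nodes come in blocks of length m, the block of index j consisting of all m-th roots of Q^j.
    A product over complete blocks is therefore a polynomial in X^m. *)
Definition node k : K := w ^+ k * q ^+ (k %/ m).
Definition node_poly n : {poly K} := \prod_(k < n) ('X - (node k)%:P).

Lemma prod_unity_roots (a : K) : a != 0 ->
  \prod_(r < m) ('X - (w ^+ r * a)%:P) = 'X^m - (a ^+ m)%:P.
Proof.
move=> a0; have := factor_Xn_sub_1 wP; rewrite big_mkord => H.
have := congr1 (fun P => (a ^+ m) *: (P \Po (a^-1 *: 'X))) H.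
rewrite comp_polyB rmorphXn /= comp_polyX comp_polyC exprZn scalerBr scalerA.
rewrite -exprMn mulfV// expr1n scale1r -[RHS]/(_ - _) -[_ *: 1%:P]mul_polyC mulr1 => <-.
rewrite rmorph_prod /= -[in a ^+ m](card_ord m) -prodr_const -scaler_prod.
apply: eq_bigr => r _; rewrite comp_polyB comp_polyX comp_polyC scalerBr scalerA mulfV// scale1r.
by rewrite -mul_polyC -rmorphM mulrC.
Qed.

Lemma node_poly_mul j : node_poly (j * m) = qpoch Q j \Po 'X^m.
Proof.
elim: j => [|j IH]; first by rewrite /node_poly big_ord0 qpoch0 comp_polyC.
rewrite qpochS comp_polyM -IH comp_polyB comp_polyX comp_polyC exprAC.
rewrite -(@prod_unity_roots (q ^+ j)) ?expf_neq0// /node_poly mulSn addnC.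
rewrite big_split_ord /=; congr (_ * _); apply: eq_bigr => r _; rewrite /node.
rewrite exprD mulnC exprM (prim_expr_order wP) expr1n mul1r mulnC.
by rewrite divnMDl// divn_small// addn0.
Qed.

Lemma node_poly_add j r : (r <= m)%N ->
  node_poly (j * m + r) = (qpoch Q j \Po 'X^m) * \prod_(s < r) ('X - (w ^+ s * q ^+ j)%:P).
Proof.
move=> rm; rewrite -node_poly_mul /node_poly big_split_ord /=; congr (_ * _).
apply: eq_bigr => s _; rewrite /node exprD mulnC exprM (prim_expr_order wP) expr1n mul1r mulnC.
by rewrite divnMDl// divn_small ?addn0// (leq_trans (ltn_ord s)).
Qed.

Definition avg (P : {poly K}) (x : K) : K := m%:R^-1 * \sum_(a < m) P.[w ^+ a * x].
(** This is the Newton coefficient of ratio Q and index j of the average of P over the m-th roots of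
    unity, regarded as a function of x^m: its value at Q^k is [avg P (q ^+ k)]. *)
Definition lamj j (P : {poly K}) : K := \sum_(k < j.+1) (qbin Q j)`_k * avg P (q ^+ k).

Lemma m_neq0 : m%:R != 0 :> K.
Proof. exact: prim_root_natf_neq0 wP. Qed.

Lemma avg_low P x : (size P <= m)%N -> avg P x = P`_0.
Proof.
move=> sP; rewrite /avg; under eq_bigr do rewrite (horner_coef_wide _ sP).
rewrite exchange_big /= (bigD1 (Ordinal m_gt0))//= [X in _ + X]big1 => [|i i0].
  rewrite addr0; under eq_bigr do rewrite expr0 mulr1.
  by rewrite sumr_const card_ord -[X in _ * X]mulr_natl mulKf ?m_neq0.
under eq_bigr do rewrite exprMn -exprM mulnC exprM mulrCA mulrC.
rewrite -mulr_sumr (sum_prim_root_exp _ wP) ifF ?mulr0//.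
by apply/negbTE; rewrite gtnNdvd//; move: i0; rewrite -val_eqE /= lt0n.
Qed.

Lemma avg_compM P P' x : avg ((P \Po 'X^m) * P') x = P.[x ^+ m] * avg P' x.
Proof.
rewrite /avg mulrCA; congr (_ * _); rewrite mulr_sumr; apply: eq_bigr => a _.
rewrite hornerM horner_comp hornerXn exprMn -exprM mulnC exprM (prim_expr_order wP).
by rewrite expr1n mul1r.
Qed.

Lemma avg_Xn i x : avg 'X^i x = if (m %| i)%N then x ^+ i else 0.
Proof.
rewrite /avg; under eq_bigr do rewrite hornerXn exprMn -exprM mulnC exprM.
rewrite -mulr_suml (sum_prim_root_exp _ wP); case: ifP => _; last by rewrite mul0r mulr0.
by rewrite mulKf ?m_neq0.
Qed.

Lemma lamj_linear j c P P' : lamj j (c *: P + P') = c * lamj j P + lamj j P'.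
Proof.
rewrite mulr_sumr -big_split; apply: eq_bigr => k _ /=.
have -> : avg (c *: P + P') (q ^+ k) = c * avg P (q ^+ k) + avg P' (q ^+ k).
  rewrite /avg mulrCA -mulrDr; congr (_ * _).
  by rewrite mulr_sumr -big_split; apply: eq_bigr => a _; rewrite !hornerE.
ring.
Qed.

(** The complete blocks form qpoch_i(X^m) with i = n / m and pass through the average; the
    incomplete one has degree below m, so that averaging leaves its constant term. Only the Newton
    coefficient of index i survives. *)
Lemma lamj_node_poly j n : lamj j (node_poly n) =
  if (n %/ m == j)%N then (\prod_(s < n %% m) ('X - (w ^+ s * q ^+ (n %/ m))%:P))`_0 else 0.
Proof.
rewrite {1}(divn_eq n m) node_poly_add ?(ltnW (ltn_pmod _ _))//.
set g := \prod_(s < _) _; transitivity (g`_0 * ncoef Q j (qpoch Q (n %/ m))).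
  rewrite mulr_sumr; apply: eq_bigr => k _; rewrite avg_compM avg_low.
    by rewrite exprAC; ring.
  rewrite /g size_prod_XsubC /index_enum -enumT size_enum_ord.
  exact: ltn_pmod.
rewrite (ncoef_qpoch qpow_neq0 qpow_not_root1) eq_sym.
by case: eqP => _; rewrite ?mulr1 ?mulr0.
Qed.

Lemma lamj_XnM j i j' : lamj j ('X^i * (qpoch Q j' \Po 'X^m)) =
  if (m %| i)%N then \sum_(k < j.+1) (qbin Q j)`_k * (q ^+ i) ^+ k * (qpoch Q j').[Q ^+ k]
  else 0.
Proof.
rewrite /lamj; under eq_bigr do rewrite [X in avg X _]mulrC avg_compM avg_Xn.
case: ifP => mi; last by rewrite big1// => k _; rewrite !mulr0.
by apply: eq_bigr => k _; rewrite [(q ^+ k) ^+ i]exprAC [(q ^+ k) ^+ m]exprAC; ring.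
Qed.

(** Evaluated at A(0), the right-hand side is the effect of qbin_j of ratio Q on the term of degree
    i of an averaged series: exponents not divisible by m disappear. *)
Lemma lamj_sum_qbin j i J : (j < J)%N ->
  \sum_(j' < J) lamj j ('X^i * (qpoch Q j' \Po 'X^m)) *: qbin Q j' =
  if (m %| i)%N then qbin Q j \Po (q ^+ i *: 'X) else 0.
Proof.
move=> jJ; under eq_bigr do rewrite lamj_XnM.
case: ifP => mi; last by rewrite big1// => k _; rewrite scale0r.
transitivity (\sum_(k < j.+1) ((qbin Q j)`_k * (q ^+ i) ^+ k) *: 'X^k); last first.
  apply/polyP => k; rewrite coef_comp_scale coef_sum.
  under eq_bigr do rewrite coefZ coefXn.
  case: (ltnP k j.+1) => kn.
    rewrite (bigD1 (Ordinal kn))//= eqxx mulr1 big1 ?addr0// => a.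
    by rewrite -val_eqE/= eq_sym => /negbTE->; rewrite mulr0.
  rewrite [in RHS]nth_default ?(size_qbin qpow_neq0 qpow_not_root1)// mul0r big1// => a _.
  by rewrite gtn_eqF ?mulr0// (leq_trans (ltn_ord a)).
under eq_bigr do rewrite scaler_suml.
rewrite exchange_big; apply: eq_bigr => k _.
rewrite (@expX_newton K Q qpow_neq0 qpow_not_root1 k J); last first.
  by apply: leq_ltn_trans jJ; rewrite -ltnS.
by rewrite scaler_sumr; apply: eq_bigr => j' _; rewrite scalerA.
Qed.
End QNewtonPower.

(** * Estimates for Newton coefficients *)

Section NewtonBounds.
Variables (R : realType) (K : fieldType) (abs : K -> R).
Hypothesis na : nonarch_abs abs.
Implicit Types (ws : seq K) (n k i : nat).

(** A further factor is written X - z = (X - w_k) + (w_k - z) against the basis polynomial of index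
    k. Since |w_k - z| <= s, both parts gain the factor s in the weighted bound. *)
Lemma newton_nodes (s : R) (w : nat -> K) ws : 0 < s ->
  (forall k, abs (w k - 1) <= s) -> (forall z, z \in ws -> abs (z - 1) <= s) ->
  exists c : nat -> K, [/\ forall k, (size ws < k)%N -> c k = 0,
    forall k, abs (c k) * s ^+ k <= s ^+ size ws &
    \prod_(z <- ws) ('X - z%:P) =
      \sum_(k < (size ws).+1) c k *: \prod_(i < k) ('X - (w i)%:P)].
Proof.
move=> s0 ww; elim: ws => [|z ws IH] zw.
  exists (fun k => (k == 0)%:R); split=> [[]//|k|].
    by case: k => [|k]; rewrite /= ?(abs1 na) ?mul1r// (abs0 na) mul0r exprn_ge0// ltW.
  by rewrite big_nil big_ord1 big_ord0 scale1r.
have [|c [c0 cs cE]] := IH; first by move=> y yw; apply: zw; rewrite inE yw orbT.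
have zw0 k : abs (w k - z) <= s.
  have -> : w k - z = (w k - 1) - (z - 1) by ring.
  by apply: (absB_le na) => //; apply: zw; rewrite inE eqxx.
pose c' k := (if k is k'.+1 then c k' else 0) + (w k - z) * c k.
exists c'; split=> /=.
  by case=> // k sk; rewrite /c' c0// c0 ?mulr0 ?addr0// ltnW.
  move=> k; have b : abs ((w k - z) * c k) * s ^+ k <= s ^+ (size ws).+1.
    by rewrite (absM na) -mulrA exprS ler_pM ?(abs_ge0 na)// mulr_ge0 ?(abs_ge0 na)// exprn_ge0// ltW.
  rewrite -ler_pdivlMr ?exprn_gt0//; apply: (absD_le na); rewrite ler_pdivlMr ?exprn_gt0//.
  case: k {b} => [|k]; first by rewrite (abs0 na) mul0r exprn_ge0// ltW.
  by rewrite !exprS mulrCA ler_wpM2l ?(ltW s0).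
rewrite big_cons cE mulrC mulr_suml.
transitivity (\sum_(k < (size ws).+1) (c k *: \prod_(i < k.+1) ('X - (w i)%:P) +
   ((w k - z) * c k) *: \prod_(i < k) ('X - (w i)%:P))).
  apply: eq_bigr => k _; rewrite big_ord_recr /= -!mul_polyC rmorphM rmorphB; ring.
rewrite big_split /= [in RHS]big_ord_recl /= big_ord0 /c' add0r.
under [in RHS]eq_bigr do rewrite scalerDl.
rewrite big_split /= [RHS]addrCA; congr (_ + _).
rewrite big_ord_recl big_ord0 /=; congr (_ + _).
by rewrite big_ord_recr /= c0// mulr0 scale0r addr0.
Qed.

Section NCoef.
Variables (q : K) (rho : R).
Hypothesis q_neq0 : q != 0.
Hypothesis q_not_root1 : forall n, (0 < n)%N -> q ^+ n != 1.
Hypotheses (abs_q : abs q = 1) (rho_gt0 : 0 < rho) (rho_le1 : rho <= 1).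
Hypothesis q_rho : abs (q - 1) <= rho.

Lemma abs_qpow_sub1 i : abs (q ^+ i - 1) <= rho.
Proof.
rewrite subrX1 (absM na) -[rho]mulr1 ler_pM ?(abs_ge0 na)//.
by apply: (abs_sum_le na) => // k _; rewrite (absX na) abs_q expr1n.
Qed.

(** A factor X - z acts on Newton coefficients through [ncoef_Xsub], with |q^n - z| <= rho. The
    weighted bound is the useful one for n below the number of factors, the bound by 1 for larger
    n. *)
Lemma ncoef_prod_bound i n ws : (forall z, z \in ws -> abs (z - 1) <= rho) ->
  abs (ncoef q n ('X^i * \prod_(z <- ws) ('X - z%:P))) <= 1 /\
  abs (ncoef q n ('X^i * \prod_(z <- ws) ('X - z%:P))) * rho ^+ n <= rho ^+ size ws.
Proof.
have rX k : 0 <= rho ^+ k by rewrite exprn_ge0// ltW.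
have rX1 k : rho ^+ k <= 1 by rewrite exprn_ile1// ltW.
elim: ws n => [|z ws IH] n wsr.
  rewrite big_nil mulr1 /=.
  have H : abs (ncoef q n 'X^i) <= 1.
    elim: i n => [|i IH] n.
      by rewrite expr0 ncoef1//; case: eqP => _; rewrite ?(abs1 na) ?(abs0 na).
    rewrite exprS; case: n => [|n].
      by rewrite ncoef0 hornerM hornerX mul1r -(ncoef0 q).
    by rewrite ncoefX//; apply: (absD_le na) => //; rewrite (absM na) (absX na) abs_q expr1n mul1r.
  by split=> //; rewrite -[leRHS]mulr1 ler_pM ?(abs_ge0 na).
have zr : abs (z - 1) <= rho by apply: wsr; rewrite inE eqxx.
have IH' k := IH k (fun y (yw : y \in ws) => wsr y (mem_behead (yw : y \in behead (z :: ws)))).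
rewrite big_cons mulrCA; set P := 'X^i * _ in IH' *.
have qz k : abs (q ^+ k - z) <= rho.
  have -> : q ^+ k - z = (q ^+ k - 1) - (z - 1) by ring.
  by apply: (absB_le na) => //; exact: abs_qpow_sub1.
have b1 k : abs ((q ^+ k - z) * ncoef q k P) <= 1.
  have [h _] := IH' k; rewrite (absM na) -[leRHS]mulr1 ler_pM ?(abs_ge0 na)//.
  exact: le_trans (qz k) rho_le1.
have b2 k : abs ((q ^+ k - z) * ncoef q k P) * rho ^+ k <= rho ^+ (size ws).+1.
  have [_ h] := IH' k; rewrite (absM na) -mulrA exprS ler_pM ?mulr_ge0 ?(abs_ge0 na)//.
case: n => [|n].
  have -> : ncoef q 0 (('X - z%:P) * P) = (q ^+ 0 - z) * ncoef q 0 P.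
    by rewrite !ncoef0// hornerM !hornerE.
  by split; [exact: b1|exact: b2].
rewrite ncoef_Xsub//; have [h1 h2] := IH' n; split; first exact: absD_le.
rewrite -ler_pdivlMr ?exprn_gt0//; apply: (absD_le na); rewrite ler_pdivlMr ?exprn_gt0//.
by rewrite exprS mulrCA [leRHS]exprS ler_wpM2l// ltW.
Qed.

Section Lamj.
Variables (m : nat) (w : K).
Hypotheses (m_gt0 : (0 < m)%N) (wP : m.-primitive_root w) (abs_w : abs w = 1).
Hypothesis w_rho : forall k, abs (w ^+ k - 1) <= rho.

Lemma node_rho k : abs (node q m w k - 1) <= rho.
Proof.
have -> : node q m w k - 1 = w ^+ k * (q ^+ (k %/ m) - 1) + (w ^+ k - 1).
  by rewrite /node; ring.
apply: (absD_le na) => //; rewrite (absM na) (absX na) abs_w expr1n mul1r.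
exact: abs_qpow_sub1.
Qed.

Lemma ncoef_pow_bound i j n :
  abs (ncoef q n ('X^i * (qpoch (q ^+ m) j \Po 'X^m))) <= 1 /\
  abs (ncoef q n ('X^i * (qpoch (q ^+ m) j \Po 'X^m))) * rho ^+ n <= rho ^+ (j * m).
Proof.
have := @ncoef_prod_bound i n [seq node q m w k | k <- index_iota 0 (j * m)].
rewrite big_map size_map size_iota subn0 big_mkord -(node_poly_mul q_neq0 m_gt0 wP).
apply => z /mapP[k _ ->].
exact: node_rho.
Qed.

(** The powers of q and the nodes all lie within rho of 1, so [newton_nodes] expands [qpoch q n] in
    node polynomials. The functional only sees the block of indices k with j m <= k < (j + 1) m;
    replacing rho^k by rho^((j+1) m) makes the estimate uniform over it. *)
Lemma lamj_bound j n :
  abs (lamj q m w j (qpoch q n)) * rho ^+ (j.+1 * m) <= rho ^+ n /\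
  ((n < j * m)%N -> lamj q m w j (qpoch q n) = 0).
Proof.
have [||c [c0 cb cE]] := @newton_nodes rho (node q m w) [seq q ^+ i | i <- index_iota 0 n] rho_gt0.
  exact: node_rho.
  by move=> z /mapP[k _ ->]; exact: abs_qpow_sub1.
rewrite size_map size_iota subn0 in c0 cb cE.
have {cE} qE : qpoch q n = \sum_(k < n.+1) c k *: node_poly q m w k.
  by rewrite -cE big_map big_mkord.
have lE : lamj q m w j (qpoch q n) = \sum_(k < n.+1) c k * lamj q m w j (node_poly q m w k).
  rewrite qE; elim/big_rec2: _ => [|k y1 y2 _ <-]; last exact: lamj_linear.
  have := lamj_linear q m w j 0 0 0; rewrite scale0r addr0 mul0r add0r => H.
  by rewrite /lamj big1// => k _; rewrite /avg big1 ?mulr0// => a _; rewrite horner0.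
have lb k : abs (lamj q m w j (node_poly q m w k)) <= 1.
  rewrite lamj_node_poly//; case: eqP => _; last by rewrite (abs0 na).
  rewrite coef0_prod (abs_prod na); rewrite big1// => s _.
  rewrite coefB coefX coefC sub0r (absN na) (absM na) !(absX na).
  by rewrite abs_w abs_q !expr1n mulr1.
rewrite lE; split=> [|nj].
  rewrite -ler_pdivlMr ?exprn_gt0//; apply: (abs_sum_le na).
    by rewrite divr_ge0// exprn_ge0// ltW.
  move=> k _; rewrite ler_pdivlMr ?exprn_gt0// (absM na).
  have [km|/negbTE km] := eqVneq (k %/ m)%N j; last first.
    rewrite [X in _ * abs X * _](_ : _ = 0) ?(abs0 na) ?mulr0 ?mul0r ?exprn_ge0 ?ltW//.
    by rewrite lamj_node_poly// km.
  apply: le_trans (cb k); rewrite -mulrA ler_wpM2l ?(abs_ge0 na)//.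
  rewrite -[leRHS]mul1r ler_pM ?(abs_ge0 na) ?exprn_ge0 ?(ltW rho_gt0)//.
  rewrite ler_wiXn2l ?(ltW rho_gt0)// -km; exact/ltnW/ltn_ceil.
rewrite big1// => k _; rewrite lamj_node_poly// ifF ?mulr0//; apply/negbTE.
rewrite neq_ltn ltn_divLR//; apply/orP; left; apply: leq_ltn_trans nj.
by rewrite -ltnS.
Qed.
End Lamj.
End NCoef.
End NewtonBounds.

(** * p-adic estimates for powers, roots of unity and factorials *)

Section PAdic.
Variables (R : realType) (p : nat) (K : fieldType) (abs : K -> R) (pi : K).
Hypotheses (p_prime : prime p) (na : nonarch_abs abs).
Hypothesis abs_p : abs p%:R = p%:R^-1.
Hypothesis piE : pi ^+ p.-1 = - p%:R.
Implicit Types (x y v z : K) (n : nat).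

Lemma abs_pi_exp : abs pi ^+ p.-1 = p%:R^-1.
Proof. by rewrite -(absX na) piE (absN na). Qed.

Lemma pred_p_gt0 : (0 < p.-1)%N.
Proof. by rewrite -subn1 subn_gt0 prime_gt1. Qed.

Lemma abs_pi_gt0 : 0 < abs pi.
Proof.
rewrite lt0r (abs_ge0 na) andbT; apply/eqP => pi0.
have := abs_pi_exp; rewrite pi0 expr0n gtn_eqF ?pred_p_gt0//= => /esym/eqP.
by rewrite invr_eq0 gt_eqF// (p_natr_gt0 R p_prime).
Qed.

Lemma abs_pi_lt1 : abs pi < 1.
Proof.
rewrite -(@expr_lt1 _ p.-1) ?pred_p_gt0 ?(abs_ge0 na)// abs_pi_exp invf_lt1 ?(p_natr_gt0 R p_prime)//.
by rewrite ltr1n prime_gt1.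
Qed.

(** All the middle binomial coefficients are divisible by p, and since |v| < 1 the linear term p v
    dominates the others. *)
Lemma binomial_middle v : abs v < 1 -> v != 0 ->
  exists2 d, (1 + v) ^+ p - 1 = v ^+ p + d & abs d = abs v / p%:R.
Proof.
move=> v1 v0; have p1 := prime_gt1 p_prime.
pose d := \sum_(1 <= k < p) v ^+ k *+ 'C(p, k).
exists d.
  rewrite exprDn; under eq_bigr do rewrite expr1n mul1r.
  rewrite -(big_mkord xpredT (fun k => v ^+ k *+ 'C(p, k))) big_nat_recr//= big_ltn ?prime_gt0//.
  rewrite -/d expr0 bin0 binn !mulr1n; ring.
have pR := (p_natr_gt0 R p_prime); have av : 0 < abs v by rewrite (abs_gt0 na).
rewrite /d big_ltn// expr1 bin1 -mulr_natr (absD_dom na) (absM na) abs_p//.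
rewrite big_nat; apply: (abs_sum_lt na); first by rewrite divr_gt0.
move=> k /andP[k2 kp].
have /dvdnP[c ->] : (p %| 'C(p, k))%N by rewrite prime_dvd_bin// kp (ltn_trans _ k2).
rewrite -mulr_natr natrM !(absM na) (absX na) abs_p mulrA ltr_pM2r ?invr_gt0//.
apply: le_lt_trans (_ : abs v ^+ k * 1 < _).
  by rewrite ler_wpM2l ?exprn_ge0 ?(abs_ge0 na)// (abs_nat_le1 na).
rewrite mulr1; case: k k2 {kp} => [//|k] k1; rewrite exprS gtr_pMr//.
by rewrite expr_lt1 ?(abs_ge0 na).
Qed.

(** The competing terms |v|^p and |v| / p balance exactly at |v| = |pi|, as |pi|^(p-1) = 1/p; below
    this radius the linear term wins, above it the p-th power. *)
Lemma abs_pow_p_small v : abs v < abs pi -> abs ((1 + v) ^+ p - 1) = abs v / p%:R.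
Proof.
move=> vpi; have [->|v0] := eqVneq v 0; first by rewrite addr0 expr1n subrr (abs0 na) mul0r.
have av : 0 < abs v by rewrite (abs_gt0 na).
have [d -> dE] := binomial_middle (lt_trans vpi abs_pi_lt1) v0.
rewrite addrC (absD_dom na) dE// (absX na) -[in ltLHS](prednK (prime_gt0 p_prime)) exprS.
by rewrite ltr_pM2l// -abs_pi_exp ltrXn2r ?(abs_ge0 na) ?gtn_eqF ?pred_p_gt0.
Qed.

Lemma abs_pow_p_large v : abs v < 1 -> abs pi < abs v ->
  abs ((1 + v) ^+ p - 1) = abs v ^+ p.
Proof.
move=> v1 piv; have av : 0 < abs v by apply: lt_trans abs_pi_gt0 piv.
have v0 : v != 0 by rewrite -(abs_gt0 na).
have [d -> dE] := binomial_middle v1 v0.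
rewrite (absD_dom na) (absX na)// dE -[in ltRHS](prednK (prime_gt0 p_prime)) exprS.
by rewrite ltr_pM2l// -abs_pi_exp ltrXn2r ?(abs_ge0 na) ?gtn_eqF ?pred_p_gt0.
Qed.

(** If |z - 1| >= 1, the term (z - 1)^p dominates z^p - 1, which contradicts the inductive bound for
    z^p. *)
Lemma unity_sub1_lt1 l z : z ^+ (p ^ l) = 1 -> abs (z - 1) < 1.
Proof.
elim: l z => [|l IH] z; first by rewrite expr1 => ->; rewrite subrr (abs0 na).
rewrite expnS exprM => /IH; case: (ltP (abs (z - 1)) 1) => // le1.
have az : abs z <= Num.max (abs (z - 1)) 1.
  by rewrite -[z in leLHS](subrK 1); apply: (le_trans (nonarch_absD na _ _)); rewrite (abs1 na).
set v := z - 1; have zE : z = 1 + v by rewrite addrC subrK.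
pose d := \sum_(1 <= k < p) v ^+ k *+ 'C(p, k).
have -> : z ^+ p - 1 = v ^+ p + d.
  rewrite zE exprDn; under eq_bigr do rewrite expr1n mul1r.
  rewrite -(big_mkord xpredT (fun k => v ^+ k *+ 'C(p, k))) big_nat_recr//= big_ltn ?prime_gt0//.
  rewrite -/d expr0 bin0 binn !mulr1n; ring.
rewrite (absD_dom na) (absX na).
  by rewrite ltNge exprn_ege1.
rewrite /d big_nat; apply: (abs_sum_lt na); first by rewrite exprn_gt0// (lt_le_trans ltr01).
move=> k /andP[k1 kp].
have /dvdnP[c ->] : (p %| 'C(p, k))%N by rewrite prime_dvd_bin// k1.
rewrite -mulr_natr natrM !(absM na) (absX na).
apply: lt_le_trans (_ : abs v ^+ k * 1 <= _).
  rewrite ltr_pM2l ?exprn_gt0 ?(lt_le_trans ltr01)//.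
  by apply: le_lt_trans (abs_p_natr_lt1 p_prime abs_p); rewrite ler_piMl ?(abs_ge0 na) ?(abs_nat_le1 na).
by rewrite mulr1 ler_weXn2l// ltnW.
Qed.

(** While |z - 1| exceeds |pi|, taking p-th powers raises this distance to its p-th power; after l
    steps there remains a p-th root of unity, which lies within |pi| of 1. *)
Lemma unity_sub1_le l z : z ^+ (p ^ l.+1) = 1 -> abs (z - 1) ^+ (p ^ l) <= abs pi.
Proof.
elim: l z => [|l IH] z zl; have v1 := unity_sub1_lt1 zl.
  rewrite expr1 leNgt; apply/negP => piv.
  have := abs_pow_p_large v1 piv; rewrite [1 + _]addrC subrK -{1}(expn1 p) zl subrr (abs0 na) => /esym/eqP.
  by rewrite expf_eq0 gt_eqF ?andbF// (lt_trans abs_pi_gt0 piv).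
have [vpi|piv] := leP (abs (z - 1)) (abs pi).
  apply: le_trans vpi; rewrite -[leRHS]expr1 ler_wiXn2l ?(abs_ge0 na) ?(ltW v1)//.
  by rewrite expn_gt0 prime_gt0.
have := abs_pow_p_large v1 piv; rewrite [1 + _]addrC subrK => E.
by rewrite expnS exprM -E; apply: IH; rewrite -exprM -expnS.
Qed.

(** Each factor p of n is handled by [abs_pow_p_small]. For n prime to p, the geometric sum (y^n -
    1) / (y - 1) is congruent to the unit n. *)
Lemma abs_pow_sub1 y n : abs (y - 1) < abs pi -> abs (y ^+ n - 1) = abs n%:R * abs (y - 1).
Proof.
elim/ltn_ind: n y => n IH y ypi.
have y1 : abs y = 1.
  rewrite -[y](subrK 1) addrC (absD_dom na) (abs1 na)//; exact: lt_trans ypi abs_pi_lt1.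
have [->|n0] := posnP n; first by rewrite expr0 subrr (abs0 na) mul0r.
have [/dvdnP[k nE]|pn] := boolP (p %| n)%N.
  have k0 : (0 < k)%N by case: k nE n0 => // ->.
  have yp : abs (y ^+ p - 1) = abs (y - 1) / p%:R.
    by have := abs_pow_p_small ypi; rewrite [1 + _]addrC subrK.
  rewrite nE mulnC exprM IH.
    by rewrite yp natrM (absM na) abs_p; ring.
    by rewrite nE ltn_Pmulr// prime_gt1.
  rewrite yp; apply: le_lt_trans ypi; rewrite ler_piMr ?(abs_ge0 na)//.
  by rewrite invf_le1 ?(p_natr_gt0 R p_prime)// ler1n prime_gt0.
have cpn : coprime p n by rewrite prime_coprime.
rewrite subrX1 (absM na) mulrC; congr (_ * _); rewrite (abs_natr_coprime p_prime na abs_p)//.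
have -> : \sum_(i < n) y ^+ i = n%:R + \sum_(i < n) (y ^+ i - 1).
  by rewrite sumrB sumr_const card_ord addrC subrK.
rewrite (absD_dom na) ?(abs_natr_coprime p_prime na abs_p)//.
apply: (abs_sum_lt na) => // i _; rewrite subrX1 (absM na).
apply: le_lt_trans (lt_trans ypi abs_pi_lt1); rewrite ler_piMr ?(abs_ge0 na)//.
by apply: (abs_sum_le na) => // k _; rewrite (absX na) y1 expr1n.
Qed.

Lemma logn_fact_le n : (p.-1 * logn p n`! <= n)%N.
Proof.
rewrite logn_fact//.
(* Partial sums of Legendre's formula; the extra term n / p^N is what makes the induction close. *)
suff H N : (p.-1 * \sum_(1 <= k < N.+1) n %/ p ^ k + n %/ p ^ N <= n)%N.
  by apply: leq_trans (H n); rewrite leq_addr.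
elim: N => [|N IH]; first by rewrite big_geq// muln0 add0n divn1.
rewrite big_nat_recr//= mulnDr -addnA; apply: leq_trans IH; rewrite leq_add2l.
rewrite -mulSnr prednK ?prime_gt0// expnSr divnMA mulnC; exact: leq_divM.
Qed.

Lemma abs_fact_ge n : abs pi ^+ n <= abs (n`!)%:R.
Proof.
have [k cop nE] := pfactor_coprime p_prime (fact_gt0 n).
rewrite nE natrM (absM na) (abs_natr_coprime p_prime na abs_p)// mul1r natrX (absX na) abs_p -abs_pi_exp -exprM.
by rewrite ler_wiXn2l ?(abs_ge0 na) ?(ltW abs_pi_lt1)// logn_fact_le.
Qed.
End PAdic.

(** * Formal solutions *)

Section MatrixSeries.
Variable K : fieldType.
Variable mu : nat.
Local Notation "''MS'" := ('M[fps K]_mu.+1).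
Local Notation "''MK'" := ('M[K]_mu.+1).
Implicit Types (M N Z : 'MS) (B : 'MK).

Definition cf M i : 'MK := map_mx (fun f => fcoef f i) M.
Definition mkmx (Z : nat -> 'MK) : 'MS := \matrix_(a, b) Fps (fun i => Z i a b).
Definition cmx B : 'MS := map_mx (@fps_const K) B.
Definition shiftmx (c : K) M : 'MS := map_mx (fps_shift c) M.

Lemma cfE M i a b : cf M i a b = fcoef (M a b) i. Proof. by rewrite mxE. Qed.
Lemma cf_mk (Z : nat -> 'MK) i : cf (mkmx Z) i = Z i.
Proof. by apply/matrixP => a b; rewrite !mxE. Qed.
Lemma cfP M N : (forall i, cf M i = cf N i) -> M = N.
Proof. by move=> H; apply/matrixP => a b; apply: fpsP => i; rewrite -!cfE H. Qed.
Lemma cfD M N i : cf (M + N) i = cf M i + cf N i.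
Proof. by apply/matrixP => a b; rewrite !mxE. Qed.
Lemma cfN M i : cf (- M) i = - cf M i.
Proof. by apply/matrixP => a b; rewrite !mxE. Qed.
Lemma cfB M N i : cf (M - N) i = cf M i - cf N i.
Proof. by rewrite cfD cfN. Qed.
Lemma cf_sum I (r : seq I) (F : I -> 'MS) i :
  cf (\sum_(k <- r) F k) i = \sum_(k <- r) cf (F k) i.
Proof.
elim/big_rec2: _ => [|k y1 y2 _ <-]; last exact: cfD.
by apply/matrixP => a b; rewrite cfE !mxE fcoef0.
Qed.
Lemma cfM M N n : cf (M *m N) n = \sum_(i < n.+1) cf M i *m cf N (n - i).
Proof.
apply/matrixP => a b; rewrite mxE mxE fcoef_sum summxE.
under eq_bigr do rewrite fcoefM; rewrite exchange_big; apply: eq_bigr => i _.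
by rewrite mxE; apply: eq_bigr => j _; rewrite !cfE.
Qed.
Lemma cf_cmxM B M i : cf (cmx B *m M) i = B *m cf M i.
Proof.
apply/matrixP => a b; rewrite cfE !mxE fcoef_sum; apply: eq_bigr => j _.
by rewrite !mxE fcoefCM.
Qed.
Lemma cf_Mcmx B M i : cf (M *m cmx B) i = cf M i *m B.
Proof.
apply/matrixP => a b; rewrite cfE !mxE fcoef_sum; apply: eq_bigr => j _.
by rewrite !mxE mulrC fcoefCM mulrC.
Qed.
Lemma cf_scale c M i : cf (fps_const c *: M) i = c *: cf M i.
Proof. by apply/matrixP => a b; rewrite cfE !mxE fcoefCM. Qed.
Lemma cf_shift c M i : cf (shiftmx c M) i = c ^+ i *: cf M i.
Proof. by apply/matrixP => a b; rewrite cfE !mxE /= mulrC. Qed.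
Lemma cf_Xn m M i :
  cf (fps_of_poly 'X^m *: M) i = if (i < m)%N then 0 else cf M (i - m).
Proof.
apply/matrixP => a b; rewrite cfE !mxE fcoefXnM; case: ifP => _; rewrite !mxE//.
Qed.
Lemma cf1 i : cf 1%:M i = if i == 0%N then 1%:M else 0.
Proof.
apply/matrixP => a b; rewrite cfE mxE; case: (a == b) / eqP => [<-|/eqP ab].
  by rewrite mulr1n fcoef1; case: (i == _); rewrite mxE ?eqxx.
by rewrite mulr0n fcoef0; case: (i == _); rewrite mxE ?(negbTE ab).
Qed.

Lemma shiftmxM c M N : shiftmx c (M *m N) = shiftmx c M *m shiftmx c N.
Proof. exact: map_mxM. Qed.
Lemma shiftmx1 c : shiftmx c 1%:M = 1%:M.
Proof. exact: map_mx1. Qed.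

Definition fps_at0 (f : fps K) : K := fcoef f 0.
Fact fps_at0_zmod : zmod_morphism fps_at0.
Proof. by []. Qed.
Fact fps_at0_monoid : monoid_morphism fps_at0.
Proof. by split=> [|f g]; rewrite /fps_at0 ?fcoef1 ?fcoef0M. Qed.
HB.instance Definition _ :=
  GRing.isZmodMorphism.Build (fps K) K fps_at0 fps_at0_zmod.
HB.instance Definition _ :=
  GRing.isMonoidMorphism.Build (fps K) K fps_at0 fps_at0_monoid.

Lemma det_fps_mx0 n (M : 'M[fps K]_n) : \det (fps_mx0 M) = fcoef (\det M) 0.
Proof. exact: (det_map_mx fps_at0). Qed.

Lemma unitmx_fps n (M : 'M[fps K]_n) : (M \in unitmx) = (fps_mx0 M \in unitmx).
Proof. by rewrite !unitmxE det_fps_mx0 fps_unitE unitfE. Qed.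

Lemma invmx_unique n (M N : 'M[fps K]_n) : M *m N = 1%:M -> N = invmx M.
Proof.
move=> e; have [u _] := mulmx1_unit e.
by rewrite -[N](mulKmx u) e mulmx1.
Qed.

Lemma shiftmx_inv c M : M \in unitmx -> shiftmx c (invmx M) = invmx (shiftmx c M).
Proof. by move=> u; apply: invmx_unique; rewrite -shiftmxM mulmxV// shiftmx1. Qed.
End MatrixSeries.

(** * Sylvester equations and the formal solution *)

Section Sylvester.
Variables (K : closedFieldType) (mu : nat).
Implicit Types (B X : 'M[K]_mu.+1) (c : K).

Lemma scaled_sub_unit (A0 : 'M[K]_mu.+1) c z : c != 0 -> ~~ eigenvalue A0 (c^-1 * z) ->
  (c *: A0 - z%:M) \in unitmx.
Proof.
move=> c0 ne; rewrite -row_free_unit; apply: inj_row_free => v /eqP.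
rewrite mulmxBr subr_eq0 mul_mx_scalar -scalemxAr => /eqP e.
apply/eqP; apply: contraNT ne => v0; apply/eigenvalueP; exists v => //.
by rewrite -scalerA -e scalerA mulVf// scale1r.
Qed.

(** The equation gives P(A0) X = X P(c A0) for every polynomial P. For the characteristic polynomial
    of A0 the left side vanishes, while P(c A0) is a product of invertible factors c A0 - z. *)
Lemma sylvester_inj (A0 : 'M[K]_mu.+1) c X : c != 0 ->
  (forall a b, eigenvalue A0 a -> eigenvalue A0 b -> a != c * b) ->
  c *: (X *m A0) - A0 *m X = 0 -> X = 0.
Proof.
move=> c0 ne /eqP; rewrite subr_eq0 => /eqP e.
have [r cE] := closed_field_poly_normal (char_poly A0).
rewrite (monicP (char_poly_monic A0)) scale1r in cE.
have H : forall P, horner_mx A0 P *m X = X *m horner_mx (c *: A0) P.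
  elim/poly_ind => [|P a IH]; first by rewrite !rmorph0 mul0mx mulmx0.
  rewrite !rmorphD !rmorphM /= !horner_mx_X !horner_mx_C mulmxDl mulmxDr.
  rewrite -mulmxE -mulmxA -e scalemxAr mulmxA IH -mulmxA; congr (_ + _).
  by rewrite -scalar_mxC.
have := H (char_poly A0); rewrite Cayley_Hamilton mul0mx cE.
have rr z : z \in r -> (c *: A0 - z%:M) \in unitmx.
  move=> zr; apply: scaled_sub_unit => //; apply/negP => ez.
  have ez' : eigenvalue A0 z by rewrite eigenvalue_root_char cE root_prod_XsubC.
  by have := ne _ _ ez' ez; rewrite mulVKf// eqxx.
elim: r {cE} X {e H} rr => [|z r IH] X rr.
  by rewrite big_nil rmorph1 mulmx1.
rewrite big_cons rmorphM /= -mulmxE mulmxA => e.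
have : X *m horner_mx (c *: A0) ('X - z%:P) = 0.
  by apply: IH => // y yr; apply: rr; rewrite inE yr orbT.
rewrite rmorphB /= horner_mx_X horner_mx_C => e'.
have u : (c *: A0 - z%:M) \in unitmx by apply: rr; rewrite inE eqxx.
by rewrite -[X](mulmxK u) e' mul0mx.
Qed.

Lemma sylvester (A0 : 'M[K]_mu.+1) c B : c != 0 ->
  (forall a b, eigenvalue A0 a -> eigenvalue A0 b -> a != c * b) ->
  exists X, c *: (X *m A0) - A0 *m X = B.
Proof.
move=> c0 ne; pose M := c *: lin_mulmxr A0 - lin_mulmx A0.
have ME X : mxvec X *m M = mxvec (c *: (X *m A0) - A0 *m X).
  by rewrite /M mulmxBr -scalemxAr !mul_vec_lin /= linearB linearZ.
have u : M \in unitmx.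
  rewrite -row_free_unit; apply: inj_row_free => v; rewrite -[v]vec_mxK ME => e.
  rewrite (_ : vec_mx v = 0) ?linear0//; apply: (sylvester_inj c0 ne).
  by apply: (can_inj mxvecK); rewrite e linear0.
exists (vec_mx (mxvec B *m invmx M)); apply: (can_inj mxvecK).
by rewrite -ME vec_mxK mulmxKV.
Qed.
End Sylvester.

Section FormalSolution.
Variables (K : closedFieldType) (mu : nat) (q : K) (A : 'M[fps K]_mu.+1).
Hypothesis q_neq0 : q != 0.
Local Notation A0 := (fps_mx0 A).
Hypothesis nonresonant : forall a b, eigenvalue A0 a -> eigenvalue A0 b ->
  forall i, (0 < i)%N -> a != q ^+ i * b.

(** Comparing coefficients of x^n gives a Sylvester equation for Y_n whose right-hand side involves
    earlier coefficients only; non-resonance makes it solvable for n > 0. *)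
Lemma formal_solution : exists Y : 'M[fps K]_mu.+1,
  [/\ fps_mx0 Y = 1%:M, Y \in unitmx & shiftmx q Y *m cmx A0 = A *m Y].
Proof.
pose sol n B := xget 0 [set X | q ^+ n *: (X *m A0) - A0 *m X = B].
have solP n B : (0 < n)%N -> q ^+ n *: (sol n B *m A0) - A0 *m sol n B = B.
  move=> n0; have [|X XP] := @sylvester K mu A0 (q ^+ n) B (expf_neq0 n q_neq0).
    by move=> a b ea eb; apply: nonresonant.
  exact: (@xgetI _ 0 [set X | q ^+ n *: (X *m A0) - A0 *m X = B] X XP).
pose g n (y : nat -> 'M[K]_mu.+1) :=
  if n is 0%N then 1%:M else sol n (\sum_(i < n) cf A (n - i) *m y i).
have [|y yE] := @strong_recursion _ 0 g.
  case=> // n y y' e; rewrite /g; congr (sol _ _); apply: eq_bigr => i _.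
  by rewrite e.
have Y0 : fps_mx0 (mkmx y) = 1%:M by rewrite -[LHS]/(cf (mkmx y) 0) cf_mk yE.
exists (mkmx y); split; [exact: Y0|by rewrite unitmx_fps Y0 unitmx1|].
apply: cfP => n; rewrite cf_Mcmx cf_shift cf_mk cfM.
case: n => [|n].
  by rewrite big_ord1 cf_mk yE scale1r mul1mx mulmx1.
rewrite (reindex_inj rev_ord_inj) big_ord_recr /= subnn.
under eq_bigr => i _ do rewrite subSS cf_mk subKn ?(ltnW (ltn_ord i))//.
rewrite cf_mk subn0 -[cf A 0]/A0 -scalemxAl.
have := solP n.+1 (\sum_(i < n.+1) cf A (n.+1 - i) *m y i) isT.
rewrite -[sol _ _]/(g n.+1 y) -yE => <-.
by rewrite subrK.
Qed.
End FormalSolution.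
(** The algebra of one step of the recursion for G_n, with a = q - 1, b = q^n, y = x^n, k = [n]_q^!
    and d = q^(n+1) - 1; g and h are the numerators of indices n and n + 1. *)
Lemma gauge_step_identity (F : fieldType) (a b x y k g d h : F) :
  a != 0 -> b != 0 -> x != 0 -> y != 0 ->
  (a * x)^-1 * (k * (b * g + b * d * h) / (b * y) - k * g / y) =
  k * (a^-1 * d) * h / (y * x).
Proof. by move=> a0 b0 x0 y0; field; rewrite a0 b0 x0 y0. Qed.

(** * Operators on multivalued matrices *)

Section TwistedEvaluation.
Variables (K : fieldType) (mu : nat) (q : K) (A0 : 'M[K]_mu.+1).
Local Notation "''MS'" := ('M[fps K]_mu.+1).
Implicit Types (M N Z : 'MS) (B : 'M[K]_mu.+1) (phi psi : {poly K}) (c : K).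

(* If Z = \sum_i Z_i x^i and A0 = q^a, then [tw Z phi] is the result of applying
   phi(sigma_q) to the multivalued matrix Z(x) x^a, divided by x^a. *)
Definition tw Z phi : 'MS := mkmx (fun i => cf Z i *m horner_mx (q ^+ i *: A0) phi).

Lemma horner_mx_comp_scale B c phi :
  horner_mx B (phi \Po (c *: 'X)) = horner_mx (c *: B) phi.
Proof.
elim/poly_ind: phi => [|P a IH]; first by rewrite comp_poly0 !rmorph0.
rewrite comp_polyD comp_polyM comp_polyX comp_polyC !rmorphD !rmorphM /= IH.
by rewrite horner_mxZ !horner_mx_X !horner_mx_C.
Qed.

Lemma twD Z phi psi : tw Z (phi + psi) = tw Z phi + tw Z psi.
Proof. by apply: cfP => i; rewrite cfD !cf_mk rmorphD mulmxDr. Qed.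
Lemma twZ Z c phi : tw Z (c *: phi) = fps_const c *: tw Z phi.
Proof. by apply: cfP => i; rewrite cf_scale !cf_mk horner_mxZ scalemxAr. Qed.
Lemma twDl M N phi : tw (M + N) phi = tw M phi + tw N phi.
Proof. by apply: cfP => i; rewrite cfD !cf_mk cfD mulmxDl. Qed.
Lemma twBl M N phi : tw (M - N) phi = tw M phi - tw N phi.
Proof. by apply: cfP => i; rewrite cfB !cf_mk cfB mulmxBl. Qed.
Lemma tw1 Z : tw Z 1 = Z.
Proof. by apply: cfP => i; rewrite !cf_mk rmorph1 mulmx1. Qed.
Lemma tw_cmx B Z phi : tw (cmx B *m Z) phi = cmx B *m tw Z phi.
Proof. by apply: cfP => i; rewrite cf_cmxM !cf_mk cf_cmxM mulmxA. Qed.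
Lemma tw_scale c Z phi : tw (fps_const c *: Z) phi = fps_const c *: tw Z phi.
Proof. by apply: cfP => i; rewrite cf_scale !cf_mk cf_scale scalemxAl. Qed.
Lemma tw_Xn m Z phi : tw (fps_of_poly 'X^m *: Z) phi =
  fps_of_poly 'X^m *: tw Z (phi \Po (q ^+ m *: 'X)).
Proof.
apply: cfP => i; rewrite cf_Xn !cf_mk cf_Xn; case: ltnP => im; first by rewrite mul0mx.
by rewrite horner_mx_comp_scale scalerA -exprD subnKC.
Qed.

Variables (A Y : 'MS).
Hypothesis q_neq0 : q != 0.
Hypothesis Y_unit : Y \in unitmx.
Hypothesis YE : shiftmx q Y *m cmx A0 = A *m Y.

(** In other words phi(sigma_q)(Z x^a) times the inverse of Y x^a: the multivalued factor
    cancels. *)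
Definition op Z phi : 'MS := tw Z phi *m invmx Y.

Lemma shiftmx_unit c M : M \in unitmx -> shiftmx c M \in unitmx.
Proof.
move=> u; have e : shiftmx c M *m shiftmx c (invmx M) = 1%:M.
  by rewrite -shiftmxM mulmxV// shiftmx1.
by have [u1 _] := mulmx1_unit e; exact: u1.
Qed.

(** Since Y x^a solves the system, sigma_q becomes M(x) -> M(q x) A(x) after division by Y x^a. This
    is an operation on analytic elements, even though Z and Y are only formal. *)
Lemma op_mulX Z phi : op Z ('X * phi) = shiftmx q (op Z phi) *m A.
Proof.
have e1 : tw Z ('X * phi) = shiftmx q (tw Z phi) *m cmx A0.
  apply: cfP => i; rewrite cf_Mcmx cf_shift !cf_mk mulrC rmorphM /= horner_mx_X.
  by rewrite -mulmxE -scalemxAr -scalemxAl -!scalemxAr mulmxA.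
have u := shiftmx_unit q Y_unit.
rewrite /op shiftmxM e1 -!mulmxA; congr (_ *m _).
apply: (can_inj (mulKmx u)); rewrite !mulmxA YE shiftmx_inv// mulmxV// mul1mx.
by rewrite mulmxK.
Qed.

Lemma opD Z phi psi : op Z (phi + psi) = op Z phi + op Z psi.
Proof. by rewrite /op twD mulmxDl. Qed.
Lemma opZ Z c phi : op Z (c *: phi) = fps_const c *: op Z phi.
Proof. by rewrite /op twZ scalemxAl. Qed.
Lemma opDl M N phi : op (M + N) phi = op M phi + op N phi.
Proof. by rewrite /op twDl mulmxDl. Qed.
Lemma opBl M N phi : op (M - N) phi = op M phi - op N phi.
Proof. by rewrite /op twBl mulmxBl. Qed.
Lemma op1 Z : op Z 1 = Z *m invmx Y.
Proof. by rewrite /op tw1. Qed.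
Lemma op_cmx B Z phi : op (cmx B *m Z) phi = cmx B *m op Z phi.
Proof. by rewrite /op tw_cmx mulmxA. Qed.
Lemma op_scale c Z phi : op (fps_const c *: Z) phi = fps_const c *: op Z phi.
Proof. by rewrite /op tw_scale scalemxAl. Qed.
Lemma op_Xn m Z phi : op (fps_of_poly 'X^m *: Z) phi =
  fps_of_poly 'X^m *: op Z (phi \Po (q ^+ m *: 'X)).
Proof. by rewrite /op tw_Xn scalemxAl. Qed.

Section Gseq.
Hypothesis q_not_root1 : forall n, (0 < n)%N -> q ^+ n != 1.

Lemma qintE n : (q - 1) * qint q n = q ^+ n - 1.
Proof. by rewrite /qint -subrX1. Qed.

Lemma qfactS n : qfact q n.+1 = qfact q n * qint q n.+1.
Proof. by rewrite /qfact big_nat_recr. Qed.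

Lemma qfact_neq0 n : qfact q n != 0.
Proof.
elim: n => [|n IH]; first by rewrite /qfact big_geq ?oner_eq0.
rewrite qfactS mulf_neq0//; apply: contraNneq (q_not_root1 (ltn0Sn n)) => e.
by rewrite -subr_eq0 -qintE e mulr0.
Qed.

(** The definition of G_(n+1) simplifies to (G_n(q x) A - G_n) / ((q - 1) x). By [op_mulX] and
    [qbin_mulX], the right-hand side obeys the same recursion. *)
Lemma Gseq_op n i j : Gseq q (mx_laurent A) n i j =
  (fps_const (qfact q n) * op Y (qbin q n) i j)%:L / (fps_of_poly 'X^n)%:L.
Proof.
have q1 : q - 1 != 0 by rewrite subr_eq0 -[q]expr1 q_not_root1.
have Xn0 k : fps_of_poly 'X^k != 0 :> fps K.
  by apply/eqP => /(congr1 (fun h => fcoef h k)); rewrite fcoef0 /= coefXn eqxx; apply/eqP/oner_neq0.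
have C0 c : c != 0 -> fps_const c != 0.
  by move=> c0; rewrite -[0](rmorph0 (@fps_const K)); apply: contraNneq c0 => /(congr1 (fun h => fcoef h 0)) /=; rewrite !coefC /= => ->.
elim: n i j => [|n IH] i j.
  rewrite /= qbin0 op1 mulmxV// /qfact big_geq// rmorph1 mul1r expr0 rmorph1.
  by rewrite !mxE -[X in _ / X]/(1%:L) tofrac1 divr1; case: (i == j); rewrite ?tofrac1 ?tofrac0.
set kappa := qfact q n; set f := op Y (qbin q n) in IH.
pose S := map_mx (laurent_shift q) (Gseq q (mx_laurent A) n).
set c := (fps_of_poly ((q - 1) *: 'X))%:L.
have -> : Gseq q (mx_laurent A) n.+1 = c^-1 *: (S *m mx_laurent A - Gseq q (mx_laurent A) n).
  rewrite /= -/S /Gseq_one -/c -scalemxAr mulmxBr mulmx1.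
  have -> : map_mx (qderiv q) (Gseq q (mx_laurent A) n) = c^-1 *: (S - Gseq q (mx_laurent A) n).
    by apply/matrixP => a b; rewrite !mxE /qderiv mulrC.
  by rewrite -scalerDr addrA subrK.
have SE a b : S a b = (fps_const kappa * fps_shift q (f a b))%:L / (fps_const (q ^+ n) * fps_of_poly 'X^n)%:L.
  rewrite mxE IH laurent_shiftE// fps_shiftM; congr (_%:L / _%:L).
    by congr (_ * _); apply: fpsP => -[|k] /=; rewrite coefC ?mulr1// mul0r.
  apply: fpsP => k; rewrite fcoefCM /= coefXn; case: eqP => [->|_]; first by rewrite mul1r mulr1.
  by rewrite mul0r mulr0.
have SA : (S *m mx_laurent A) i j =
    (fps_const kappa * op Y ('X * qbin q n) i j)%:L / (fps_const (q ^+ n) * fps_of_poly 'X^n)%:L.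
  rewrite op_mulX mxE [in RHS]mxE mulr_sumr rmorph_sum mulr_suml; apply: eq_bigr => k _.
  by rewrite SE !mxE mulrAC -tofracM mulrA.
have qn0 : q ^+ n != 0 by rewrite expf_neq0.
have d0 : q ^+ n.+1 - 1 != 0 by rewrite subr_eq0 q_not_root1.
rewrite mxE mxE [X in _ * (_ + X)]mxE SA IH -/kappa.
set h := op Y (qbin q n.+1) i j; set g := f i j.
have -> : op Y ('X * qbin q n) i j =
    fps_const (q ^+ n) * g + fps_const (q ^+ n * (q ^+ n.+1 - 1)) * h.
  rewrite qbin_mulX// opD (opZ Y (q ^+ n) (qbin q n)) (opZ Y _ (qbin q n.+1)).
  by rewrite mxE; congr (_ + _); rewrite mxE.
rewrite qfactS -/kappa; have -> : qint q n.+1 = (q - 1)^-1 * (q ^+ n.+1 - 1).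
  by rewrite -qintE mulKf.
have -> : c = (fps_const (q - 1))%:L * (fps_of_poly 'X)%:L.
  by rewrite /c -mul_polyC rmorphM -tofracM.
have cV : (fps_const (q - 1)^-1)%:L = ((fps_const (q - 1))%:L)^-1.
  have a0 : (fps_const (q - 1))%:L != 0 by rewrite tofrac_eq0 C0.
  by apply: (mulfI a0); rewrite mulfV// -tofracM -rmorphM mulfV// rmorph1 tofrac1.
have cM (a b : K) : fps_const (a * b) = fps_const a * fps_const b by exact: rmorphM.
have -> : fps_of_poly 'X^(n.+1) = fps_of_poly 'X^n * fps_of_poly 'X :> fps K.
  by rewrite -rmorphM exprSr.
rewrite !cM !tofracM tofracD !tofracM cV.
have := C0 _ q1; rewrite -tofrac_eq0; move: (fps_const (q - 1))%:L => a a0.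
have := C0 _ qn0; rewrite -tofrac_eq0; move: (fps_const (q ^+ n))%:L => b b0.
have := Xn0 n; rewrite -tofrac_eq0; move: (fps_of_poly 'X^n)%:L => xn xn0.
have := Xn0 1%N; rewrite expr1 -tofrac_eq0; move: (fps_of_poly 'X)%:L => x x0.
exact: gauge_step_identity.
Qed.
End Gseq.
End TwistedEvaluation.
Section BoundedMatrices.
Variables (R : realType) (K : fieldType) (abs : K -> R) (mu : nat).
Hypothesis na : nonarch_abs abs.
Local Notation "''MS'" := ('M[fps K]_mu.+1).
Implicit Types (M N Z : 'MS) (B : 'M[K]_mu.+1) (C D : R).
Local Notation bnd := (bnd abs).

Definition mbnd M C := forall a b, bnd (M a b) C.

Lemma mbnd_cf M C : mbnd M C <-> forall i a b, abs (cf M i a b) <= C.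
Proof. by split=> H => [i a b|a b i]; [rewrite cfE|rewrite -cfE]; exact: H. Qed.
Lemma mbnd_ge0 M C : mbnd M C -> 0 <= C.
Proof. by move=> H; apply: (bnd_ge0 na (H ord0 ord0)). Qed.
Lemma mbndW M C D : C <= D -> mbnd M C -> mbnd M D.
Proof. by move=> CD MC a b; apply: bndW CD (MC a b). Qed.
Lemma mbndD M N C : mbnd M C -> mbnd N C -> mbnd (M + N) C.
Proof. by move=> MC NC a b; rewrite mxE; apply: bndD. Qed.
Lemma mbndB M N C : mbnd M C -> mbnd N C -> mbnd (M - N) C.
Proof. by move=> MC NC a b; rewrite !mxE; apply: bndB. Qed.
Lemma mbndM M N C D : mbnd M C -> mbnd N D -> mbnd (M *m N) (C * D).
Proof.
move=> MC ND a b; rewrite mxE; apply: (bnd_sum na) => [|k _]; last exact: bndM.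
by rewrite mulr_ge0 ?(mbnd_ge0 MC) ?(mbnd_ge0 ND).
Qed.
Lemma mbndZ f M C D : bnd f C -> mbnd M D -> mbnd (f *: M) (C * D).
Proof. by move=> fC MD a b; rewrite mxE; apply: bndM. Qed.
Lemma mbndCZ c M D : mbnd M D -> mbnd (fps_const c *: M) (abs c * D).
Proof. by move=> MD a b; rewrite mxE; apply: bndCM. Qed.
Lemma mbnd_cmx B : exists C, mbnd (cmx B) C.
Proof.
exists (\sum_a \sum_b abs (B a b)) => a b i; rewrite mxE /= coefC.
have s0 c : 0 <= \sum_b abs (B c b) by apply: sumr_ge0 => *; exact: abs_ge0.
case: eqP => _; last by rewrite (abs0 na) sumr_ge0.
rewrite (bigD1 a)//= (bigD1 b)//= -addrA lerDl addr_ge0 ?sumr_ge0// => *; exact: abs_ge0.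
Qed.
Lemma mbnd_shift c M C : abs c = 1 -> mbnd M C -> mbnd (shiftmx c M) C.
Proof. by move=> c1 MC a b; rewrite mxE; apply: bnd_shift. Qed.
Lemma mbnd_sum n (F : 'I_n -> 'MS) C : 0 <= C -> (forall k, mbnd (F k) C) ->
  mbnd (\sum_k F k) C.
Proof. by move=> C0 H a b; rewrite summxE; apply: (bnd_sum na) => // k _; exact: H. Qed.

Definition mx_bounded (B : 'M[K]_mu.+1) C := forall a b, abs (B a b) <= C.

Lemma mx_bounded_exists B : exists2 C, 0 <= C & mx_bounded B C.
Proof.
have [C BC] := mbnd_cmx B; exists C; first exact: mbnd_ge0 BC.
by move=> a b; have := BC a b 0%N; rewrite mxE /= coefC.
Qed.

Lemma mx_boundedM B B' C D : 0 <= C -> 0 <= D -> mx_bounded B C -> mx_bounded B' D ->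
  mx_bounded (B *m B') (C * D).
Proof.
move=> C0 D0 BC BD a b; rewrite mxE; apply: (abs_sum_le na) => [|k _]; first exact: mulr_ge0.
by rewrite (absM na) ler_pM ?(abs_ge0 na).
Qed.

(** Convergence to 0 of each coefficient, without uniformity in its index; bounds on all
    coefficients still pass to the limit, by [mbnd_cf_limit]. *)
Definition cf_cvg0 (S : nat -> 'MS) := forall i e, 0 < e ->
  exists k0, forall n, (k0 <= n)%N -> mx_bounded (cf (S n) i) e.

Lemma cf_cvg0M (S : nat -> 'MS) M : cf_cvg0 S -> cf_cvg0 (fun n => S n *m M).
Proof.
move=> H i e e0.
have /choice[C CP] : forall j : nat, exists C, 0 <= C /\ mx_bounded (cf M j) C.
  by move=> j; have [C C0 CP] := mx_bounded_exists (cf M j); exists C.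
pose D := 1 + \sum_(j < i.+1) C j.
have D0 : 0 < D by rewrite ltr_wpDr// sumr_ge0// => j _; case: (CP j).
have CD (j : 'I_i.+1) : C j <= D.
  rewrite /D (bigD1 j)//= addrCA lerDl addr_ge0// sumr_ge0// => k _; by case: (CP k).
have /choice[N NP] : forall j : nat, exists k0, forall n, (k0 <= n)%N -> mx_bounded (cf (S n) j) (e / D).
  by move=> j; apply: H; rewrite divr_gt0.
exists (\max_(j < i.+1) N j) => n /bigmax_leqP Nn a b; rewrite cfM summxE.
apply: (abs_sum_le na) => [|j _]; first exact: ltW.
have := mx_boundedM (_ : 0 <= e / D) (_ : 0 <= D) (NP j n (Nn j isT)) (_ : mx_bounded (cf M (i - j)) D) a b.
rewrite divfK ?gt_eqF//; apply; rewrite ?divr_ge0 ?(ltW e0) ?(ltW D0)//.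
move=> a' b'; have [_ /(_ a' b')] := CP (i - j)%N; move/le_trans; apply.
have lt : (i - j < i.+1)%N by rewrite ltnS leq_subr.
exact: (CD (Ordinal lt)).
Qed.

Lemma mbnd_cf_limit (S : nat -> 'MS) (T : 'MS) C (N : nat) :
  cf_cvg0 (fun n => T - S n) -> 0 <= C -> (forall n, (N <= n)%N -> mbnd (S n) C) -> mbnd T C.
Proof.
move=> H C0 SC; apply/mbnd_cf => i a b; rewrite leNgt; apply/negP => lt.
have t0 : 0 < abs (cf T i a b) / 2 by rewrite divr_gt0// (le_lt_trans C0).
have [N0 /(_ _ (leq_maxl N0 N)) /(_ a b)] := H i _ t0.
have := (mbnd_cf _ _).1 (SC _ (leq_maxr N0 N)) i a b.
rewrite cfB !mxE; set u := fcoef (T a b) i; set v := fcoef _ i => vC uv.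
rewrite cfE -/u in lt uv.
have : abs u <= Num.max (abs u / 2) C.
  rewrite -[u in leLHS](subrK v); apply: (absD_le na).
    by apply: le_trans uv _; rewrite le_max lexx.
  by apply: le_trans vC _; rewrite le_max lexx orbT.
rewrite le_max => /orP[]; last by rewrite leNgt lt.
by rewrite leNgt => /negP; apply; have := le_lt_trans C0 lt; lra.
Qed.
End BoundedMatrices.

(** * Newton polynomials at a matrix with eigenvalues near 1 *)

Section SmallEigenvalues.
Variables (R : realType) (p : nat) (K : closedFieldType) (abs : K -> R) (pi : K).
Hypotheses (p_prime : prime p) (na : nonarch_abs abs).
Hypothesis abs_p : abs p%:R = p%:R^-1.
Hypothesis piE : pi ^+ p.-1 = - p%:R.
Variables (mu : nat) (A0 : 'M[K]_mu.+1) (Q : K).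
Hypothesis Q_near1 : abs (Q - 1) < abs pi.
Hypothesis Q_neq1 : Q != 1.

(** In the Newton basis at the eigenvalues of A0, Cayley-Hamilton annihilates all but finitely many
    basis matrices. A matrix that is not diagonalizable thus behaves like its eigenvalues, up to the
    constant C. *)
Lemma prod_sub_bounded (s : R) : 0 < s ->
  (forall a, eigenvalue A0 a -> abs (a - 1) <= s) ->
  exists2 C, 0 <= C & forall ws : seq K, (forall z, z \in ws -> abs (z - 1) <= s) ->
    mx_bounded abs (horner_mx A0 (\prod_(z <- ws) ('X - z%:P))) (C * s ^+ size ws).
Proof.
move=> s0 As; have [r cE] := closed_field_poly_normal (char_poly A0).
rewrite (monicP (char_poly_monic A0)) scale1r in cE.
pose w k := nth 1 r k; pose b k := horner_mx A0 (\prod_(i < k) ('X - (w i)%:P)).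
have ww k : abs (w k - 1) <= s.
  rewrite /w; have [kr|kr] := ltnP k (size r); last first.
    by rewrite nth_default// subrr (abs0 na) ltW.
  by apply: As; rewrite eigenvalue_root_char cE root_prod_XsubC mem_nth.
have b0 k : (size r <= k)%N -> b k = 0.
  move=> rk; rewrite /b -(subnKC rk) big_split_ord /= rmorphM /=.
  have -> : \prod_(i < size r) ('X - (w i)%:P) = char_poly A0.
    by rewrite cE (big_nth 1) big_mkord.
  by rewrite Cayley_Hamilton mul0r.
have /choice[c cP] : forall k, exists c, 0 <= c /\ mx_bounded abs (b k) c.
  by move=> k; have [c c0 cP] := mx_bounded_exists na (b k); exists c.
have cs k : 0 <= c k / s ^+ k by rewrite divr_ge0 ?exprn_ge0 ?(ltW s0)//; case: (cP k).
pose C := \sum_(k < size r) c k / s ^+ k.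
have C0 : 0 <= C by apply: sumr_ge0 => k _; exact: cs.
exists C => // ws wss; have [d [d0 db ->]] := newton_nodes na s0 ww wss.
move=> a a'; rewrite rmorph_sum summxE; apply: (abs_sum_le na) => [|k _].
  by rewrite mulr_ge0// exprn_ge0// ltW.
rewrite /= horner_mxZ mxE (absM na) -/(b k).
have [kr|kr] := ltnP k (size r); last first.
  by rewrite b0// mxE (abs0 na) mulr0 mulr_ge0// exprn_ge0// ltW.
have [ck /(_ a a') bk] := cP k.
have sk : 0 < s ^+ k by rewrite exprn_gt0.
apply: le_trans (_ : abs (d k) * c k <= _); first by rewrite ler_wpM2l ?(abs_ge0 na).
apply: le_trans (_ : s ^+ size ws / s ^+ k * c k <= _).
  by rewrite ler_wpM2r// ler_pdivlMr.
rewrite mulrAC -mulrA mulrC ler_wpM2r ?exprn_ge0 ?(ltW s0)//.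
by rewrite /C (bigD1 (Ordinal kr))//= lerDl sumr_ge0.
Qed.

Lemma abs_qconst n : abs Q = 1 -> abs (qconst Q n) = abs (n`!)%:R * abs (Q - 1) ^+ n.
Proof.
move=> Q1; elim: n => [|n IH]; first by rewrite /qconst big_ord0 (abs1 na) mul1r.
rewrite /qconst big_ord_recr /= -/(qconst Q n) (absM na) IH !(absM na) (absX na) Q1 expr1n.
rewrite mul1r (abs_pow_sub1 p_prime na abs_p piE)// factS natrM (absM na) exprS; ring.
Qed.

Lemma qbin_small_eigen (s : R) : abs Q = 1 ->
  abs (Q - 1) <= s -> s < p%:R * abs (Q - 1) ->
  (forall a, eigenvalue A0 a -> abs (a - 1) <= s) ->
  exists C theta, [/\ 0 <= C, 0 <= theta, theta < 1 & forall j,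
    mx_bounded abs (horner_mx A0 (qbin Q j)) (C * theta ^+ j / abs pi ^+ (p * j))].
Proof.
move=> Q1 Qs sp As; have Qm : 0 < abs (Q - 1) by rewrite (abs_gt0 na) subr_eq0.
have s0 := lt_le_trans Qm Qs.
have pR := p_natr_gt0 R p_prime; have pi0 := abs_pi_gt0 p_prime na abs_p piE.
have [C C0 CP] := prod_sub_bounded s0 As.
(* The numerator is at most C s^j, the denominator at least |pi|^j |Q - 1|^j because |j!| >= |pi|^j,
   and |pi|^(p j) = |pi|^j / p^j. *)
exists C, (s / (p%:R * abs (Q - 1))); split=> //.
  by rewrite divr_ge0 ?(ltW s0)// mulr_ge0 ?(ltW pR) ?(ltW Qm).
  by rewrite ltr_pdivrMr ?mul1r// mulr_gt0.
move=> j a b; rewrite /qbin horner_mxZ mxE (absM na) (absV na).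
have := CP [seq Q ^+ i | i <- index_iota 0 j]; rewrite size_map size_iota subn0.
rewrite big_map big_mkord => /(_ _ a b) H.
have {H} H : abs (horner_mx A0 (qpoch Q j) a b) <= C * s ^+ j.
  apply: H => z /mapP[i _ ->]; apply: le_trans Qs.
  rewrite (abs_pow_sub1 p_prime na abs_p piE)//.
  by rewrite ler_piMl ?(abs_ge0 na) ?(abs_nat_le1 na).
have fg : 0 < abs (j`!)%:R.
  by apply: lt_le_trans (abs_fact_ge p_prime na abs_p piE j); rewrite exprn_gt0.
have Qj : 0 < abs (Q - 1) ^+ j by rewrite exprn_gt0.
rewrite abs_qconst//; apply: le_trans (_ : (abs pi ^+ j * abs (Q - 1) ^+ j)^-1 * (C * s ^+ j) <= _).
  apply: ler_pM; rewrite ?invr_ge0 ?mulr_ge0 ?(ltW fg) ?(ltW Qj) ?(abs_ge0 na)//.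
  rewrite lef_pV2 ?posrE ?mulr_gt0// ?exprn_gt0//.
  by rewrite ler_pM2r// (abs_fact_ge p_prime na abs_p piE).
have -> : abs pi ^+ (p * j) = p%:R^-1 ^+ j * abs pi ^+ j.
  rewrite -(abs_pi_exp na abs_p piE) -exprMn -exprSr prednK ?prime_gt0// exprM//.
rewrite le_eqVlt; apply/orP; left; apply/eqP.
rewrite expr_div_n exprMn exprVn.
have := gt_eqF Qj; move: (abs (Q - 1) ^+ j) => x x0.
have pj : p%:R ^+ j != 0 :> R by rewrite expf_neq0// gt_eqF.
have pij : abs pi ^+ j != 0 by rewrite expf_neq0// gt_eqF.
move: (p%:R ^+ j) pj => y y0; move: (abs pi ^+ j) pij => z z0; field.
by rewrite x0 y0 z0.
Qed.
End SmallEigenvalues.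

(** * Averaging over the roots of unity *)

Section FrobeniusAverage.
Variables (R : realType) (p : nat) (K : closedFieldType) (abs : K -> R).
Hypotheses (p_prime : prime p) (K_char0 : [pchar K] =i pred0).
Hypotheses (na : nonarch_abs abs) (complete : abs_complete abs).
Hypothesis abs_p : abs p%:R = p%:R^-1.
Variables (q : K) (m : nat) (w : K) (rho : R).
Hypothesis q_not_root1 : forall n, (0 < n)%N -> q ^+ n != 1.
Hypotheses (abs_q : abs q = 1) (rho_gt0 : 0 < rho) (rho_le1 : rho <= 1).
Hypothesis q_rho : abs (q - 1) <= rho.
Hypotheses (m_gt0 : (0 < m)%N) (wP : m.-primitive_root w).
Hypothesis unity_rho : forall z, z ^+ m = 1 -> abs (z - 1) <= rho.
Variables (mu : nat) (A0 : 'M[K]_mu.+1) (A Y : 'M[fps K]_mu.+1).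
Hypothesis Y_unit : Y \in unitmx.
Hypothesis YE : shiftmx q Y *m cmx A0 = A *m Y.
Local Notation Q := (q ^+ m).
Variables (CA theta : R).
Hypotheses (CA_ge0 : 0 <= CA) (theta_ge0 : 0 <= theta) (theta_lt1 : theta < 1).
Hypothesis qbinA0 : forall j,
  mx_bounded abs (horner_mx A0 (qbin Q j)) (CA * theta ^+ j / rho ^+ (j * m)).
Local Notation op := (op q A0 Y).
Local Notation mbnd := (mbnd abs).
Implicit Types (T Z : 'M[fps K]_mu.+1) (e C D : R).

Let q_neq0 : q != 0. Proof. by rewrite -(abs_gt0 na) abs_q ltr01. Qed.

Lemma abs_unity_root z : z ^+ m = 1 -> abs z = 1.
Proof. by move=> zm; exact: (abs_unity na m_gt0 zm). Qed.

Let w_pow k : (w ^+ k) ^+ m = 1.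
Proof. by rewrite exprAC (prim_expr_order wP) expr1n. Qed.
Let abs_w : abs w = 1.
Proof. by have := abs_unity_root (w_pow 1); rewrite expr1. Qed.
Let w_rho k : abs (w ^+ k - 1) <= rho. Proof. exact: unity_rho. Qed.
Let cbound i j n := ncoef_pow_bound na q_neq0 q_not_root1 abs_q rho_gt0 rho_le1 q_rho
  m_gt0 wP abs_w w_rho i j n.

(** * Series of operators attached to a linear functional on polynomials *)

Section Functional.
Variables (lam : {poly K} -> K) (D : R) (J : nat).
Hypothesis lam_linear : forall c P P', lam (c *: P + P') = c * lam P + lam P'.
Hypothesis D_ge0 : 0 <= D.
Hypothesis lam_bound : forall n, abs (lam (qpoch q n)) <= D * rho ^+ n.
Hypothesis lam_eq0 : forall i j, (J <= j)%N -> lam ('X^i * (qpoch Q j \Po 'X^m)) = 0.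

Lemma lam_sum n (c : 'I_n -> K) (F : 'I_n -> {poly K}) :
  lam (\sum_i c i *: F i) = \sum_i c i * lam (F i).
Proof.
elim/big_rec2: _ => [|i y1 y2 _ <-]; last exact: lam_linear.
by have := lam_linear (- 1) 0 0; rewrite scaler0 addr0 mulN1r addNr.
Qed.

(** Re-expansion with [qbin_pow] turns the partial sum into a combination of the matrices qbin_j(A0)
    of ratio Q. Its coefficient of index j is [lam] of a truncated Newton expansion of X^i
    qpoch_j(X^m), hence exact once M exceeds the degree i + j m. For the other j, the errors are at
    most D rho^(j m) and meet matrices of size CA theta^j / rho^(j m). *)
Lemma newton_functional_cvg i e : 0 < e -> exists N, forall M, (N <= M)%N ->
  mx_bounded abs (\sum_(n < M) lam (qpoch q n) *: horner_mx (q ^+ i *: A0) (qbin q n) -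
    \sum_(j < J) lam ('X^i * (qpoch Q j \Po 'X^m)) *: horner_mx A0 (qbin Q j)) e.
Proof.
move=> e0; have [N0 HN0] := geometric_small (D * CA) theta_ge0 theta_lt1 e0.
exists (maxn J (i + N0 * m).+1) => M; rewrite geq_max => /andP[JM NM] a b.
pose P j := 'X^i * (qpoch Q j \Po 'X^m).
have sP j : (size (P j) <= (i + j * m).+1)%N.
  rewrite /P; apply: leq_trans (size_polyMleq _ _) _; rewrite size_polyXn.
  rewrite addSn /= -addnS leq_add2l.
  have -> : qpoch Q j \Po 'X^m = node_poly q m w (j * m) by rewrite node_poly_mul.
  by rewrite /node_poly size_prod_XsubC /index_enum -enumT size_enum_ord.
pose S j := \sum_(n < M) lam (qpoch q n) * ncoef q n (P j).
have lamP j N : ((i + j * m).+1 <= N)%N ->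
    lam (P j) = \sum_(n < N) lam (qpoch q n) * ncoef q n (P j).
  move=> le; rewrite {1}(newton_expand q_neq0 q_not_root1 (leq_trans (sP j) le)) lam_sum.
  by apply: eq_bigr => n _; rewrite mulrC.
have E1 : \sum_(n < M) lam (qpoch q n) *: horner_mx (q ^+ i *: A0) (qbin q n) =
    \sum_(j < M) S j *: horner_mx A0 (qbin Q j).
  transitivity (\sum_(n < M) \sum_(j < M) (lam (qpoch q n) * ncoef q n (P j)) *: horner_mx A0 (qbin Q j)).
    apply: eq_bigr => n _; rewrite -horner_mx_comp_scale.
    rewrite (qbin_pow q_neq0 q_not_root1 m_gt0 i (ltn_ord n)) rmorph_sum scaler_sumr.
    apply: eq_bigr => j _; rewrite /= (horner_mxZ A0 (ncoef q n (P j)) (qbin Q j)).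
    by rewrite scalerA.
  by rewrite exchange_big; apply: eq_bigr => j _; rewrite -scaler_suml.
have E2 : \sum_(j < J) lam (P j) *: horner_mx A0 (qbin Q j) =
    \sum_(j < M) lam (P j) *: horner_mx A0 (qbin Q j).
  rewrite (big_ord_widen M (fun j => lam (P j) *: horner_mx A0 (qbin Q j)) JM) big_mkcond.
  by apply: eq_bigr => j _; case: ltnP => // Jj; rewrite lam_eq0// scale0r.
rewrite E1 E2 -sumrB summxE; apply: (abs_sum_le na) => [|j _]; first exact: ltW.
rewrite -scalerBl mxE (absM na).
have [le|lt] := leqP (i + j * m).+1 M.
  by rewrite (lamP j M le) subrr (abs0 na) mul0r ltW.
have Sb N : abs (\sum_(n < N) lam (qpoch q n) * ncoef q n (P j)) <= D * rho ^+ (j * m).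
  apply: (abs_sum_le na) => [|n _]; first by rewrite mulr_ge0// exprn_ge0// ltW.
  have [_ cb] := cbound i j n; rewrite (absM na).
  apply: le_trans (_ : D * rho ^+ n * abs (ncoef q n (P j)) <= _).
    by rewrite ler_wpM2r ?(abs_ge0 na).
  by rewrite -mulrA ler_wpM2l// mulrC.
have Sl : abs (S j - lam (P j)) <= D * rho ^+ (j * m).
  by apply: (absB_le na); [exact: Sb|rewrite (lamP j _ (leqnn _))].
have N0j : (N0 <= j)%N.
  rewrite leqNgt; apply/negP => jN; move: lt; rewrite ltnNge => /negP; apply.
  by apply: leq_trans NM; rewrite ltnS leq_add2l leq_mul2r (ltnW jN) orbT.
apply: le_trans (ltW (HN0 j N0j)).
have rj : 0 < rho ^+ (j * m) by rewrite exprn_gt0.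
apply: le_trans (_ : D * rho ^+ (j * m) * (CA * theta ^+ j / rho ^+ (j * m)) <= _).
  by rewrite ler_pM ?(abs_ge0 na)// qbinA0.
rewrite le_eqVlt; apply/orP; left; apply/eqP.
by field; rewrite gt_eqF.
Qed.

Variable T : 'M[fps K]_mu.+1.
Hypothesis TE : forall i, cf (T *m Y) i =
  cf Y i *m \sum_(j < J) lam ('X^i * (qpoch Q j \Po 'X^m)) *: horner_mx A0 (qbin Q j).

Definition lam_partial M := \sum_(n < M) fps_const (lam (qpoch q n)) *: op Y (qbin q n).

Lemma lam_partial_cvg : cf_cvg0 abs (fun M => T - lam_partial M).
Proof.
have H : cf_cvg0 abs (fun M => (T - lam_partial M) *m Y).
  move=> i e e0; have [C C0 CP] := mx_bounded_exists na (cf Y i).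
  have C1 : 0 < C + 1 by rewrite ltr_wpDl.
  have [N HN] := newton_functional_cvg i (divr_gt0 e0 C1); exists N => M /HN H.
  have -> : cf ((T - lam_partial M) *m Y) i = - (cf Y i *m
     (\sum_(n < M) lam (qpoch q n) *: horner_mx (q ^+ i *: A0) (qbin q n) -
    \sum_(j < J) lam ('X^i * (qpoch Q j \Po 'X^m)) *: horner_mx A0 (qbin Q j))).
    rewrite mulmxBl cfB TE mulmxBr opprB; congr (_ - _).
    rewrite mulmx_suml cf_sum mulmx_sumr; apply: eq_bigr => n _.
    by rewrite -scalemxAl cf_scale mulmxKV// cf_mk scalemxAr.
  move=> a b; rewrite mxE (absN na).
  apply: le_trans (mx_boundedM na C0 _ CP H a b) _; first by rewrite divr_ge0 ?ltW.
  by rewrite mulrA mulrAC ger_pMl// ler_pdivrMr// mul1r lerDl.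
have := cf_cvg0M na (invmx Y) H; move=> G i e e0; have [N HN] := G i e e0.
by exists N => M /HN; rewrite mulmxK.
Qed.

Lemma lam_limit_bnd C : 0 <= C ->
  (forall n, mbnd (fps_const (lam (qpoch q n)) *: op Y (qbin q n)) C) -> mbnd T C.
Proof.
move=> C0 H; apply: (mbnd_cf_limit na (N := 0) lam_partial_cvg C0) => M _.
exact: mbnd_sum.
Qed.

(** The geometric bound makes the tails uniformly small, so T, known only as a coefficientwise
    limit, is a uniform limit of the partial sums, which are analytic elements. *)
Lemma lam_limit_E0 C r : 0 <= C -> 0 <= r -> r < 1 ->
  (forall n a b, E0 abs (op Y (qbin q n) a b)) ->
  (forall n, mbnd (fps_const (lam (qpoch q n)) *: op Y (qbin q n)) (C * r ^+ n)) ->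
  forall a b, E0 abs (T a b).
Proof.
move=> C0 r0 r1 GE0 H a b; apply: (E0_limit p_prime K_char0 na complete abs_p) => e e0.
have [N HN] := geometric_small C r0 r1 e0.
exists (lam_partial N a b).
  rewrite summxE; apply: (E0_sum p_prime K_char0 na complete abs_p) => n _; rewrite mxE.
  exact: (E0CM p_prime K_char0 na complete abs_p).
have cv : cf_cvg0 abs (fun M => (T - lam_partial N) - (lam_partial M - lam_partial N)).
  move=> i e' e'0; have [N' HN'] := lam_partial_cvg i e'0; exists N' => M /HN'.
  by rewrite opprB addrA subrK.
have := mbnd_cf_limit na (N := N) cv (ltW e0) _ => /(_ _ a b).
rewrite !mxE; apply => M NM; rewrite /lam_partial.
rewrite -(subnKC NM) big_split_ord /= addrAC subrr add0r.
apply: (mbnd_sum na) => [|k]; first exact: ltW.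
by apply: mbndW (H _); apply/ltW/HN; rewrite leq_addr.
Qed.
End Functional.

Variables (s CG : R).
Hypotheses (rho_s : rho < s) (CG_ge0 : 0 <= CG).
Hypothesis G_growth : forall n, mbnd (op Y (qbin q n)) (CG / s ^+ n).

Let s_gt0 : 0 < s. Proof. exact: lt_trans rho_s. Qed.

(** The functional is evaluation at z. It is at most rho^n on [qpoch q n], whose roots lie within
    rho of z, and since z^m = 1 it kills X^i qpoch_j(X^m) for j > 0. What remains is z^i, which
    multiplies the coefficient of index i in Y(z x). *)
Lemma unity_shift_bnd z : z ^+ m = 1 -> mbnd (shiftmx z Y *m invmx Y) CG.
Proof.
move=> z1; pose lam (P : {poly K}) := P.[z].
have ll c P P' : lam (c *: P + P') = c * lam P + lam P' by rewrite /lam !hornerE.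
have lb n : abs (lam (qpoch q n)) <= 1 * rho ^+ n.
  rewrite /lam mul1r horner_prod (abs_prod na) -[n in rho ^+ n]card_ord -prodr_const.
  apply: ler_prod => i _; rewrite (abs_ge0 na) !hornerE /=.
  have -> : z - q ^+ i = (z - 1) - (q ^+ i - 1) by ring.
  by apply: (absB_le na); [exact: unity_rho|exact: abs_qpow_sub1].
have lE i j : lam ('X^i * (qpoch Q j \Po 'X^m)) = if j == 0%N then z ^+ i else 0.
  rewrite /lam hornerM horner_comp !hornerXn z1; case: j => [|j].
    by rewrite qpoch0 hornerC mulr1.
  by rewrite -[1](expr0 Q) qpoch_root// mulr0.
have l0 i j : (1 <= j)%N -> lam ('X^i * (qpoch Q j \Po 'X^m)) = 0.
  by rewrite lE; case: j.
apply: (@lam_limit_bnd lam 1 1 ll ler01 lb l0 _ _ CG) => // [i|n].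
  rewrite mulmxKV// cf_shift big_ord1 lE eqxx qbin0 rmorph1 -scalemxAr mulmx1 //.
apply: mbndW (mbndCZ na _ (G_growth n)).
have rs : (rho / s) ^+ n <= 1.
  rewrite exprn_ile1 ?divr_ge0 ?(ltW rho_gt0) ?(ltW s_gt0)//.
  by rewrite ler_pdivrMr// mul1r ltW.
apply: le_trans (_ : rho ^+ n * (CG / s ^+ n) <= _).
  by rewrite ler_wpM2r ?divr_ge0 ?exprn_ge0 ?(ltW s_gt0)//; have := lb n; rewrite mul1r.
by rewrite mulrCA -expr_div_n ler_piMr.
Qed.

(* The average of Y(z x) over the m-th roots of unity z. Its image under
   qbin Q j is the sum over n of the images of Y under lamj j (qpoch q n) *: qbin q n. *)
Definition Ybar : 'M[fps K]_mu.+1 := mkmx (fun i => if (m %| i)%N then cf Y i else 0).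

(** The factor (rho / s)^(n - j m) makes the expansion of the average converge uniformly; the rest
    is the growth in j. Terms with n < j m vanish, which is where the truncated subtraction would
    give no decay. *)
Lemma Ybar_term j n :
  mbnd (fps_const (lamj q m w j (qpoch q n)) *: op Y (qbin q n))
    (CG / rho ^+ m / s ^+ (j * m) * (rho / s) ^+ (n - j * m)).
Proof.
have [lb l0] := lamj_bound na q_neq0 q_not_root1 abs_q rho_gt0 rho_le1 q_rho m_gt0 wP abs_w w_rho j n.
have rs0 : 0 <= rho / s by rewrite divr_ge0 ?(ltW rho_gt0) ?(ltW s_gt0).
have [nj|jn] := ltnP n (j * m).
  rewrite l0// rmorph0 scale0r => a b; rewrite mxE; apply: (bnd0 na).
  by rewrite mulr_ge0 ?exprn_ge0// !divr_ge0 ?exprn_ge0 ?(ltW rho_gt0) ?(ltW s_gt0).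
apply: mbndW (mbndCZ na _ (G_growth n)).
have rj : 0 < rho ^+ (j.+1 * m) by rewrite exprn_gt0.
rewrite -ler_pdivlMr// in lb.
apply: le_trans (_ : rho ^+ n / rho ^+ (j.+1 * m) * (CG / s ^+ n) <= _).
  by rewrite ler_wpM2r// divr_ge0// exprn_ge0// ltW.
rewrite le_eqVlt; apply/orP; left; apply/eqP.
rewrite expr_div_n mulSn exprD.
have -> : rho ^+ n = rho ^+ (j * m) * rho ^+ (n - j * m) by rewrite -exprD subnKC.
have -> : s ^+ n = s ^+ (j * m) * s ^+ (n - j * m) by rewrite -exprD subnKC.
have H x k : 0 < x -> x ^+ k != 0 :> R by move=> x0; rewrite expf_neq0// gt_eqF.
by field; rewrite !H.
Qed.

Lemma Ybar_limitE j i : cf (op Ybar (qbin Q j) *m Y) i =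
  cf Y i *m \sum_(j' < j.+1) lamj q m w j ('X^i * (qpoch Q j' \Po 'X^m)) *: horner_mx A0 (qbin Q j').
Proof.
rewrite mulmxKV// cf_mk cf_mk.
have -> : \sum_(j' < j.+1) lamj q m w j ('X^i * (qpoch Q j' \Po 'X^m)) *: horner_mx A0 (qbin Q j') =
    horner_mx A0 (\sum_(j' < j.+1) lamj q m w j ('X^i * (qpoch Q j' \Po 'X^m)) *: qbin Q j').
  by rewrite rmorph_sum; apply: eq_bigr => j' _; rewrite /= (horner_mxZ A0 _ (qbin Q j')).
rewrite (lamj_sum_qbin q_neq0 q_not_root1 m_gt0 wP i (ltnSn j)).
by case: ifP => _; rewrite ?horner_mx_comp_scale// mul0mx rmorph0 mulmx0.
Qed.

Lemma lamj_vanish j i j' : (j.+1 <= j')%N -> lamj q m w j ('X^i * (qpoch Q j' \Po 'X^m)) = 0.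
Proof.
move=> jj; rewrite lamj_XnM//; case: ifP => // _; rewrite big1// => k _.
by rewrite qpoch_root ?mulr0// (leq_trans (ltn_ord k)).
Qed.

Let lamjb j n : abs (lamj q m w j (qpoch q n)) <= (rho ^+ (j.+1 * m))^-1 * rho ^+ n.
Proof.
have [lb _] := lamj_bound na q_neq0 q_not_root1 abs_q rho_gt0 rho_le1 q_rho m_gt0 wP abs_w w_rho j n.
by rewrite mulrC ler_pdivlMr// exprn_gt0.
Qed.
Let D0 j : 0 <= (rho ^+ (j.+1 * m))^-1.
Proof. by rewrite invr_ge0 exprn_ge0// ltW. Qed.

Lemma op_Ybar_growth j : mbnd (op Ybar (qbin Q j)) (CG / rho ^+ m / s ^+ (j * m)).
Proof.
apply: (lam_limit_bnd (lamj_linear q m w j) (D0 j) (lamjb j) (@lamj_vanish j) (Ybar_limitE j)).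
  by rewrite !divr_ge0 ?exprn_ge0 ?(ltW rho_gt0) ?(ltW s_gt0).
move=> n; apply: mbndW (Ybar_term j n); rewrite ler_piMr//.
  by rewrite !divr_ge0 ?exprn_ge0 ?(ltW rho_gt0) ?(ltW s_gt0).
rewrite exprn_ile1 ?divr_ge0 ?(ltW rho_gt0) ?(ltW s_gt0)//.
by rewrite ler_pdivrMr// mul1r ltW.
Qed.

Lemma op_Ybar_E0 : (forall n a b, E0 abs (op Y (qbin q n) a b)) ->
  forall a b, E0 abs (op Ybar 1 a b).
Proof.
move=> GE0; have rs0 : 0 <= rho / s by rewrite divr_ge0 ?(ltW rho_gt0) ?(ltW s_gt0).
have rs1 : rho / s < 1 by rewrite ltr_pdivrMr// mul1r.
have := lam_limit_E0 (lamj_linear q m w 0) (D0 0) (lamjb 0) (@lamj_vanish 0) (Ybar_limitE 0) _ rs0 rs1 GE0.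
rewrite qbin0 => H; apply: (H (CG / rho ^+ m)).
  by rewrite !divr_ge0 ?exprn_ge0 ?(ltW rho_gt0).
by move=> n; have := Ybar_term 0 n; rewrite mul0n subn0 expr0 divr1.
Qed.
End FrobeniusAverage.
(** Sylvester's determinant identity in rank one, by multiplying one block matrix on either side by
    the same unipotent matrix. *)
Lemma det_sub1_mulmxC (U : comPzRingType) n (u : 'cV[U]_n) (v : 'rV[U]_n) :
  \det (1%:M - u *m v) = 1 - (v *m u) 0 0.
Proof.
pose M : 'M[U]_(1 + n) := block_mx 1%:M v u 1%:M.
pose N : 'M[U]_(1 + n) := block_mx 1%:M 0 (- u) 1%:M.
have dN : \det N = 1 by rewrite det_lblock !det1 mulr1.
have e1 : \det (N *m M) = \det (1%:M - u *m v).
  rewrite mulmx_block !mul1mx !mul0mx !addr0 mulmx1 addNr det_ublock det1 mul1r.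
  by rewrite mulNmx addrC.
have e2 : \det (M *m N) = 1 - (v *m u) 0 0.
  rewrite mulmx_block !mulmx1 !mul1mx !mulmx0 !add0r mulmxN subrr det_ublock det1 mulr1.
  by rewrite det_mx11 !mxE.
by rewrite -e1 -e2 !det_mulmx mulrC.
Qed.

(** * Matrices of analytic elements *)

Section AnalyticMatrices.
Variables (R : realType) (p : nat) (K : closedFieldType) (abs : K -> R).
Hypotheses (p_prime : prime p) (K_char0 : [pchar K] =i pred0).
Hypotheses (na : nonarch_abs abs) (complete : abs_complete abs).
Hypothesis abs_p : abs p%:R = p%:R^-1.
Implicit Types (x z c : K) (f g : fps K) (C D e : R).
Local Notation E0 := (E0 abs).
Local Notation ev := (ev abs).
Local Notation E0M := (E0M p_prime K_char0 na complete abs_p).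
Local Notation E0_sum := (E0_sum p_prime K_char0 na complete abs_p).
Local Notation E0_prod := (E0_prod p_prime K_char0 na complete abs_p).
Local Notation E0_poly := (E0_poly p_prime K_char0 na complete abs_p).
Local Notation E0_bnd := (E0_bnd p_prime K_char0 na complete abs_p).
Local Notation E0_divide := (E0_divide p_prime K_char0 na complete abs_p).

Definition mxE0 n m (M : 'M[fps K]_(n, m)) := forall a b, E0 (M a b).

Lemma mxE0M n m k (M : 'M[fps K]_(n, m)) (N : 'M[fps K]_(m, k)) :
  mxE0 M -> mxE0 N -> mxE0 (M *m N).
Proof. by move=> HM HN a b; rewrite mxE; apply: E0_sum => i _; apply: E0M. Qed.

Lemma mxE0_cmx n m (B : 'M[K]_(n, m)) : mxE0 (map_mx (@fps_const K) B).
Proof. by move=> a b; rewrite mxE; apply: E0_poly. Qed.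

Lemma fps_signE (s : nat) : (-1) ^+ s = fps_of_poly ((-1) ^+ s)%:P :> fps K.
Proof. by rewrite !rmorphXn !rmorphN !rmorph1. Qed.

Lemma E0_det n (M : 'M[fps K]_n) : mxE0 M -> E0 (\det M).
Proof.
move=> HM; apply: E0_sum => s _; apply: E0M; last exact: E0_prod.
by rewrite fps_signE; apply: E0_poly.
Qed.

Lemma E0_cofactor n (M : 'M[fps K]_n) a b : mxE0 M -> E0 (cofactor M a b).
Proof.
move=> HM; apply: E0M; first by rewrite fps_signE; apply: E0_poly.
by apply: E0_det => i j; rewrite !mxE.
Qed.

Lemma mxE0_inv n (M : 'M[fps K]_n) : mxE0 M -> dom abs (\det M) 0 -> mxE0 (invmx M).
Proof.
move=> HM d0 a b; have u : M \in unitmx by rewrite unitmxE (dom0_unit d0).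
rewrite /invmx u !mxE; apply: E0M; last exact: E0_cofactor.
exact: (E0V p_prime K_char0 na complete abs_p (E0_det HM)).
Qed.

Lemma ev_det n (M : 'M[fps K]_n) x : mxE0 M -> abs x < 1 ->
  ev (\det M) x = \det (map_mx (ev^~ x) M).
Proof.
move=> HM x1.
have /choice[C CP] : forall ab : 'I_n * 'I_n, exists C, bnd abs (M ab.1 ab.2) C.
  by move=> ab; apply: E0_bnd.
have C0 ab : 0 <= C ab by exact: (bnd_ge0 na (CP ab)).
have MC a b : bnd abs (M a b) (\sum_ab C ab).
  apply: bndW (CP (a, b)); rewrite (bigD1 (a, b))//= lerDl.
  by apply: sumr_ge0.
have /choice[D DP] : forall s : 'S_n, exists D, bnd abs ((-1) ^+ s * \prod_i M i (s i)) D.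
  move=> s; apply: E0_bnd; apply: E0M; last exact: E0_prod.
  by rewrite fps_signE; apply: E0_poly.
have D0 s : 0 <= D s by exact: (bnd_ge0 na (DP s)).
rewrite /determinant (@ev_sum _ _ abs na complete _ _ _ (\sum_s D s))//; last first.
  move=> s; apply: bndW (DP s); rewrite (bigD1 s)//= lerDl.
  by apply: sumr_ge0.
apply: eq_bigr => s _.
have [D' D'P] := E0_bnd (E0_prod (index_enum _) (fun i (_ : predT i) => HM i (s i))).
have [D1 D1P] := E0_bnd (E0_poly ((-1) ^+ s)%:P).
rewrite -fps_signE in D1P; rewrite (evM na complete D1P D'P)// fps_signE ev_poly// hornerC.
congr (_ * _); rewrite (ev_prod na complete _ (fun i => MC i (s i)))//.
by apply: eq_bigr => i _; rewrite mxE.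
Qed.

Lemma E0_divide_prod f (r : seq K) : E0 f -> uniq r ->
  (forall z, z \in r -> abs z < 1 /\ ev f z = 0) ->
  exists2 g, E0 g & f = fps_of_poly (\prod_(z <- r) ('X - z%:P)) * g.
Proof.
elim: r f => [|z r IH] f Ef; first by exists f; rewrite ?big_nil ?rmorph1 ?mul1r.
rewrite cons_uniq => /andP[zr ur] H.
have [z1 fz] := H z (mem_head _ _).
have [g Eg fE] := E0_divide Ef z1 fz.
have [|h Eh gE] := IH g Eg ur.
  move=> y yr; have [y1] := H y (mem_behead (s := z :: r) yr); split=> //.
  have [C gC] := E0_bnd Eg; have [D dD] := E0_bnd (E0_poly ('X - z%:P)).
  move: b; rewrite fE (evM na complete dD gC y1) ev_poly// !hornerE => /eqP.
  rewrite mulf_eq0 subr_eq0 => /orP[/eqP yz|/eqP//].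
  by rewrite -yz yr in zr.
by exists h => //; rewrite fE gE big_cons rmorphM mulrA.
Qed.

(* Each coefficient of g is read off from (1 - c x^m) g and a later coefficient of
   g, with a gain of 1 / |c|; iterating makes the second contribution vanish. *)
Lemma bnd_div_large g c m C D : 1 < abs c ->
  bnd abs g C -> bnd abs ((1 - fps_const c * fps_of_poly 'X^m) * g) D ->
  bnd abs g (D / abs c).
Proof.
move=> c1 gC gD; have c0 : 0 < abs c by exact: lt_trans c1.
have D0 := bnd_ge0 na gD; have C0 := bnd_ge0 na gC.
have gE i : fcoef ((1 - fps_const c * fps_of_poly 'X^m) * g) (i + m) =
    fcoef g (i + m) - c * fcoef g i.
  rewrite mulrBl mul1r -mulrA fcoefB fcoefCM fcoefXnM ltnNge leq_addl /= addnK//.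
have step E : bnd abs g E -> bnd abs g (Num.max (D / abs c) (E / abs c)).
  move=> gE' i; have := gD (i + m)%N; rewrite gE => H.
  have {}H : abs (c * fcoef g i) <= Num.max D E.
    have -> : c * fcoef g i = fcoef g (i + m) - (fcoef g (i + m) - c * fcoef g i) by ring.
    by apply: (absB_le na); rewrite le_max ?H ?gE' ?orbT.
  rewrite (absM na) le_max in H; rewrite le_max !ler_pdivlMr// ![_ * abs c]mulrC.
  exact: H.
have ic : 0 <= (abs c)^-1 by rewrite invr_ge0 ltW.
have ic1 : (abs c)^-1 < 1 by rewrite invf_lt1.
have iter k : bnd abs g (Num.max (D / abs c) (C * (abs c)^-1 ^+ k)).
  elim: k => [|k IH]; first by apply: bndW gC; rewrite expr0 mulr1 le_max lexx orbT.
  apply: bndW (step _ IH); rewrite ge_max le_max lexx /=.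
  rewrite exprSr mulrA maxr_pMl// ge_max; apply/andP; split; rewrite le_max ?lexx ?orbT//.
  by rewrite ler_piMr ?divr_ge0// ltW.
move=> i; rewrite leNgt; apply/negP => lt.
have g0 : 0 < abs (fcoef g i) by apply: le_lt_trans lt; rewrite divr_ge0// ltW.
have [N /(_ N (leqnn _)) HN] := geometric_small C ic ic1 g0.
have := iter N i; rewrite le_max !leNgt lt HN => //.
Qed.

End AnalyticMatrices.

(** * Removal of the zeros of the gauge transformation *)

Section GaugeIdentities.
Variables (U : comNzRingType) (n : nat).
Implicit Types (N Z W : 'M[U]_n.+1) (c d x : U).

Lemma gauge_mulmx N Z W d :
  (Z + d *: (N *m Z)) *m W = Z *m W + d *: (N *m (Z *m W)).
Proof. by rewrite mulmxDl -scalemxAl mulmxA. Qed.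

Lemma gauge_factor (u : 'cV[U]_n.+1) (v : 'rV[U]_n.+1) Z W c x :
  (Z - c *: (x *: (u *m v *m Z))) *m W = (1%:M - ((c * x) *: u) *m v) *m (Z *m W).
Proof. by rewrite mulmxBl [in RHS]mulmxBl mul1mx -!scalemxAl scalerA !mulmxA. Qed.

Lemma gauge_entry Z W c x i j : (Z - c *: (x *: W)) i j = Z i j - c * (x * W i j).
Proof. by rewrite !mxE. Qed.

Lemma gauge_recurrence Z Z' W W' c d x i j :
  Z = Z' - c *: (x *: W) -> W = d *: Z' + W' ->
  (1 - c * d * x) * Z' i j = Z i j + c * (x * W' i j).
Proof. by move=> -> ->; rewrite !mxE; ring. Qed.

Lemma one_sub_mulA c x d : (1 - c * x) * d = d - c * (x * d).
Proof. by rewrite mulrBl mul1r mulrA. Qed.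

Lemma gauge_split N Z W d : N *m N = N -> N *m W = d *: (N *m Z) ->
  W = Z + (d - 1) *: (N *m Z) -> W = Z - N *m Z + N *m W.
Proof. by move=> NN -> ->; rewrite scalerBl scale1r addrAC addrA. Qed.

Lemma gauge_project N Z W c x : N *m N = N -> Z = W - c *: (x *: (N *m W)) ->
  N *m Z = N *m W - c *: (x *: (N *m W)).
Proof. by move=> NN ->; rewrite mulmxBr -!scalemxAr mulmxA NN. Qed.
End GaugeIdentities.

Lemma shiftmx_gauge (K : fieldType) n (z : K) (N Z : 'M[fps K]_n.+1) d :
  shiftmx z (Z + d *: (N *m Z)) =
  shiftmx z Z + fps_shift z d *: (shiftmx z N *m shiftmx z Z).
Proof. by rewrite /shiftmx map_mxD map_mxZ map_mxM. Qed.

Local Opaque op.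
Section ZeroRemoval.
Variables (R : realType) (p : nat) (K : closedFieldType) (abs : K -> R).
Hypotheses (p_prime : prime p) (K_char0 : [pchar K] =i pred0).
Hypotheses (na : nonarch_abs abs) (complete : abs_complete abs).
Hypothesis abs_p : abs p%:R = p%:R^-1.
Variables (q : K) (m : nat) (w : K).
Hypothesis q_not_root1 : forall n, (0 < n)%N -> q ^+ n != 1.
Hypotheses (abs_q : abs q = 1) (m_gt0 : (0 < m)%N) (wP : m.-primitive_root w).
Variables (mu : nat) (A0 : 'M[K]_mu.+1) (A Y : 'M[fps K]_mu.+1).
Hypotheses (Y_unit : Y \in unitmx) (Y0 : fps_mx0 Y = 1%:M).
Hypothesis YE : shiftmx q Y *m cmx A0 = A *m Y.
Hypothesis A_E0 : mxE0 abs A.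
Variable CG : R.
Hypothesis unity_bnd : forall z, z ^+ m = 1 -> mbnd abs (shiftmx z Y *m invmx Y) CG.
Variable good : R -> Prop.
Local Notation Q := (q ^+ m).
Local Notation op := (op q A0 Y).
Local Notation mbnd := (mbnd abs).
Local Notation ev := (ev abs).
Local Notation E0 := (E0 abs).
Local Notation mxE0 := (mxE0 abs).
Implicit Types (Z M : 'M[fps K]_mu.+1) (s C D : R) (z c : K).
Local Notation E0D := (E0D p_prime K_char0 na complete abs_p).
Local Notation E0B := (E0B p_prime K_char0 na complete abs_p).
Local Notation E0CM := (E0CM p_prime K_char0 na complete abs_p).
Local Notation E0_bnd := (E0_bnd p_prime K_char0 na complete abs_p).
Local Notation E0_dom := (E0_dom p_prime K_char0 na complete abs_p).
Local Notation E0_det := (E0_det p_prime K_char0 na complete abs_p).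
Local Notation mxE0M := (mxE0M p_prime K_char0 na complete abs_p).

Let q_neq0 : q != 0. Proof. by rewrite -(abs_gt0 na) abs_q ltr01. Qed.

Lemma mxE0_bnd M : mxE0 M -> exists C, mbnd M C.
Proof.
move=> HM; have /choice[C CP] : forall ab : 'I_mu.+1 * 'I_mu.+1, exists C, bnd abs (M ab.1 ab.2) C.
  by move=> ab; apply: E0_bnd.
exists (\sum_ab C ab) => a b; apply: bndW (CP (a, b)); rewrite (bigD1 (a, b))//= lerDl.
by apply: sumr_ge0 => ab _; exact: (bnd_ge0 na (CP ab)).
Qed.

Lemma mxE0_shift c M : abs c = 1 -> mxE0 M -> mxE0 (shiftmx c M).
Proof.
move=> c1 HM a b; rewrite mxE; exact: (E0_shift p_prime K_char0 na complete abs_p c1).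
Qed.

(** Horner's scheme: by [op_mulX] each step is a dilation by q, a product with A and the addition of
    a multiple of Z Y^-1. *)
Lemma mxE0_op Z phi : mxE0 (Z *m invmx Y) -> mxE0 (op Z phi).
Proof.
move=> HZ; elim/poly_ind: phi => [|P c IH].
  have -> : op Z 0 = fps_const 0 *: op Z 1 by rewrite -opZ scale0r.
  by move=> a b; rewrite mxE op1; apply: E0CM.
have -> : op Z (P * 'X + c%:P) = shiftmx q (op Z P) *m A + fps_const c *: op Z 1.
  by rewrite opD mulrC (op_mulX Y_unit YE) -opZ -mul_polyC mulr1.
move=> a b; rewrite mxE; apply: E0D; first exact: (mxE0M (mxE0_shift abs_q IH) A_E0).
by rewrite mxE op1; apply: E0CM.
Qed.

(** The properties of the averaged solution that survive the removal of zeros. [good] stands for the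
    interval of radii between rho and chi(A); the growth constant may depend on the radius. *)
Record frobenius_cover Z : Prop := FrobeniusCover {
  cover_inv : forall z, z ^+ m = 1 -> shiftmx z Z = Z;
  cover_at0 : fps_mx0 Z = 1%:M;
  cover_E0 : mxE0 (Z *m invmx Y);
  cover_growth : forall s, 0 < s -> s <= 1 -> good s ->
    exists C, forall j, mbnd (op Z (qbin Q j)) (C / s ^+ (j * m)) }.

Lemma mx0_invmx : fps_mx0 (invmx Y) = 1%:M.
Proof.
have := cfM (invmx Y) Y 0; rewrite big_ord1 subnn mulVmx// cf1 /=.
by rewrite -[cf Y 0]/(fps_mx0 Y) Y0 mulmx1 => ->.
Qed.

Lemma mx0_cover Z : fps_mx0 Z = 1%:M -> fps_mx0 (Z *m invmx Y) = 1%:M.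
Proof.
move=> Z0; rewrite -[LHS]/(cf _ 0) cfM big_ord1 subnn.
by rewrite -[cf Z 0]/(fps_mx0 Z) Z0 -[cf _ 0]/(fps_mx0 (invmx Y)) mx0_invmx mulmx1.
Qed.

Lemma det_cover_neq0 Z : fps_mx0 Z = 1%:M -> \det (Z *m invmx Y) != 0.
Proof.
move=> Z0; apply/eqP => /(congr1 (fun f => fcoef f 0)).
by rewrite -det_fps_mx0 mx0_cover// det1 fcoef0 => /eqP; rewrite oner_eq0.
Qed.

(** With H = Z Y^-1, invariance of Z gives H(z x) = H(x) Y(x) Y(z x)^-1, where the last product is
    the dilation by z of Y(x / z) Y(x)^-1. A row vector annihilating H at x0 thus annihilates it at
    z x0 as soon as this factor is bounded. *)
Lemma cover_unity_shift Z z : z ^+ m = 1 -> shiftmx z Z = Z ->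
  shiftmx z (Z *m invmx Y) = Z *m invmx Y *m shiftmx z (shiftmx z^-1 Y *m invmx Y).
Proof.
move=> z1 Zz; have z0 : z != 0.
  by apply: contra_eq_neq z1 => ->; rewrite expr0n gtn_eqF// eq_sym oner_eq0.
have e : shiftmx z (shiftmx z^-1 Y) = Y.
  by apply/matrixP => a b; rewrite !mxE fps_shift_shift mulVf// fps_shift1.
have e1 : invmx Y *m (Y *m shiftmx z (invmx Y)) = shiftmx z (invmx Y) by rewrite mulKmx.
rewrite !shiftmxM Zz e -[RHS]mulmxA e1; reflexivity.
Qed.

Lemma ev_at0 f C : bnd abs f C -> ev f 0 = fcoef f 0.
Proof.
move=> fC; have x1 : abs 0 < 1 by rewrite (abs0 na) ltr01.
have [g _ fE] := ev_divide na complete fC x1.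
by rewrite {2}fE fcoefD fcoefXsubM mul0r subr0 addr0 /= coefC.
Qed.

Lemma cover_dom Z : frobenius_cover Z -> exists N, dom abs (\det (Z *m invmx Y)) N.
Proof.
by case=> _ Z0 ZE _; apply: E0_dom (det_cover_neq0 Z0); apply: E0_det.
Qed.

(* H vanishes in the direction v at x0, hence at all z x0 with z^m = 1, because Z is
   invariant and Y(z x) Y(x)^-1 is bounded. Dividing that direction by the function
   1 - (x / x0)^m removes these m zeros of det H. *)
Section Step.
Variables (Z : 'M[fps K]_mu.+1) (Zc : frobenius_cover Z).
Variables (x0 : K) (x01 : abs x0 < 1) (x0_neq0 : x0 != 0).
Variables (v : 'rV[K]_mu.+1) (u : 'cV[K]_mu.+1).
Hypothesis vu : v *m u = 1%:M.
Local Notation H := (Z *m invmx Y).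
Hypothesis vH : v *m map_mx (ev^~ x0) H = 0.
Variables (c : K) (D : fps K) (N0 Z' : 'M[fps K]_mu.+1).
Hypotheses (cE : c = x0 ^- m) (DE : D = 1 - fps_const c * fps_of_poly 'X^m).
Hypotheses (N0E : N0 = cmx (u *m v)) (Z'E : Z' = Z + (D^-1 - 1) *: (N0 *m Z)).

Let c_gt1 : 1 < abs c.
Proof.
rewrite cE (absV na) (absX na) invf_gt1 ?exprn_gt0 ?(abs_gt0 na)//.
by rewrite exprn_ilt1 ?(abs_ge0 na)// -lt0n.
Qed.

Let D0 : fcoef D 0 = 1.
Proof. by rewrite DE fcoefB fcoef1 fcoefCM /= coefXn eq_sym gtn_eqF// mulr0 subr0. Qed.

Let D_unit : D \is a GRing.unit.
Proof. by rewrite fps_unitE D0 oner_eq0. Qed.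

Let N0N0 : N0 *m N0 = N0.
Proof. by rewrite N0E -map_mxM -mulmxA [v *m _]mulmxA vu mul1mx. Qed.

Let N0Z' : N0 *m Z' = D^-1 *: (N0 *m Z).
Proof.
rewrite Z'E mulmxDr -scalemxAr mulmxA N0N0 scalerBl scale1r addrC subrK //.
Qed.

Let row_eq0 z b : z ^+ m = 1 -> ev ((map_mx (@fps_const K) v *m H) 0 b) (z * x0) = 0.
Proof.
move=> z1; rewrite -ev_shift.
set F := map_mx (@fps_const K) v *m H.
have [C HC] := mxE0_bnd (cover_E0 Zc).
set W := shiftmx z (shiftmx z^-1 Y *m invmx Y).
have WC : mbnd W CG.
  apply: (mbnd_shift na); first exact: (abs_unity na m_gt0 z1).
  by apply: unity_bnd; rewrite exprVn z1 invr1.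
have e : fps_shift z (F 0 b) = \sum_a F 0 a * W a b.
  have := cover_unity_shift z1 (cover_inv Zc z1); rewrite -/W => e.
  transitivity ((map_mx (@fps_const K) v *m shiftmx z H) 0 b).
    rewrite !mxE rmorph_sum; apply: eq_bigr => a _; rewrite rmorphM; congr (_ * _).
      by rewrite !mxE; apply: fpsP => -[|i] /=; rewrite coefC ?mulr1// mul0r.
    by rewrite [in RHS]mxE.
  by rewrite e mulmxA mxE.
have vC a : bnd abs (fps_const (v 0 a)) (\sum_a abs (v 0 a)).
  move=> i /=; rewrite coefC; case: eqP => _; last first.
    by rewrite (abs0 na) sumr_ge0// => *; exact: abs_ge0.
  by rewrite (bigD1 a)//= lerDl sumr_ge0// => *; exact: abs_ge0.
have FC a : bnd abs (F 0 a) ((\sum_a abs (v 0 a)) * C).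
  rewrite mxE; apply: (bnd_sum na) => [|i _].
    by rewrite mulr_ge0 ?(mbnd_ge0 na HC)// sumr_ge0// => *; exact: abs_ge0.
  by rewrite mxE; apply: (bndM na).
have F0 a : ev (F 0 a) x0 = 0.
  have := congr1 (fun M : 'rV_mu.+1 => M 0 a) vH; rewrite !mxE => <-.
  have := @ev_sum _ _ abs na complete _ (index_enum _)
    (fun i => map_mx (@fps_const K) v 0 i * H i a) ((\sum_a abs (v 0 a)) * C) x0 _ x01.
  rewrite -[\sum_(i <- _) _ * H i a]/(\sum_i _) => ->; last first.
    by move=> i; rewrite mxE; apply: (bndM na).
  apply: eq_bigr => i _; rewrite mxE [in RHS]mxE (evM na complete (vC i) (HC i a))//.
  by rewrite ev_poly// hornerC.
rewrite e (@ev_sum _ _ abs na complete _ _ _ ((\sum_a abs (v 0 a)) * C * CG))//; last first.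
  by move=> a; apply: (bndM na).
by rewrite big1// => a _; rewrite (evM na complete (FC a) (WC a b))// F0 mul0r.
Qed.

Let row_div b : E0 (D^-1 * (map_mx (@fps_const K) v *m H) 0 b).
Proof.
set f := (_ *m _) 0 b.
have Ef : E0 f by apply: mxE0M; [exact: (mxE0_cmx p_prime K_char0 na complete abs_p _)|exact: (cover_E0 Zc)].
have [||g Eg fE] := E0_divide_prod p_prime K_char0 na complete abs_p (f := f)
    (r := [seq w ^+ k * x0 | k <- index_iota 0 m]) Ef.
  rewrite map_inj_in_uniq ?iota_uniq// => i j; rewrite !mem_index_iota /= => im jm.
  by move/(mulIf x0_neq0)/eqP; rewrite (eq_prim_root_expr wP) !modn_small// => /eqP.
  move=> z /mapP[k _ ->]; have wk : (w ^+ k) ^+ m = 1.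
    by rewrite exprAC (prim_expr_order wP) expr1n.
  split; last exact: row_eq0.
  by rewrite (absM na) (abs_unity na m_gt0 wk) mul1r.
rewrite big_map big_mkord (prod_unity_roots wP x0_neq0) in fE.
have cD : fps_const (- c) * fps_of_poly ('X^m - (x0 ^+ m)%:P) = D.
  rewrite rmorphB mulrBr.
  have -> : fps_const (- c) * fps_of_poly (x0 ^+ m)%:P = - 1.
    by rewrite -[fps_of_poly _]/(fps_const (x0 ^+ m)) -rmorphM mulNr cE mulVf ?expf_neq0// rmorphN rmorph1.
  by rewrite opprK addrC DE rmorphN mulNr.
have c0 : - c != 0 by rewrite cE oppr_eq0 invr_eq0 expf_neq0.
have -> : D^-1 * f = fps_const (- c)^-1 * g.
  apply: (mulrI D_unit); rewrite mulrA mulrV// mul1r -cD fE.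
  by rewrite mulrACA -rmorphM mulfV// rmorph1 mul1r.
exact: E0CM.
Qed.

Let H'E : Z' *m invmx Y = H + (D^-1 - 1) *: (N0 *m H).
Proof. rewrite Z'E; exact: gauge_mulmx. Qed.

Let N0H a b : (N0 *m H) a b = fps_const (u a 0) * (map_mx (@fps_const K) v *m H) 0 b.
Proof.
rewrite N0E /cmx map_mxM -mulmxA mxE big_ord1; congr (_ * _); by rewrite mxE.
Qed.

Lemma cover_step_E0 : mxE0 (Z' *m invmx Y).
Proof.
rewrite H'E => a b; rewrite mxE; apply: E0D; first exact: (cover_E0 Zc).
rewrite mxE mulrBl mul1r; apply: E0B.
  by rewrite N0H mulrCA; apply: E0CM; exact: row_div.
rewrite N0E; apply: mxE0M; [exact: (mxE0_cmx p_prime K_char0 na complete abs_p _)|exact: (cover_E0 Zc)].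
Qed.

Let ZE : Z = Z' - fps_const c *: (fps_of_poly 'X^m *: (N0 *m Z')).
Proof.
rewrite N0Z' !scalerA -[_ * fps_of_poly _]/(fps_const c * fps_of_poly 'X^m).
have -> : fps_const c * fps_of_poly 'X^m = 1 - D by rewrite DE opprB addrC subrK.
rewrite mulrBl mul1r mulrV// Z'E.
by rewrite addrK.
Qed.

(** H is the product of 1 - c x^m u v and the new gauge matrix; as v u = 1, the first factor has
    determinant 1 - c x^m. *)
Lemma cover_step_det : \det H = D * \det (Z' *m invmx Y).
Proof.
pose uc : 'cV[fps K]_mu.+1 := (fps_const c * fps_of_poly 'X^m) *: map_mx (@fps_const K) u.
pose vc : 'rV[fps K]_mu.+1 := map_mx (@fps_const K) v.
have -> : H = (1%:M - uc *m vc) *m (Z' *m invmx Y).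
  by rewrite -gauge_factor {1}ZE N0E /cmx map_mxM.
rewrite det_mulmx det_sub1_mulmxC -scalemxAr -map_mxM vu !mxE eqxx rmorph1 mulr1.
by rewrite DE.
Qed.

Lemma cover_step_dom : dom abs D m.
Proof.
have Dm i : fcoef D i = (i == 0%N)%:R - c * (i == m)%:R.
  by rewrite DE fcoefB fcoef1 fcoefCM /= coefXn.
have Dmm : fcoef D m = - c by rewrite Dm gtn_eqF// eqxx sub0r mulr1.
have c0 : c != 0 by rewrite cE invr_eq0 expf_neq0.
split; rewrite ?Dmm ?oppr_eq0// ?(absN na) => i.
  rewrite Dm; case: eqP => _; case: eqP => _; rewrite ?mulr1 ?mulr0 ?subr0 ?sub0r ?(absN na)//.
    by apply: (absB_le na) => //; rewrite (abs1 na) ltW.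
    by rewrite (abs1 na) ltW.
  by rewrite (abs0 na) ltW// (lt_trans _ c_gt1).
move=> im; rewrite Dm (ltn_eqF im) mulr0 subr0; case: eqP => _; rewrite ?(abs1 na) ?(abs0 na)//.
exact: lt_trans c_gt1.
Qed.

Let N0_op phi : N0 *m op Z phi = N0 *m op Z' phi -
  fps_const c *: (fps_of_poly 'X^m *: (N0 *m op Z' (phi \Po (Q *: 'X)))).
Proof.
have op_N0 M psi : op (N0 *m M) psi = N0 *m op M psi.
  by rewrite N0E; exact: (op_cmx q A0 Y (u *m v) M psi).
apply: (etrans (esym (op_N0 Z phi))).
apply: (etrans (congr1 (op^~ phi) (gauge_project N0N0 ZE))).
apply: (etrans (opBl q A0 Y (N0 *m Z') (fps_const c *: (fps_of_poly 'X^m *: (N0 *m Z'))) phi)).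
congr (_ - _); first exact: op_N0.
apply: (etrans (op_scale q A0 Y c (fps_of_poly 'X^m *: (N0 *m Z')) phi)); congr (_ *: _).
apply: (etrans (op_Xn q A0 Y m (N0 *m Z') phi)); congr (_ *: _); exact: op_N0.
Qed.

Let op_Z' phi : op Z' phi = op Z phi - N0 *m op Z phi + N0 *m op Z' phi.
Proof.
have op_N0 M psi : op (N0 *m M) psi = N0 *m op M psi.
  by rewrite N0E; exact: (op_cmx q A0 Y (u *m v) M psi).
apply: (etrans (congr1 (op^~ phi) (gauge_split N0N0 N0Z' Z'E))).
apply: (etrans (opDl q A0 Y (Z - N0 *m Z) (N0 *m Z') phi)); congr (_ + _); last exact: op_N0.
apply: (etrans (opBl q A0 Y Z (N0 *m Z) phi)); congr (_ - _); exact: op_N0.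
Qed.

(** Let U_j and V_j be the images of Z and Z' under qbin_j of ratio Q. From Z = (1 - c x^m N0) Z'
    and [qbin_scale] follows (1 - c Q^j x^m) N0 V_j = N0 U_j + c x^m N0 V_(j-1) for j > 0. Inverting
    the left factor gains 1 / |c| by [bnd_div_large], which exactly compensates the factor c on the
    right: the constant does not grow with j. *)
Lemma cover_step_growth s : 0 < s -> s <= 1 -> good s ->
  exists C, forall j, mbnd (op Z' (qbin Q j)) (C / s ^+ (j * m)).
Proof.
move=> s0 s1 gs; have [C HC] := cover_growth Zc s0 s1 gs.
have [CN NC] := mbnd_cmx na (u *m v).
have CN0 := mbnd_ge0 na NC.
have C0 : 0 <= C by have := mbnd_ge0 na (HC 0%N); rewrite expr0 divr1.
have sj j : 0 < s ^+ (j * m) by rewrite exprn_gt0.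
have NU j : mbnd (N0 *m op Z (qbin Q j)) (CN * C / s ^+ (j * m)).
  by rewrite -mulrA N0E; apply: (mbndM na).
have c0 : 0 < abs c by exact: lt_trans c_gt1.
have V j : mbnd (N0 *m op Z' (qbin Q j)) (CN * C / s ^+ (j * m)).
  have aQ k : abs (Q ^+ k) = 1 by rewrite !(absX na) abs_q !expr1n.
  (* [bnd_div_large] needs some bound beforehand, with no control in j; it exists because the image
     is a matrix of analytic elements. *)
  have [B BP] : exists B, mbnd (N0 *m op Z' (qbin Q j)) B.
    apply: mxE0_bnd; rewrite N0E; apply: mxE0M; first exact: (mxE0_cmx p_prime K_char0 na complete abs_p _).
    by apply: mxE0_op; exact: cover_step_E0.
  elim: j B BP => [|j IH] B BP a b.
    have := bnd_div_large na (c := c) (m := m) c_gt1 (BP a b) (D := CN * C / s ^+ (0 * m)) => H.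
    apply: bndW (H _); last first.
      have e := congr1 (fun M : 'M[fps K]_mu.+1 => M a b) (N0_op (qbin Q 0)).
      rewrite (_ : qbin Q 0 \Po (Q *: 'X) = qbin Q 0) in e; last first.
        by rewrite qbin0 comp_polyC.
      have {}e := etrans e (gauge_entry _ _ _ _ a b).
      rewrite one_sub_mulA; exact: (eq_ind _ (fun f => bnd abs f _) (NU 0%N a b) _ e).
    by rewrite ler_pdivrMr// ler_peMr ?(ltW c_gt1)// divr_ge0 ?mulr_ge0// ltW.
  have [B' BP'] : exists B, mbnd (N0 *m op Z' (qbin Q j)) B.
    apply: mxE0_bnd; rewrite N0E; apply: mxE0M; first exact: (mxE0_cmx p_prime K_char0 na complete abs_p _).
    by apply: mxE0_op; exact: cover_step_E0.
  have Vj := IH _ BP' a b.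
  have cQ : 1 < abs (c * Q ^+ j.+1) by rewrite (absM na) aQ mulr1.
  have eD : abs c * (CN * C / s ^+ (j.+1 * m)) / abs (c * Q ^+ j.+1) = CN * C / s ^+ (j.+1 * m).
    by rewrite (absM na) aQ mulr1 mulrAC mulfV ?gt_eqF// mul1r.
  have := bnd_div_large na (c := c * Q ^+ j.+1) (m := m) cQ (BP a b)
    (D := abs c * (CN * C / s ^+ (j.+1 * m))).
  rewrite eD; apply.
  have -> : (1 - fps_const (c * Q ^+ j.+1) * fps_of_poly 'X^m) * (N0 *m op Z' (qbin Q j.+1)) a b =
     (N0 *m op Z (qbin Q j.+1)) a b + fps_const c * (fps_of_poly 'X^m * (N0 *m op Z' (qbin Q j)) a b).
    have e1 : N0 *m op Z' (qbin Q j.+1 \Po (Q *: 'X)) =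
        fps_const (Q ^+ j.+1) *: (N0 *m op Z' (qbin Q j.+1)) + N0 *m op Z' (qbin Q j).
      rewrite (qbin_scale (qpow_neq0 m q_neq0) (qpow_not_root1 q_not_root1 m_gt0)).
      rewrite opD (opZ q A0 Y Z' (Q ^+ j.+1) (qbin Q j.+1)) mulmxDr -scalemxAr; reflexivity.
    have e := gauge_recurrence a b (N0_op (qbin Q j.+1)) e1.
    rewrite rmorphM; exact: e.
  have sS : (s ^+ (j * m))^-1 <= (s ^+ (j.+1 * m))^-1.
    by rewrite lef_pV2 ?posrE// ler_wiXn2l// ?(ltW s0)// leq_mul2r leqnSn orbT.
  apply: (bndD na).
    by apply: bndW (NU j.+1 a b); rewrite ler_peMl ?(ltW c_gt1)// divr_ge0 ?mulr_ge0// ltW.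
  apply: bndCM => //; rewrite -[_ / _]mul1r; apply: (bndM na); first exact: bndXn.
  by apply: bndW Vj; rewrite ler_wpM2l ?mulr_ge0.
exists (C + CN * C) => j; rewrite op_Z'.
have le1 : C / s ^+ (j * m) <= (C + CN * C) / s ^+ (j * m).
  by rewrite ler_wpM2r ?invr_ge0 ?(ltW (sj j))// lerDl mulr_ge0.
have le2 : CN * C / s ^+ (j * m) <= (C + CN * C) / s ^+ (j * m).
  by rewrite ler_wpM2r ?invr_ge0 ?(ltW (sj j))// lerDr.
apply: (mbndD na); last exact: mbndW le2 (V j).
by apply: (mbndB na); [exact: mbndW le1 (HC j)|exact: mbndW le2 (NU j)].
Qed.

Lemma cover_step : frobenius_cover Z'.
Proof.
split; [| |exact: cover_step_E0|exact: cover_step_growth].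
  move=> z z1; have Dz : fps_shift z D = D.
    rewrite DE rmorphB rmorph1 rmorphM; congr (_ - _ * _).
      by apply: fpsP => -[|i] /=; rewrite coefC ?mulr1// mul0r.
    apply: fpsP => i /=; rewrite coefXn; case: eqP => [->|_]; first by rewrite z1 mulr1.
    by rewrite mul0r.
  have N0z : shiftmx z N0 = N0.
    rewrite N0E; apply/matrixP => a b; rewrite !mxE.
    by apply: fpsP => -[|i] /=; rewrite coefC ?mulr1// mul0r.
  rewrite Z'E; apply: (etrans (shiftmx_gauge z N0 Z (D^-1 - 1))).
  have -> : fps_shift z (D^-1 - 1) = D^-1 - 1 by rewrite rmorphB rmorph1 rmorphV ?D_unit//= Dz.
  rewrite (cover_inv Zc z1) N0z; reflexivity.
have e0 : fcoef (D^-1 - 1) 0 = 0.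
  have := fcoef0M D^-1 D; rewrite mulVr// D0 mulr1 fcoef1 fcoefB fcoef1 => <-.
  by rewrite subrr.
rewrite -(cover_at0 Zc) Z'E; apply/matrixP => a b.
by rewrite !mxE fcoefD fcoef0M e0 mul0r addr0.
Qed.
End Step.

Lemma cover_remove_zero Z N : frobenius_cover Z -> dom abs (\det (Z *m invmx Y)) N.+1 ->
  exists2 Z', frobenius_cover Z' &
    exists2 N', (N' < N.+1)%N & dom abs (\det (Z' *m invmx Y)) N'.
Proof.
move=> Zc dN; have HE := cover_E0 Zc.
have [x0 x01 Hx0] := E0_root p_prime K_char0 na complete abs_p (E0_det HE) dN.
have x0n : x0 != 0.
  apply: contra_eq_neq Hx0 => ->; have [C fC] := E0_bnd (E0_det HE).
  by rewrite (ev_at0 fC) -det_fps_mx0 (mx0_cover (cover_at0 Zc)) det1 oner_eq0.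
rewrite (ev_det p_prime K_char0 na complete abs_p HE x01) in Hx0.
have /det0P[v v0 vS] : \det (map_mx (ev^~ x0) (Z *m invmx Y)) == 0 by apply/eqP.
have [b vb] := rV0Pn _ v0.
(* A column with v u = 1, which makes u v the idempotent that isolates the direction of v. *)
pose u : 'cV[K]_mu.+1 := (v 0 b)^-1 *: delta_mx b 0.
have vu : v *m u = 1%:M.
  apply/matrixP => i j; rewrite !ord1 mxE (bigD1 b)//= !mxE !eqxx mulr1 mulfV// big1 ?addr0//.
  by move=> k kb; rewrite !mxE (negbTE kb) /= !mulr0.
have Z'c := cover_step Zc x01 x0n vu vS erefl erefl erefl erefl.
eexists; first exact: Z'c.
have [N' dN'] := cover_dom Z'c; exists N' => //.
have := domM na (cover_step_dom x01 x0n erefl erefl) dN'.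
rewrite -(cover_step_det vu erefl erefl erefl) => d.
by rewrite (dom_uniq dN d) -[ltnLHS]add0n ltn_add2r.
Qed.

Lemma cover_zero_free Z : frobenius_cover Z ->
  exists2 Z', frobenius_cover Z' & dom abs (\det (Z' *m invmx Y)) 0.
Proof.
move=> Zc; have [N dN] := cover_dom Zc.
elim/ltn_ind: N Z Zc dN => -[|N] IH Z Zc dN; first by exists Z.
have [Z' Z'c [N' lt dN']] := cover_remove_zero Zc dN.
exact: (IH N' lt Z' Z'c dN').
Qed.
End ZeroRemoval.

(** * Substitution of x^m *)

Section ComposePower.
Variables (K : closedFieldType) (m : nat).
Hypothesis m_gt0 : (0 < m)%N.
Variable mu : nat.
Implicit Types (M N : 'M[fps K]_mu.+1) (B : 'M[K]_mu.+1).

Definition compmx M : 'M[fps K]_mu.+1 := map_mx (fps_comp_pow m) M.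

Lemma cf_compmx M i : cf (compmx M) i = if (m %| i)%N then cf M (i %/ m) else 0.
Proof. by apply/matrixP => a b; rewrite !mxE /=; case: ifP; rewrite !mxE. Qed.

Lemma compmxM M N : compmx (M *m N) = compmx M *m compmx N.
Proof.
apply/matrixP => a b; rewrite !mxE (big_morph (fps_comp_pow m) (id1 := 0) (op1 := +%R)).
  by apply: eq_bigr => k _; rewrite fps_comp_powM// !mxE.
  by move=> f g; apply: fpsP => i /=; case: ifP; rewrite ?addr0.
by apply: fpsP => i /=; case: ifP; rewrite ?coef0.
Qed.

Let dvdn_quotient_eq0 i : (m %| i)%N -> (i %/ m == 0)%N = (i == 0)%N.
Proof. by move=> mi; rewrite -[in RHS](divnK mi) muln_eq0 (gtn_eqF m_gt0) orbF. Qed.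

Lemma compmx1 : compmx 1%:M = 1%:M.
Proof.
apply: cfP => i; rewrite cf_compmx !cf1; case: ifP => mi.
  by rewrite dvdn_quotient_eq0.
by case: eqP mi => // ->; rewrite dvdn0.
Qed.

Lemma compmxV M : M \in unitmx -> compmx (invmx M) = invmx (compmx M).
Proof. by move=> u; apply: invmx_unique; rewrite -compmxM mulmxV// compmx1. Qed.

Lemma shiftmx_compmx q M : shiftmx q (compmx M) = compmx (shiftmx (q ^+ m) M).
Proof. by apply/matrixP => a b; rewrite !mxE fps_shift_comp_pow. Qed.

Lemma compmx_cmx B : compmx (cmx B) = cmx B.
Proof.
apply/matrixP => a b; rewrite !mxE; apply: fpsP => i /=; rewrite !coefC.
case: ifP => mi; first by rewrite dvdn_quotient_eq0.
by case: eqP mi => // ->; rewrite dvdn0.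
Qed.

Lemma compmxP w M : m.-primitive_root w -> shiftmx w M = M -> exists N, M = compmx N.
Proof.
move=> wP Mw.
have /choice[F FP] : forall ab : 'I_mu.+1 * 'I_mu.+1, exists f, M ab.1 ab.2 = fps_comp_pow m f.
  move=> [a b] /=; apply: fps_comp_powP => //; apply: (fps_invariant_comp_pow wP).
  by have := congr1 (fun M : 'M[fps K]_mu.+1 => M a b) Mw; rewrite mxE.
exists (\matrix_(a, b) F (a, b)); apply/matrixP => a b; rewrite !mxE.
exact: (FP (a, b)).
Qed.

Lemma compmx_tw q A0 N phi : compmx (tw (q ^+ m) A0 N phi) = tw q A0 (compmx N) phi.
Proof.
apply: cfP => i; rewrite cf_compmx !cf_mk cf_compmx; case: ifP => mi; last by rewrite mul0mx.
by rewrite -exprM [(m * _)%N]mulnC divnK.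
Qed.

Local Transparent op.
Lemma compmx_op q A0 N phi : N \in unitmx ->
  compmx (op (q ^+ m) A0 N N phi) = op q A0 (compmx N) (compmx N) phi.
Proof. by move=> u; rewrite /op compmxM compmx_tw compmxV. Qed.

Lemma op_change q A0 M N Z phi : M \in unitmx ->
  op q A0 N Z phi = op q A0 M Z phi *m (M *m invmx N).
Proof. by move=> u; rewrite /op mulmxA mulmxKV. Qed.

Lemma cf_op_high q A0 N Z phi i : (forall k, (k <= i)%N -> cf Z k = 0) ->
  cf (op q A0 N Z phi) i = 0.
Proof.
move=> H; rewrite /op cfM big1// => k _; rewrite cf_mk H ?mul0mx//.
by rewrite -ltnS.
Qed.
End ComposePower.
Local Opaque op.

(** * From growth at ratio q^m back to growth at ratio q *)

Section Growth.
Variables (R : realType) (K : closedFieldType) (abs : K -> R).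
Hypotheses (na : nonarch_abs abs).
Variables (q : K) (m : nat) (w : K) (rho : R).
Hypothesis q_not_root1 : forall n, (0 < n)%N -> q ^+ n != 1.
Hypotheses (abs_q : abs q = 1) (rho_gt0 : 0 < rho) (rho_le1 : rho <= 1).
Hypothesis q_rho : abs (q - 1) <= rho.
Hypotheses (m_gt0 : (0 < m)%N) (wP : m.-primitive_root w).
Hypothesis unity_rho : forall z, z ^+ m = 1 -> abs (z - 1) <= rho.
Variables (mu : nat) (A0 : 'M[K]_mu.+1) (Z g : 'M[fps K]_mu.+1).
Local Notation Q := (q ^+ m).
Local Notation mbnd := (mbnd abs).
Variables (tau C D : R).
Hypotheses (rho_tau : rho <= tau) (tau_le1 : tau <= 1).
Hypothesis Z_growth : forall j, mbnd (op q A0 Z Z (qbin Q j)) (C / tau ^+ (j * m)).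
Hypothesis gD : mbnd g D.

Let q_neq0 : q != 0. Proof. by rewrite -(abs_gt0 na) abs_q ltr01. Qed.
Let w_pow k : (w ^+ k) ^+ m = 1.
Proof. by rewrite exprAC (prim_expr_order wP) expr1n. Qed.
Let abs_w : abs w = 1.
Proof. by have := abs_unity na m_gt0 (w_pow 1); rewrite expr1. Qed.
Let w_rho k : abs (w ^+ k - 1) <= rho. Proof. exact: unity_rho. Qed.
Let tau_gt0 : 0 < tau. Proof. exact: lt_le_trans rho_tau. Qed.
Let C_ge0 : 0 <= C.
Proof. by have := mbnd_ge0 na (Z_growth 0); rewrite mul0n expr0 divr1. Qed.
Let D_ge0 : 0 <= D. Proof. exact: (mbnd_ge0 na gD). Qed.

(** The coefficients of the re-expansion by [qbin_pow] are at most 1, and at most rho^(j m - n) when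
    j m > n. As rho <= tau <= 1, they are in both cases small enough to replace tau^(j m) by tau^n,
    uniformly in i. *)
Lemma op_qbin_scale_growth i n :
  mbnd (op q A0 Z Z (qbin q n \Po (q ^+ i *: 'X))) (C / tau ^+ n).
Proof.
rewrite (qbin_pow q_neq0 q_not_root1 m_gt0 i (ltnSn n)).
have op_sum (c : 'I_n.+1 -> K) (P : 'I_n.+1 -> {poly K}) :
    op q A0 Z Z (\sum_j c j *: P j) = \sum_j fps_const (c j) *: op q A0 Z Z (P j).
  elim/big_rec2: _ => [|j y1 y2 _ <-]; last by rewrite opD opZ.
  by have := opZ q A0 Z Z 0 0; rewrite rmorph0 !scale0r.
rewrite (op_sum (fun j => ncoef q n ('X^i * (qpoch Q j \Po 'X^m))) (fun j => qbin Q j)).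
have tn k : 0 < tau ^+ k by rewrite exprn_gt0.
apply: (mbnd_sum na) => [|j]; first by rewrite divr_ge0// ltW.
apply: mbndW (mbndCZ na _ (Z_growth j)).
have [c1 cr] := ncoef_pow_bound na q_neq0 q_not_root1 abs_q rho_gt0 rho_le1 q_rho
  m_gt0 wP abs_w w_rho i j n.
move: c1 cr; set c := abs _ => c1 cr.
have c0 : 0 <= c by exact: abs_ge0.
suff H : c * tau ^+ n <= tau ^+ (j * m).
  by rewrite mulrCA ler_wpM2l// ler_pdivrMr// mulrC ler_pdivlMr.
have [le|lt] := leqP (j * m) n.
  apply: le_trans (_ : 1 * tau ^+ n <= _); first by rewrite ler_wpM2r// ltW.
  by rewrite mul1r ler_wiXn2l// ltW.
have cr' : c <= rho ^+ (j * m - n).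
  rewrite -(ler_pM2r (_ : 0 < rho ^+ n)) ?exprn_gt0//.
  by rewrite -exprD subnK// ltnW.
rewrite -(subnK (ltnW lt)) exprD ler_wpM2r ?(ltW (tn n))//.
by apply: le_trans cr' _; rewrite lerXn2r ?nnegrE ?(ltW rho_gt0) ?(ltW tau_gt0).
Qed.

(** By [op_Xn], a factor x^k in front of Z scales the variable of the polynomial by q^k, for which
    [op_qbin_scale_growth] is uniform. The operators preserve the order in x, so for a given
    coefficient g may be truncated to a polynomial. *)
Lemma op_mul_growth n : mbnd (op q A0 Z (g *m Z) (qbin q n)) (D * (C / tau ^+ n)).
Proof.
have T0 : 0 <= C / tau ^+ n by rewrite divr_ge0// exprn_ge0// ltW.
apply/mbnd_cf => i.
pose S := \sum_(k < i.+1) fps_of_poly 'X^k *: cmx (cf g k).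
have cfS k : (k <= i)%N -> cf (g - S) k = 0.
  move=> ki; rewrite cfB cf_sum; apply/eqP; rewrite subr_eq0; apply/eqP.
  have cfc B e : cf (cmx B) e = if e == 0%N then B else 0.
    apply/matrixP => a b; rewrite !mxE /= coefC; by case: eqP; rewrite ?mxE.
  have ki' : (k < i.+1)%N by rewrite ltnS.
  rewrite (bigD1 (Ordinal ki'))//= cf_Xn ltnn subnn cfc eqxx big1 ?addr0// => e.
  rewrite -val_eqE /= => ek; rewrite cf_Xn cfc; case: ltnP => // le.
  by rewrite subn_eq0 leqNgt ltn_neqAle ek le.
have e : op q A0 Z (g *m Z) (qbin q n) =
    op q A0 Z ((g - S) *m Z) (qbin q n) + op q A0 Z (S *m Z) (qbin q n).
  by rewrite -opDl -mulmxDl subrK.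
have h : cf (op q A0 Z ((g - S) *m Z) (qbin q n)) i = 0.
  apply: cf_op_high => k ki; rewrite cfM big1// => j _; rewrite cfS ?mul0mx//.
  by apply: leq_trans ki; rewrite -ltnS.
have e2 : cf (op q A0 Z (g *m Z) (qbin q n)) i = cf (op q A0 Z (S *m Z) (qbin q n)) i.
  apply: (etrans (congr1 (fun M => cf M i) e)); apply: (etrans (cfD _ _ i)).
  by apply: (etrans (congr1 (fun M => M + _) h)); exact: add0r.
suff H : mbnd (op q A0 Z (S *m Z) (qbin q n)) (D * (C / tau ^+ n)).
  move=> a b; have Ha := (mbnd_cf _ _ _).1 H i a b.
  exact: (eq_ind_r (fun M : 'M[K]_mu.+1 => abs (M a b) <= _) Ha e2).
have -> : op q A0 Z (S *m Z) (qbin q n) = \sum_(k < i.+1) fps_of_poly 'X^k *: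
    (cmx (cf g k) *m op q A0 Z Z (qbin q n \Po (q ^+ k *: 'X))).
  rewrite /S mulmx_suml; elim/big_rec2: _ => [|k y1 y2 _ <-].
    have := op_scale q A0 Z 0 0 (qbin q n); rewrite rmorph0 !scale0r; exact.
  rewrite opDl -scalemxAl op_Xn op_cmx; reflexivity.
apply: (mbnd_sum na) => [|k]; first exact: mulr_ge0.
rewrite -[D * _]mul1r; apply: (mbndZ na); first exact: bndXn.
apply: (mbndM na); last exact: op_qbin_scale_growth.
move=> a b e'; rewrite mxE /= coefC; case: eqP => _; last by rewrite (abs0 na).
by rewrite mxE; apply: gD.
Qed.
End Growth.

(** * Descent to the power of the variable *)

Section SolutionRadius.
Variables (R : realType) (p : nat) (K Omega : closedFieldType).
Variables (abs : K -> R) (absO : Omega -> R).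
Variables (iota : {rmorphism K -> Omega}) (t : Omega).
Hypotheses (p_prime : prime p) (K_char0 : [pchar K] =i pred0).
Hypotheses (na : nonarch_abs abs) (complete : abs_complete abs).
Hypothesis abs_p : abs p%:R = p%:R^-1.
Hypothesis Omega_generic : generic_extension abs absO iota t.
Variable q : K.
Hypothesis q_not_root1 : forall n, (0 < n)%N -> q ^+ n != 1.
Hypothesis abs_q : abs q = 1.
Variables (mu : nat) (A0 : 'M[K]_mu.+1) (A Y : 'M[fps K]_mu.+1).
Hypotheses (Y_unit : Y \in unitmx) (A_E0 : mxE0 abs A).
Hypothesis YE : shiftmx q Y *m cmx A0 = A *m Y.

Let q_neq0 : q != 0. Proof. by rewrite -(abs_gt0 na) abs_q ltr01. Qed.

Lemma mxE0_1 n : mxE0 abs (1%:M : 'M[fps K]_n).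
Proof.
move=> a b; rewrite mxE; have -> : (1 *+ (a == b) : fps K) = fps_of_poly (1 *+ (a == b)).
  by rewrite rmorphMn rmorph1.
exact: (E0_poly p_prime K_char0 na complete abs_p).
Qed.

Lemma op_solution_E0 phi : mxE0 abs (op q A0 Y Y phi).
Proof.
apply: (mxE0_op p_prime K_char0 na complete abs_p abs_q Y_unit YE A_E0).
rewrite mulmxV//; exact: mxE0_1.
Qed.

Lemma solution_chi_lower r : 0 < r -> r < chi abs absO iota t (mx_laurent A) q ->
  exists2 C, 0 < C & forall n, mbnd abs (op q A0 Y Y (qbin q n)) (C / r ^+ n).
Proof.
move=> r0 rc; exact: (chi_lower p_prime K_char0 na complete abs_p Omega_generic
  (qfact_neq0 q_not_root1) (fun n => op_solution_E0 (qbin q n))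
  (Gseq_op q_neq0 Y_unit YE q_not_root1) r0 rc).
Qed.

Lemma solution_chi_upper r C : 0 < r -> r <= 1 ->
  (forall n, mbnd abs (op q A0 Y Y (qbin q n)) (C / r ^+ n)) ->
  r <= chi abs absO iota t (mx_laurent A) q.
Proof.
move=> r0 r1 H; exact: (chi_upper p_prime K_char0 na complete abs_p Omega_generic
  (qfact_neq0 q_not_root1) (fun n => op_solution_E0 (qbin q n))
  (Gseq_op q_neq0 Y_unit YE q_not_root1) r0 r1 H (ltn0Sn mu)).
Qed.
End SolutionRadius.

Section RealRoots.
Variables (R : realType) (m : nat).
Hypothesis m_gt0 : (0 < m)%N.
Implicit Types x y z : R.

Lemma real_rootX x : 0 <= x -> (x `^ m%:R^-1) ^+ m = x.
Proof.
move=> x0; rewrite -powR_mulrn ?powR_ge0// -powRrM mulVf ?powRr1//.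
by rewrite pnatr_eq0 -lt0n.
Qed.

Lemma ltr_root x y : 0 <= x -> 0 <= y -> x ^+ m < y -> x < y `^ m%:R^-1.
Proof.
move=> x0 y0 xy; rewrite -(ltr_pXn2r m_gt0) ?nnegrE ?powR_ge0//.
by rewrite real_rootX.
Qed.

Lemma root_ltr x y : 0 <= x -> 0 <= y -> x < y ^+ m -> x `^ m%:R^-1 < y.
Proof.
move=> x0 y0 xy; rewrite -(ltr_pXn2r m_gt0) ?nnegrE ?powR_ge0//.
by rewrite real_rootX.
Qed.
End RealRoots.

Section FrobeniusDescent.
Variables (R : realType) (p : nat) (K Omega : closedFieldType).
Variables (abs : K -> R) (absO : Omega -> R).
Variables (iota : {rmorphism K -> Omega}) (t : Omega).
Hypotheses (p_prime : prime p) (K_char0 : [pchar K] =i pred0).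
Hypotheses (na : nonarch_abs abs) (complete : abs_complete abs).
Hypothesis abs_p : abs p%:R = p%:R^-1.
Hypothesis Omega_generic : generic_extension abs absO iota t.
Variables (q : K) (m : nat) (rho : R).
Hypothesis q_not_root1 : forall n, (0 < n)%N -> q ^+ n != 1.
Hypotheses (abs_q : abs q = 1) (rho_gt0 : 0 < rho) (rho_le1 : rho <= 1).
Hypothesis q_rho : abs (q - 1) <= rho.
Hypothesis m_gt0 : (0 < m)%N.
Hypothesis unity_rho : forall z, z ^+ m = 1 -> abs (z - 1) <= rho.
Variables (mu : nat) (A : 'M[fps K]_mu.+1).
Local Notation A0 := (fps_mx0 A).
Hypothesis A_GL : GL_E0 abs A.
Hypothesis nonresonant : forall a b, eigenvalue A0 a -> eigenvalue A0 b ->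
  forall i, (0 < i)%N -> a != q ^+ i * b.
Variables (CA theta : R).
Hypotheses (theta_ge0 : 0 <= theta) (theta_lt1 : theta < 1).
Local Notation Q := (q ^+ m).
Hypothesis qbinA0 : forall j,
  mx_bounded abs (horner_mx A0 (qbin Q j)) (CA * theta ^+ j / rho ^+ (j * m)).
Local Notation chiA := (chi abs absO iota t (mx_laurent A) q).
Hypothesis rho_chi : rho < chiA.

Let q_neq0 : q != 0. Proof. by rewrite -(abs_gt0 na) abs_q ltr01. Qed.
Let A_E0 : mxE0 abs A. Proof. by case: A_GL. Qed.
Let A_unit : A \in unitmx. Proof. by case: A_GL. Qed.
Let Q_not_root1 n : (0 < n)%N -> Q ^+ n != 1.
Proof. exact: (qpow_not_root1 q_not_root1 m_gt0). Qed.
Let abs_Q : abs Q = 1. Proof. by rewrite (absX na) abs_q expr1n. Qed.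

Lemma frobenius_cover_exists : exists Y Z : 'M[fps K]_mu.+1,
  [/\ fps_mx0 Y = 1%:M, Y \in unitmx, shiftmx q Y *m cmx A0 = A *m Y,
      frobenius_cover abs q m A0 Y (fun s => rho < s < chiA) Z
    & dom abs (\det (Z *m invmx Y)) 0].
Proof.
have [w wP] := prim_root_exists K_char0 m_gt0.
have [Y [Y0 Yu YE]] := formal_solution q_neq0 nonresonant.
have lower s : rho < s -> s < chiA -> exists2 C, 0 < C &
    forall n, mbnd abs (op q A0 Y Y (qbin q n)) (C / s ^+ n).
  move=> rs sc; apply: (solution_chi_lower p_prime K_char0 na complete abs_p Omega_generic
    q_not_root1 abs_q Yu A_E0 YE _ sc); exact: lt_trans rs.
(* One radius suffices to bound Y(z x) Y(x)^-1 and to obtain analyticity; the growth condition is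
   then proved at every radius of the interval. *)
have [s rs sc] : exists2 s, rho < s & s < chiA.
  by exists ((rho + chiA) / 2); [rewrite midf_lt//|rewrite midf_lt//].
have [CG CG0 G] := lower s rs sc.
have ub := unity_shift_bnd na q_not_root1 abs_q rho_gt0 rho_le1 q_rho m_gt0 wP unity_rho
  Yu theta_ge0 theta_lt1 qbinA0 rs (ltW CG0) G.
have Yc : frobenius_cover abs q m A0 Y (fun s => rho < s < chiA) (Ybar m Y).
  split.
    move=> z z1; apply: cfP => i; rewrite cf_shift cf_mk.
    case: ifP => [/dvdnP[k ->]|_]; last by rewrite scaler0.
    by rewrite mulnC exprM z1 expr1n scale1r.
    by rewrite -[LHS]/(cf _ 0) cf_mk dvdn0.
    have := op_Ybar_E0 p_prime K_char0 na complete abs_p q_not_root1 abs_q rho_gt0 rho_le1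
      q_rho m_gt0 wP unity_rho Yu theta_ge0 theta_lt1 qbinA0 rs (ltW CG0) G.
    rewrite op1; apply => n.
    exact: (op_solution_E0 p_prime K_char0 na complete abs_p abs_q Yu A_E0 YE).
  move=> s' s'0 s'1 /andP[rs' sc']; have [C C0 GC] := lower s' rs' sc'.
  exists (C / rho ^+ m) => j.
  exact: (op_Ybar_growth na q_not_root1 abs_q rho_gt0 rho_le1 q_rho m_gt0 wP unity_rho
    Yu theta_ge0 theta_lt1 qbinA0 rs' (ltW C0) GC).
have [Z Zc dZ] := cover_zero_free p_prime K_char0 na complete abs_p q_not_root1 abs_q
  m_gt0 wP Yu Y0 YE A_E0 ub Yc.
by exists Y, Z; split.
Qed.

Section Descent.
Variables Y Z : 'M[fps K]_mu.+1.
Hypotheses (Y0 : fps_mx0 Y = 1%:M) (Y_unit : Y \in unitmx).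
Hypothesis YE : shiftmx q Y *m cmx A0 = A *m Y.
Hypothesis Zc : frobenius_cover abs q m A0 Y (fun s => rho < s < chiA) Z.
Hypothesis dZ : dom abs (\det (Z *m invmx Y)) 0.
Variable H : 'M[fps K]_mu.+1.
Hypothesis HE : H = Z *m invmx Y.

Let Z_unit : Z \in unitmx.
Proof. by rewrite unitmx_fps (cover_at0 Zc) unitmx1. Qed.
Let H0 : fps_mx0 H = 1%:M.
Proof. rewrite HE; exact: (mx0_cover Y_unit Y0 (cover_at0 Zc)). Qed.
Let H_unit : H \in unitmx.
Proof. by rewrite unitmx_fps H0 unitmx1. Qed.
Let H_E0 : mxE0 abs H. Proof. rewrite HE; exact: (cover_E0 Zc). Qed.
Let HV_E0 : mxE0 abs (invmx H).
Proof. rewrite HE; exact: (mxE0_inv p_prime K_char0 na complete abs_p (cover_E0 Zc) dZ). Qed.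
Let HVE : invmx H = Y *m invmx Z.
Proof.
symmetry; apply: invmx_unique; rewrite HE mulmxA mulmxKV// mulmxV//.
Qed.

Lemma gauge_system : shiftmx q H *m A = shiftmx q Z *m cmx A0 *m invmx Z *m H.
Proof.
have e : shiftmx q (invmx Y) *m A = cmx A0 *m invmx Y.
  rewrite shiftmx_inv//; have u := shiftmx_unit q Y_unit.
  apply: (can_inj (mulKmx u)); rewrite mulKVmx// mulmxA YE mulmxK//.
have e1 : invmx Z *m H = invmx Y by rewrite HE mulKmx.
apply: (etrans (congr1 (fun M => shiftmx q M *m A) HE)).
rewrite shiftmxM -mulmxA e -[RHS]mulmxA e1 mulmxA; reflexivity.
Qed.

(** V is for F and Q what Y is for A and q, with the same matrix A(0). Under X = x^m, the operators
    of ratio Q on V therefore become operators of ratio q on Z, divided by Z instead of Y. *)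
Lemma descent_exists : exists F V : 'M[fps K]_mu.+1,
  [/\ V \in unitmx, Z = compmx m V, shiftmx Q V *m cmx A0 = F *m V,
      compmx m F = shiftmx q Z *m cmx A0 *m invmx Z & fps_mx0 F = A0].
Proof.
have [w wP] := prim_root_exists K_char0 m_gt0.
have Zw : shiftmx w Z = Z by apply: (cover_inv Zc); exact: prim_expr_order wP.
have [V VE] := compmxP m_gt0 wP Zw.
have V0 : fps_mx0 V = 1%:M.
  have := cf_compmx m V 0; rewrite -VE dvdn0 div0n => e.
  exact: (etrans (esym e) (cover_at0 Zc)).
have Vu : V \in unitmx by rewrite unitmx_fps V0 unitmx1.
pose F := shiftmx Q V *m cmx A0 *m invmx V.
have FV : shiftmx Q V *m cmx A0 = F *m V by rewrite /F mulmxKV.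
exists F, V; split; [exact: Vu|exact: VE|exact: FV| |].
  have eV : compmx m (shiftmx Q V) = shiftmx q Z by rewrite -shiftmx_compmx// -VE.
  have eI : compmx m (invmx V) = invmx Z by rewrite compmxV// -VE.
  apply: (etrans (compmxM m_gt0 _ _)); congr (_ *m _); last exact: eI.
  apply: (etrans (compmxM m_gt0 _ _)); congr (_ *m _); first exact: eV.
  exact: compmx_cmx.
have := cfM F V 0; rewrite big_ord1 subnn -FV.
rewrite -[cf V 0]/(fps_mx0 V) V0 mulmx1 -[cf F 0]/(fps_mx0 F) => <-.
by rewrite cf_Mcmx cf_shift expr0 scale1r -[cf V 0]/(fps_mx0 V) V0 mul1mx.
Qed.

Variables F V : 'M[fps K]_mu.+1.
Hypotheses (V_unit : V \in unitmx) (VE : Z = compmx m V).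
Hypothesis FE : shiftmx Q V *m cmx A0 = F *m V.
Hypothesis FZ : compmx m F = shiftmx q Z *m cmx A0 *m invmx Z.
Hypothesis F0 : fps_mx0 F = A0.
Local Notation chiF := (chi abs absO iota t (mx_laurent F) Q).

Lemma descent_gauge : shiftmx q H *m A *m invmx H = compmx m F.
Proof. by rewrite gauge_system mulmxK. Qed.

Lemma mxE0_compmx_inv (M : 'M[fps K]_mu.+1) : mxE0 abs (compmx m M) -> mxE0 abs M.
Proof.
move=> HM a b; apply: (E0_comp_pow_inv p_prime K_char0 na complete abs_p m_gt0).
by have := HM a b; rewrite mxE.
Qed.

Lemma descent_unit : F \in unitmx.
Proof. by rewrite unitmx_fps F0 -unitmx_fps. Qed.

Local Notation mxE0M := (mxE0M p_prime K_char0 na complete abs_p).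
Local Notation mxE0_shift := (mxE0_shift p_prime K_char0 na complete abs_p abs_q).

(** F(x^m) and its inverse are products of analytic elements built from H, A and their inverses;
    [E0_comp_pow_inv] then descends from x^m to X. *)
Lemma descent_E0 : GL_E0 abs F.
Proof.
split; [exact: descent_unit| |].
  apply: mxE0_compmx_inv; rewrite -descent_gauge.
  exact: (mxE0M (mxE0M (mxE0_shift H_E0) A_E0) HV_E0).
apply: mxE0_compmx_inv; rewrite (compmxV m_gt0 descent_unit).
have AV : mxE0 abs (invmx A) by case: A_GL.
have e : invmx (compmx m F) = H *m invmx A *m shiftmx q (invmx H).
  symmetry; apply: invmx_unique; rewrite -descent_gauge.
  rewrite -!mulmxA mulKmx// mulKVmx// -shiftmxM mulmxV// shiftmx1; reflexivity.
rewrite e; exact: (mxE0M (mxE0M H_E0 AV) (mxE0_shift HV_E0)).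
Qed.

Let F_E0 : mxE0 abs F. Proof. by case: descent_E0. Qed.

Let op_V phi C : mbnd abs (op Q A0 V V phi) C <-> mbnd abs (op q A0 Z Z phi) C.
Proof.
rewrite VE -(compmx_op m_gt0 q A0 phi V_unit); split=> B a b.
  by rewrite mxE; apply/(bnd_comp_pow na _ _ m_gt0); exact: B.
by apply/(bnd_comp_pow na _ _ m_gt0); have := B a b; rewrite mxE.
Qed.

(** Dividing by Z instead of Y multiplies the images of Z on the right by Y Z^-1 = H^-1, which is
    bounded. *)
Lemma descent_chi_ge s : rho < s -> s < chiA -> s ^+ m <= chiF.
Proof.
move=> rs sc; have s0 : 0 < s by exact: lt_trans rs.
have s1 : s <= 1 by apply: ltW; apply: lt_le_trans sc _; exact: chi_le1.
have [|C HC] := cover_growth Zc s0 s1; first by rewrite rs.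
have [D HD] := mxE0_bnd p_prime K_char0 na complete abs_p HV_E0.
apply: (solution_chi_upper p_prime K_char0 na complete abs_p Omega_generic Q_not_root1 abs_Q
  V_unit F_E0 FE (C := C * D)); rewrite ?exprn_gt0 ?exprn_ile1 ?(ltW s0)//.
move=> j; apply/op_V; rewrite (op_change q A0 Z Z (qbin Q j) Y_unit) -HVE.
rewrite -exprM [(m * j)%N]mulnC mulrAC; exact: (mbndM na (HC j) HD).
Qed.

(** As Y = H^-1 Z with H^-1 bounded, [op_mul_growth] controls the images of Y divided by Z;
    returning to division by Y costs the bounded factor H. *)
Lemma descent_chi_le tau : rho <= tau -> tau <= 1 -> tau ^+ m < chiF -> tau <= chiA.
Proof.
move=> rt t1 tc; have t0 : 0 < tau by exact: lt_le_trans rt.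
have [w wP] := prim_root_exists K_char0 m_gt0.
have [C C0 HC] := solution_chi_lower p_prime K_char0 na complete abs_p Omega_generic
  Q_not_root1 abs_Q V_unit F_E0 FE (exprn_gt0 m t0) tc.
have [D HD] := mxE0_bnd p_prime K_char0 na complete abs_p HV_E0.
have [D' HD'] := mxE0_bnd p_prime K_char0 na complete abs_p H_E0.
have ZG j : mbnd abs (op q A0 Z Z (qbin Q j)) (C / tau ^+ (j * m)).
  have -> : tau ^+ (j * m) = (tau ^+ m) ^+ j by rewrite mulnC exprM.
  apply: (proj1 (op_V (qbin Q j) _)); exact: HC.
have YZ : Y = invmx H *m Z by rewrite HVE mulmxKV.
apply: (solution_chi_upper p_prime K_char0 na complete abs_p Omega_generic q_not_root1 abs_q
  Y_unit A_E0 YE (C := D * C * D')) => //.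
move=> n; rewrite (op_change q A0 Y Y (qbin q n) Z_unit) -HE mulrAC.
apply: (mbndM na _ HD'); rewrite {1}YZ -mulrA.
exact: (op_mul_growth na q_not_root1 abs_q rho_gt0 rho_le1 q_rho m_gt0 wP unity_rho rt t1 ZG HD).
Qed.

Lemma descent_chi : chiF = chiA ^+ m.
Proof.
have cA0 : 0 <= chiA by apply: ltW; exact: lt_trans rho_chi.
have cF0 : 0 <= chiF.
  apply: le_trans (descent_chi_ge (s := (rho + chiA) / 2) _ _); rewrite ?midf_lt//.
  by rewrite exprn_ge0// divr_ge0// addr_ge0// ltW.
apply/eqP; rewrite eq_le; apply/andP; split; rewrite leNgt; apply/negP => lt.
  have lt1 := ltr_root m_gt0 cA0 cF0 lt.
  have r1 : chiF `^ m%:R^-1 <= 1.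
    rewrite -(ler_pXn2r m_gt0) ?nnegrE ?powR_ge0// real_rootX// expr1n; exact: chi_le1.
  set tau := (chiA + chiF `^ m%:R^-1) / 2.
  have [ct tc] : chiA < tau /\ tau < chiF `^ m%:R^-1 by rewrite /tau !midf_lt.
  have t0 : 0 <= tau by apply: le_trans cA0 (ltW ct).
  have : tau <= chiA.
    apply: descent_chi_le; first exact: ltW (lt_trans rho_chi ct).
      exact: le_trans (ltW tc) r1.
    by rewrite -[ltRHS](real_rootX m_gt0 cF0) (ltr_pXn2r m_gt0) ?nnegrE ?powR_ge0.
  by rewrite leNgt ct.
have lt1 := root_ltr m_gt0 cF0 cA0 lt.
(* The maximum keeps the intermediate radius above rho, where [descent_chi_ge] applies. *)
set z := Num.max rho (chiF `^ m%:R^-1).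
have zc : z < chiA by rewrite gt_max rho_chi.
have [zs sc] : z < (z + chiA) / 2 /\ (z + chiA) / 2 < chiA by rewrite !midf_lt.
have := descent_chi_ge (le_lt_trans _ zs) sc; rewrite le_max lexx => /(_ isT).
rewrite leNgt => /negP; apply; rewrite -[ltLHS](real_rootX m_gt0 cF0).
have rz : chiF `^ m%:R^-1 < (z + chiA) / 2 by apply: le_lt_trans zs; rewrite le_max lexx orbT.
by rewrite (ltr_pXn2r m_gt0) ?nnegrE ?powR_ge0// (le_trans (powR_ge0 _ _) (ltW rz)).
Qed.
End Descent.

Theorem frobenius_descent : exists H F : 'M[fps K]_mu.+1,
  [/\ mxE0 abs H /\ mxE0 abs (invmx H), fps_mx0 H = 1%:M,
      shiftmx q H *m A *m invmx H = map_mx (fps_comp_pow m) F,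
      fps_mx0 F = A0
    & chi abs absO iota t (mx_laurent F) Q = chiA ^+ m /\ GL_E0 abs F].
Proof.
have [Y [Z [Y0 Yu YE Zc dZ]]] := frobenius_cover_exists.
have [F [V [Vu VE FE FZ F0]]] := descent_exists Zc.
exists (Z *m invmx Y), F; split.
  split; first exact: (cover_E0 Zc).
  exact: (mxE0_inv p_prime K_char0 na complete abs_p (cover_E0 Zc) dZ).
  exact: (mx0_cover Yu Y0 (cover_at0 Zc)).
  exact: (descent_gauge Y0 Yu YE Zc erefl FZ).
  exact: F0.
split; first exact: (descent_chi Y0 Yu YE Zc dZ erefl Vu VE FE FZ F0).
exact: (descent_E0 Y0 Yu YE Zc dZ erefl FZ F0).
Qed.
End FrobeniusDescent.

(** * Passage to Laurent series and normalisation of the hypotheses *)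

Section Laurent.
Variable K : fieldType.
Implicit Types (f g : fps K).

Lemma laurent_at0E f : laurent_at0 f%:L = fcoef f 0.
Proof.
rewrite /laurent_at0; set S := [set c | _].
have [g /eqP e ->] := @xgetI _ 0 S (fcoef f 0) (ex_intro2 _ _ f erefl erefl).
by move: e; rewrite tofrac_eq => /eqP ->.
Qed.

Lemma mx_at0_laurent n (M : 'M[fps K]_n) : mx_at0 (mx_laurent M) = fps_mx0 M.
Proof. by apply/matrixP => i j; rewrite !mxE laurent_at0E. Qed.

Lemma laurent_shift_fps (q : K) f : q != 0 -> laurent_shift q f%:L = (fps_shift q f)%:L.
Proof.
move=> q0; have {1}-> : f%:L = f%:L / 1%:L by rewrite tofrac1 divr1.
by rewrite laurent_shiftE ?oner_neq0// rmorph1 tofrac1 divr1.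
Qed.

Lemma mx_laurent_unit n (M : 'M[fps K]_n) : M \in unitmx -> mx_laurent M \in unitmx.
Proof.
move=> u; have e : mx_laurent M *m mx_laurent (invmx M) = 1%:M.
  by rewrite -map_mxM mulmxV// map_mx1.
by have [u1 _] := mulmx1_unit e; exact: u1.
Qed.

Lemma mx_laurent_inv n (M : 'M[fps K]_n) : M \in unitmx ->
  invmx (mx_laurent M) = mx_laurent (invmx M).
Proof.
move=> u; apply: (can_inj (mulKmx (mx_laurent_unit u))).
by rewrite mulmxV ?mx_laurent_unit// -map_mxM mulmxV// map_mx1.
Qed.
End Laurent.

Section NormalForm.
Variables (R : realType) (K : fieldType) (abs : K -> R).
Hypothesis na : nonarch_abs abs.

Lemma mx_abs1 n : mx_abs abs (1%:M : 'M[K]_n.+1) = 1.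
Proof.
apply/eqP; rewrite eq_le; apply/andP; split.
  apply/bigmax_leP; split=> // -[i j] _ /=; rewrite mxE.
  by case: (i == j); rewrite ?(abs1 na) ?(abs0 na).
apply: le_trans (_ : abs ((1%:M : 'M[K]_n.+1) 0 0) <= _); first by rewrite mxE eqxx (abs1 na).
exact: (le_bigmax _ (fun ij : 'I_n.+1 * 'I_n.+1 => abs (1%:M ij.1 ij.2)) (0, 0)).
Qed.

Lemma unitmx_eigenvalue_neq0 n (B : 'M[K]_n) a : B \in unitmx -> eigenvalue B a -> a != 0.
Proof.
move=> Bu /eigenvalueP[v ve v0]; apply: contra_neq v0 => a0.
by rewrite -[v](mulmxK Bu) ve a0 scale0r mul0mx.
Qed.

(** Finitely many strict inequalities leave a common margin; for the eigenvalues of A(0), this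
    margin yields theta < 1. *)
Lemma strict_bound_attained (f : K -> R) (r : seq K) x B : x < B ->
  (forall z, z \in r -> f z < B) ->
  exists s, [/\ x <= s, s < B & forall z, z \in r -> f z <= s].
Proof.
move=> xB; elim: r => [|y r IH] H; first by exists x.
have [|s [xs sB rs]] := IH; first by move=> z zr; apply: H; rewrite inE zr orbT.
exists (Num.max s (f y)); split; first by rewrite le_max xs.
  by rewrite gt_max sB H ?mem_head.
move=> z; rewrite inE => /orP[/eqP ->|/rs zs]; first by rewrite le_max lexx orbT.
by rewrite le_max zs.
Qed.
End NormalForm.

Lemma GL_E0'_mx_laurent (R : realType) (p : nat) (K : closedFieldType) (abs : K -> R) n
  (H : 'M[fps K]_n) : prime p -> [pchar K] =i pred0 -> nonarch_abs abs ->
  abs_complete abs -> abs p%:R = p%:R^-1 -> H \in unitmx ->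
  mxE0 abs H -> mxE0 abs (invmx H) -> GL_E0' abs (mx_laurent H).
Proof.
move=> p_prime K0 na complete abs_p Hu HE HV.
have E f : E0 abs f -> E0' abs f%:L.
  move=> Ef; exists f, 1; split; rewrite ?oner_neq0 ?tofrac1 ?divr1//.
  have := E0_poly p_prime K0 na complete abs_p 1; by rewrite rmorph1.
split; first exact: mx_laurent_unit.
  by move=> i j; rewrite mxE; apply: E.
by move=> i j; rewrite mx_laurent_inv// mxE; apply: E.
Qed.

Section FrobeniusRadius.
Variables (R : realType) (p l : nat) (K : closedFieldType) (abs : K -> R) (pi : K).
Hypotheses (p_prime : prime p) (na : nonarch_abs abs).
Hypothesis abs_p : abs p%:R = p%:R^-1.
Hypothesis piE : pi ^+ p.-1 = - p%:R.
(** The bound given by [unity_sub1_le] for the roots of unity of order p^(l+1); the index l is thus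
    one less than the exponent in m. *)
Let rho := abs pi `^ ((p ^ l)%:R^-1).
Let pl_gt0 : (0 < p ^ l)%N. Proof. by rewrite expn_gt0 prime_gt0. Qed.
Let pi_gt0 := abs_pi_gt0 p_prime na abs_p piE.

Lemma rhoX : rho ^+ (p ^ l) = abs pi.
Proof. by rewrite real_rootX// ltW. Qed.

Lemma rho_gt0 : 0 < rho. Proof. exact: powR_gt0. Qed.

Lemma rho_le1 : rho <= 1.
Proof.
rewrite -(ler_pXn2r pl_gt0) ?nnegrE ?(ltW rho_gt0)// rhoX expr1n.
by rewrite ltW// (abs_pi_lt1 p_prime na abs_p piE).
Qed.

Lemma pi_le_rho : abs pi <= rho.
Proof.
rewrite -rhoX -[leRHS]expr1 ler_wiXn2l ?(ltW rho_gt0) ?rho_le1//.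
Qed.

Lemma rhoX_pow j : rho ^+ (j * p ^ l.+1) = abs pi ^+ (p * j).
Proof. by rewrite mulnC expnS [(p * _)%N]mulnC -mulnA exprM rhoX. Qed.

Lemma unity_sub1_rho z : z ^+ (p ^ l.+1) = 1 -> abs (z - 1) <= rho.
Proof.
move=> z1; rewrite -(ler_pXn2r pl_gt0) ?nnegrE ?(ltW rho_gt0) ?(abs_ge0 na)// rhoX.
exact: (unity_sub1_le p_prime na abs_p piE z1).
Qed.
End FrobeniusRadius.
Theorem mainTheorem3 (R : realType) (p : nat) (p_prime : prime p)
  (K : closedFieldType) (abs : K -> R)
  (K_char0 : [pchar K] =i pred0)
  (abs_nonarch : nonarch_abs abs) (K_complete : abs_complete abs)
  (abs_p : abs p%:R = p%:R^-1)
  (q pi pi_q : K)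
  (abs_q : abs q = 1)
  (q_not_root1 : forall n, (0 < n)%N -> q ^+ n != 1)
  (q_reduction : reduction_algebraic abs p q)
  (piE : pi ^+ p.-1 = - p%:R)
  (pi_qE : (fun n : nat => abs (qfact q n) `^ (n%:R^-1)) @ \oo --> abs pi_q)
  (q_near1 : abs (1 - q) < abs pi)
  (pi_pi_q : abs pi = abs pi_q)
  (Omega : closedFieldType) (absO : Omega -> R)
  (iota : {rmorphism K -> Omega}) (t : Omega)
  (Omega_generic : generic_extension abs absO iota t)
  (l mu : nat) (l_gt0 : (0 < l)%N) (mu_gt0 : (0 < mu)%N)
  (A : 'M[laurent K]_mu)
  (A_class : class_H abs absO iota t p l q pi_q A)
  (A_normal : normal_form abs p l q A) :
  exists H F : 'M[fps K]_mu,
    [/\ GL_E0' abs (mx_laurent H) /\ (forall i j, E0 abs (H i j)),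
        [/\ fps_mx0 H \in unitmx, mx_abs abs (fps_mx0 H) = 1
          & mx_abs abs (invmx (fps_mx0 H)) = 1],
        map_mx (laurent_shift q) (mx_laurent H) *m A *m invmx (mx_laurent H)
          = mx_laurent (map_mx (fps_comp_pow (p ^ l)) F),
        eigenvalue (mx_at0 A) =1 eigenvalue (fps_mx0 F)
      & chi abs absO iota t (mx_laurent F) (q ^+ (p ^ l))
          = chi abs absO iota t A q ^+ (p ^ l)
        /\ GL_E0 abs F].
Proof.
case: mu mu_gt0 A A_class A_normal => // mu _ A1 A_class A_normal.
(* From here on l is the exponent of the statement minus 1, so that m = p^(l+1) and rho is the
   p^l-th root of |pi|. *)
case: l l_gt0 A_class A_normal => // l _ [_ _ A0_unit _ chi_gt] [[A AE A_GL] eigen small].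
move: A0_unit chi_gt eigen small; rewrite {}AE mx_at0_laurent /= -pi_pi_q.
set rho := abs pi `^ _; move=> A0_unit chi_gt eigen small; set m := (p ^ l.+1)%N.
have m_gt0 : (0 < m)%N by rewrite expn_gt0 prime_gt0.
have q_lt : abs (q - 1) < abs pi by rewrite (abs_subC abs_nonarch).
have q_neq0 : q != 0 by rewrite -(abs_gt0 abs_nonarch) abs_q ltr01.
have q1 : 0 < abs (q - 1) by rewrite (abs_gt0 abs_nonarch) subr_eq0 -[q]expr1 q_not_root1.
have pR : 0 < p%:R :> R by rewrite ltr0n prime_gt0.
have nonres a b : eigenvalue (fps_mx0 A) a -> eigenvalue (fps_mx0 A) b ->
    forall i, (0 < i)%N -> a != q ^+ i * b.
  move=> ea eb i i0; apply/eqP => ab; have [e|ne] := eigen a b ea eb; last first.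
    by apply: (ne i%:Z); rewrite ab mulrC.
  have b0 := unitmx_eigenvalue_neq0 A0_unit eb.
  have := q_not_root1 i i0; rewrite -(inj_eq (mulIf b0)) -ab e mul1r eqxx => //.
have absm : abs (m%:R : K) = p%:R ^- l.+1.
  by rewrite /m natrX (absX abs_nonarch) abs_p exprVn.
have Q1E : abs (q ^+ m - 1) = p%:R ^- l.+1 * abs (q - 1).
  by rewrite (abs_pow_sub1 p_prime abs_nonarch abs_p piE)// absm.
have Q1_lt : abs (q ^+ m - 1) < abs pi.
  rewrite Q1E; apply: le_lt_trans q_lt; rewrite ler_piMl ?(ltW q1)// -absm.
  exact: abs_nat_le1.
have [r cE] := closed_field_poly_normal (char_poly (fps_mx0 A)).
rewrite (monicP (char_poly_monic _)) scale1r in cE.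
have rE a : (a \in r) = eigenvalue (fps_mx0 A) a.
  by rewrite eigenvalue_root_char cE root_prod_XsubC.
have Q1_gt0 : 0 < abs (q ^+ m - 1) by rewrite (abs_gt0 abs_nonarch) subr_eq0 q_not_root1.
(* As |Q - 1| = p^-(l+1) |q - 1|, the smallness condition on an eigenvalue a reads |a - 1| < p |Q -
   1|, the form required by [qbin_small_eigen]. *)
have [||s [Qs sp rs]] := @strict_bound_attained R K (fun a => abs (a - 1)) r
    (abs (q ^+ m - 1)) (p%:R * abs (q ^+ m - 1)).
  by rewrite ltr_pMl// (_ : 1 = 1%:R)// ltr_nat prime_gt1.
  move=> a; rewrite rE => /small; rewrite (absM abs_nonarch) (absV abs_nonarch).
  rewrite (_ : 1 - l.+1%:Z = - l%:Z); last by lia.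
  rewrite -exprnN ltr_pdivrMr// Q1E exprS invfM !mulrA mulfV ?gt_eqF// mul1r.
  by [].
have abs_Q : abs (q ^+ m) = 1 by rewrite (absX abs_nonarch) abs_q expr1n.
have [C [theta [C0 th0 th1 bound]]] := qbin_small_eigen p_prime abs_nonarch abs_p piE
  Q1_lt (q_not_root1 m m_gt0) abs_Q Qs sp
  (fun a ea => rs a (etrans (rE a) ea)).
have [||H [F [[HE HVE] H0 HF F0 [chiE F_GL]]]] := @frobenius_descent R p K Omega abs absO
  iota t p_prime K_char0 abs_nonarch K_complete abs_p Omega_generic q m rho q_not_root1 abs_q
  (rho_gt0 l p_prime abs_nonarch abs_p piE) (rho_le1 l p_prime abs_nonarch abs_p piE)
  (le_trans (ltW q_lt) (pi_le_rho l p_prime abs_nonarch abs_p piE)) m_gt0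
  (unity_sub1_rho (l := l) p_prime abs_nonarch abs_p piE) mu A A_GL nonres C theta th0 th1.
  move=> j; rewrite rhoX_pow//; exact: bound.
  exact: chi_gt.
have Hu : H \in unitmx by rewrite unitmx_fps H0 unitmx1.
exists H, F; split.
  split; last exact: HE.
  exact: (GL_E0'_mx_laurent p_prime K_char0 abs_nonarch K_complete abs_p Hu HE HVE).
  by rewrite H0 invmx1 unitmx1 !(mx_abs1 abs_nonarch).
  have -> : map_mx (laurent_shift q) (mx_laurent H) = mx_laurent (shiftmx q H).
    by apply/matrixP => i j; rewrite !mxE laurent_shift_fps.
  rewrite (mx_laurent_inv Hu) -!map_mxM; congr (mx_laurent _); exact: HF.
  by rewrite F0.
by [].
Qed.
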